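(* Let $n\ge1$ and let $c$ be a positive integer. Let $k_1\ge k_2\ge\cdots\ge k_{n+1}\ge0$, $m_1,\dots,m_n\ge0$, $a\ge 0$ and $b_1,\dots,b_n\ge0$ be integers; put $a_1=a$, $a_2=\cdots=a_n=0$, $\sigma_0=0$, $\sigma_s=b_1+\cdots+b_s$. For $s=1,\dots,n+1$ let $z^{(s)}=(z^{(s)}_1,\dots,z^{(s)}_{k_s})$ be variables, $z=(z^{(1)},\dots,z^{(n)})$, $Z^{(s)}=z^{(s)}_1+\cdots+z^{(s)}_{k_s}$. For $1\le s\le n$, $1\le j\le m_s$, let $\lambda^{(s,j)}$ be partitions and $f_{\lambda^{(s,j)}}\in\Lambda_{\mathbb{Q}}$ homogeneous of degree $|\lambda^{(s,j)}|$, and let $X^{(s)}_j,Y^{(s)}_j$ be alphabets independent of $z$. Suppose for every $s$ that $\sum_{j=1}^{m_s}|\lambda^{(s,j)}|\le k_s-k_{s+1}$ and $a+\sigma_s+s\ge sc$. Then \[ \mathrm{CT}_{z}\prod_{s=1}^n\prod_{j=1}^{m_s}f_{\lambda^{(s,j)}}\big[Z^{(s)}Y^{(s)}_j+X^{(s)}_j\big]\prod_{s=1}^{n}\frac{\prod_{i=1}^{k_s}(1/z_i^{(s)})_{a_s}(qz_i^{(s)})_{b_s}\prod_{1\le i<j\le k_s}(z_i^{(s)}/z_j^{(s)})_c(qz_j^{(s)}/z_i^{(s)})_c}{\prod_{i=1}^{k_s}(z_i^{(s)})^{b_s+1-c}\prod_{j=1}^{k_{s+1}}\prod_{i=1}^{k_s}(q^{b_s+1-c}z_i^{(s)}/z_j^{(s+1)})_c}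 \] equals \[ (-1)^{\sum_{s}k_s(b_s+1-c)}q^{\sum_{s}k_s\binom{b_s+2-c}{2}}\prod_{s=1}^n\prod_{j=1}^{m_s}f_{\lambda^{(s,j)}}\Big[\frac{q^{a+\sigma_{s-1}+(s-1)(1-c)}-q^{c-b_s-1}}{1-q^c}Y^{(s)}_j+X^{(s)}_j\Big] \prod_{s=1}^nM_{k_s}\big(a+\sigma_s+s(1-c),c-1,c\big)\prod_{j=1}^{k_{n+1}}(1/z^{(n+1)}_j)_{a+\sigma_n+n(1-c)}. \]
   Context: $q$ is an indeterminate; $(y)_m=(1-y)(1-yq)\cdots(1-yq^{m-1})$, $(y)_0=1$. $\mathrm{CT}_z$ is the constant term in all variables of $z$; each inverse factor $(1-d\,z_i^{(s)}/z_j^{(s+1)})^{-1}$, $d\in\mathbb{Q}(q)$, is expanded as $\sum_{m\ge0}(d\,z_i^{(s)}/z_j^{(s+1)})^m$. $M_k(A,B,c)=\prod_{i=0}^{k-1}\frac{(q)_{A+B+ic}(q)_{(i+1)c}}{(q)_{A+ic}(q)_{B+ic}(q)_c}$; $\binom{m}{2}=m(m-1)/2$ for every integer $m$. $\Lambda_{\mathbb{Q}}$ is the ring of symmetric functions over $\mathbb{Q}$, with power sums $p_r$. Plethysm: for an expression $A$ (a rational function/formal series in variables such as $q$, the $z$'s and letters of alphabets, with rational coefficients), $p_r[A]$ is obtained from $A$ by replacing every variable $v$ by $v^r$; $f[A]$ is obtained by writing $f$ as a polynomial in the $p_r$ and substituting $p_r\mapsto p_r[A]$. An alphabet is a formal sum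 $x_1+x_2+\cdots$ of variables; a product of alphabets $XY$ is the sum of all products of letters. *)

(* Defs.v *)
From HB Require Import structures.
From mathcomp Require Import all_boot all_order all_algebra.
From mathcomp Require Import all_classical.
From mathcomp Require Import finmap monalg.

Set Implicit Arguments.
Unset Strict Implicit.
Unset Printing Implicit Defensive.
Import GRing.Theory.

Local Open Scope classical_set_scope.
Local Open Scope ring_scope.

(* Monomials with integer exponents in the variables V are written additively:
   the exponent vector e : {malg int[V]} stands for \prod_x x ^ (e@_x).
   A formal Laurent series is the function sending e to the coefficient of
   that monomial. *)
Definition fser (K : fieldType) (V : choiceType) : Type := {malg int[V]} -> K.

Section FormalSeries.
Context {K : fieldType} {V : choiceType}.
Implicit Types (F G : fser K V) (d : K) (u e : {malg int[V]}).

Definition fmon d u : fser K V := fun e => if e == u then d else 0.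

Definition fone : fser K V := fmon 1 0.

Definition fadd F G : fser K V := fun e => F e + G e.

Definition fscale d F : fser K V := fun e => d * F e.

(* \sum_(_ \in _) is the sum over the indices with a nonzero summand (and is 0
   if these are infinitely many). Series in finitely many variables x whose
   exponents lie in a finite set plus a fixed pointed finitely generated cone,
   times letters with nonnegative exponents, form a ring in which all these
   sums are finite. All products used below live there: the expansions only
   involve nonnegative powers of the ratios z^(s)_i / z^(s+1)_j. *)
Definition fmul F G : fser K V :=
  fun e => \sum_(u \in [set: {malg int[V]}]) (F u * G (e - u)).

(* 1 / (1 - d * u) expanded as \sum_(m >= 0) (d * u) ^ m *)
Definition fgeom d u : fser K V :=
  fun e => \sum_(m \in [set m : nat | u *+ m = e]) d ^+ m.

(* the alphabet with set of letters S, i.e. the formal sum \sum_(x in S) x *)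
Definition falph (S : set V) : fser K V :=
  fun e => if `[< exists2 x, S x & e = << x >> >] then 1 else 0.

(* constant term in the variables of D; the other variables are kept *)
Definition CT (D : set V) F : fser K V :=
  fun e => if `[< forall x, D x -> e@_x = 0 >] then F e else 0.

End FormalSeries.

Declare Scope fser_scope.
Delimit Scope fser_scope with S.

Notation "F *s G" := (fmul F G) (at level 40, left associativity) : fser_scope.
Notation "F +s G" := (fadd F G) (at level 50, left associativity) : fser_scope.
Notation "\fprod_ ( m <= i < n ) F" :=
  (\big[fmul/fone]_(m <= i < n) F%S)
  (at level 41, F at level 41, i, m, n at level 50,
   format "'[' \fprod_ ( m  <=  i  <  n ) '/  '  F ']'") : fser_scope.

(* Elements of \Lambda_Q: symmetric formal power series of bounded degree in
   countably many variables. *)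
Definition edeg (V : choiceType) (e : {malg int[V]}) : int :=
  \sum_(x <- msupp e) e@_x.

Definition symfun (f : fser rat nat) : Prop :=
  [/\ forall e, f e != 0 -> forall i, 0 <= e@_i,
      exists d : nat, forall e, f e != 0 -> edeg e <= d%:Z
    & forall (w : nat -> nat) e e', bijective w ->
        (forall i, e'@_i = e@_(w i)) -> f e' = f e].

Definition homogeneous (d : nat) (f : fser rat nat) : Prop :=
  forall e, f e != 0 -> edeg e = d%:Z.

Definition psum (r : nat) : fser rat nat :=
  fun e => if `[< exists i : nat, e = << r%:Z *g i >> >] then 1 else 0.

(* P is a polynomial in the power sums, its variable number i standing for
   p_(i+1); the result is P with p_r replaced by p r. *)
Definition psubst (K : fieldType) (V : choiceType) (p : nat -> fser K V)
    (P : {malg rat[{cmonom nat}]}) : fser K V :=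
  fun e => \sum_(t <- msupp P) ratr P@_t *
    (\big[fmul/fone]_(i <- finsupp t) \big[fmul/fone]_(j < t i) p i.+1) e.

Definition Qq : fieldType := {fraction {poly rat}}.
Definition q : Qq := tofrac ('X : {poly rat}).

(* the substitution q |-> q ^ r in Q(q), for r > 0 *)
Definition qsubst (r : nat) (d : Qq) : Qq :=
  let u : {ratio {poly rat}} := repr (d : {fraction {poly rat}}) in
  (tofrac (\n_u \Po 'X^r) : Qq) / (tofrac (\d_u \Po 'X^r) : Qq).

Section Plethysm.
Context {V : choiceType}.
Implicit Type A : fser Qq V.

(* p_r[A]: every variable, including q, is replaced by its r-th power *)
Definition plethp (r : nat) A : fser Qq V :=
  fun e => \sum_(u \in [set u : {malg int[V]} | u *+ r = e]) qsubst r (A u).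

(* f[A]: write f as a polynomial in the power sums (the expression exists and
   is unique for f in \Lambda_Q), then replace each p_r by p_r[A]. *)
Definition pleth (f : fser rat nat) A : fser Qq V :=
  psubst (plethp ^~ A) (xget 0 [set P | psubst psum P = f]).

(* (d * u)_m *)
Definition fpoch (d : Qq) (u : {malg int[V]}) (m : nat) : fser Qq V :=
  \big[fmul/fone]_(l < m) fadd fone (fmon (- (d * q ^+ l)) u).

(* 1 / (d * u)_m *)
Definition fpochV (d : Qq) (u : {malg int[V]}) (m : nat) : fser Qq V :=
  \big[fmul/fone]_(l < m) fgeom (d * q ^+ l) u.

End Plethysm.

Definition qpoch (y : Qq) (m : nat) : Qq := \prod_(l < m) (1 - y * q ^+ l).

Definition Mcst (k A B c : nat) : Qq :=
  \prod_(i < k) (qpoch q (A + B + i * c) * qpoch q (i.+1 * c) /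
    (qpoch q (A + i * c) * qpoch q (B + i * c) * qpoch q c)).

Definition binz2 (m : int) : int := ((m * (m - 1)) %/ 2)%Z.

Definition is_partition (l : seq nat) : bool := sorted geq l && (0%N \notin l).

Definition sigma (b : nat -> nat) (s : nat) : nat := (\sum_(1 <= t < s.+1) b t)%N.

(* a + sigma_s + s * (1 - c), for s * c <= a + sigma_s + s *)
Definition Aidx (a c : nat) (b : nat -> nat) (s : nat) : nat :=
  (a + sigma b s + s - s * c)%N.

Section Variables.
Context {V : choiceType}.
Implicit Types (z : nat -> nat -> V) (k : nat -> nat).

Definition zlevel z k (s : nat) : set V :=
  [set x | exists2 i, (1 <= i <= k s)%N & x = z s i].

Definition zvars z k (n : nat) : set V :=
  \bigcup_(s in [set s : nat | (1 <= s <= n)%N]) zlevel z k s.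

End Variables.

(* Main.v *)
(* The levels are integrated out one after the other, starting with z^(1).
   For one level z_1, ..., z_k carrying the factor prod_i (1 / z_i)_A, expand
   1 / prod_(i,j) (q ^ (b + 1 - c) z_i / w_j)_c = prod_j sum_n g_n(z) w_j ^ - n,
   where g_n is h_n of the letters q ^ (b - l) z_i with l < c. The generating
   series S(x) of the constant terms of products g_(n_1) ... g_(n_k) against the
   Dyson-type kernel is a polynomial of degree at most k M, M = A + b + 1 - c.
   By the Cauchy identity and Lagrange interpolation it is a sum of residues,
   all of which vanish at x_j = q ^ - r with r < M; so S(x) = S(0) prod_j (x_j)_M,
   and at x_j = q ^ (1 + j c) a single residue survives and gives S(0). Hence
   the constant term functional is, up to S(0), multiplicative on products of at
   most k of the g_n, and by Newton's identities on products of power sums of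
   weight at most k - l when l of the g_n are used up by the w_j. It maps p_r to
   p_r of (q ^ A - q ^ (c - b - 1)) / (1 - q ^ c), and leaves prod_j (1 / w_j)_M,
   which has the shape needed for the next level.
   A homogeneous f is a polynomial in the power sums with all terms of the same
   weight because the power sums are algebraically independent. *)
From HB Require Import structures.
From mathcomp Require Import all_boot all_order all_algebra.
From mathcomp Require Import ring zify.
From mathcomp Require mpoly.

Set Implicit Arguments.
Unset Strict Implicit.
Unset Printing Implicit Defensive.
Import GRing.Theory.
Local Open Scope ring_scope.

(** * Complete symmetric functions and divided differences *)

(** One level is computed in [{mpoly K[k]}], where points can be substituted: pulling B = M + c (k -
    1) powers of each 1 / z_i out of the integrand turns the constant term into the coefficient of
    (z_1 ... z_k) ^ B. This B is just right: in each variable the kernel has degree at most B + k c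
    - 1, the largest without a residue at infinity against k c letters, and its monomials have total
    degree at least k B - k M, which bounds the degree of S. Residues require distinct letters.
    Hence S is studied on the lines t u with u a vector of distinct positive integers: over Q(q)
    such integers do not collide after multiplication by powers of q, and a Kronecker substitution
    recovers all coefficients of S. The series need a ring of their own, since alphabets may be
    infinite and two arbitrary series have no product. Membership is a lower bound on a triangular
    change of the exponents, chosen so that the ratios z^(s)_i / z^(s+1)_j are nonnegative. The
    polynomial results enter through [transfer], with the geometric series truncated. *)

Section SymmetricFunctions.
Context {A : comNzRingType}.
Implicit Types (s : seq A) (x y : A).

Fixpoint hsym s (n : nat) : A :=
  if s is y :: s' then \sum_(i < n.+1) y ^+ i * hsym s' (n - i)
  else (n == 0%N)%:R.

(* (-1) ^ n times the n-th elementary symmetric function. *)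
Fixpoint esgn s (n : nat) : A :=
  match s, n with
  | y :: s', n'.+1 => esgn s' n'.+1 - y * esgn s' n'
  | _, 0 => 1
  | [::], _ => 0
  end.

Definition psym s (r : nat) : A := \sum_(y <- s) y ^+ r.

Lemma hsym0 s : hsym s 0 = 1.
Proof. by elim: s => //= y s IH; rewrite big_ord1 expr0 mul1r subn0 IH. Qed.

Lemma hsymS y s n : hsym (y :: s) n.+1 = hsym s n.+1 + y * hsym (y :: s) n.
Proof.
rewrite /= big_ord_recl expr0 mul1r subn0; congr (_ + _).
rewrite mulr_sumr; apply: eq_bigr => i _.
by rewrite ?lift0 /bump /= ?add1n exprS mulrA subSS.
Qed.

Lemma hsym_nil n : hsym [::] n = (n == 0%N)%:R. Proof. by []. Qed.

Lemma hsym_cons y s n :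
  hsym (y :: s) n = \sum_(i < n.+1) y ^+ i * hsym s (n - i).
Proof. by []. Qed.

Arguments hsym : simpl never.

Lemma esgn0 s : esgn s 0 = 1. Proof. by case: s. Qed.

Lemma prod_esgn s x L : (size s <= L)%N ->
  \prod_(y <- s) (1 - y * x) = \sum_(n < L.+1) esgn s n * x ^+ n.
Proof.
elim: s L => [|y s IH] L hL.
  rewrite big_nil big_ord_recl expr0 mulr1 big1 ?addr0 // => i _.
  by rewrite ?lift0 /bump /= ?add1n mul0r.
rewrite big_cons; case: L hL => // L hL.
rewrite mulrBl mul1r {1}(IH L.+1) ?(ltnW hL) // (IH L) // [RHS]big_ord_recl /=.
rewrite big_ord_recl /= esgn0 -addrA; congr (_ + _).
rewrite mulr_sumr -sumrB; apply: eq_bigr => i _.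
rewrite ?lift0 /bump /= ?add1n exprS; ring.
Qed.

Lemma psym_cons y s r : psym (y :: s) r = y ^+ r + psym s r.
Proof. by rewrite /psym big_cons. Qed.

(** Induction on the alphabet: a new letter y splits [psym] into y ^ r and the old power sum, and
    [hsymS] turns each of the two sums into a known term plus y times the same sum for n - 1. *)
Lemma newton_hsym s n :
  n%:R * hsym s n = \sum_(r < n) psym s r.+1 * hsym s (n - r.+1).
Proof.
elim: s n => [|y s IHs] n.
  rewrite big1; last by move=> i _; rewrite /psym big_nil mul0r.
  by rewrite hsym_nil; case: n => [|n] /=; rewrite ?mul0r ?mulr0.
elim: n => [|n IHn]; first by rewrite big_ord0 mul0r.
have E m : \sum_(r < m.+1) psym s r.+1 * hsym (y :: s) (m.+1 - r.+1) =
   m.+1%:R * hsym s m.+1 + y * \sum_(r < m) psym s r.+1 * hsym (y :: s) (m - r.+1).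
  rewrite IHs !big_ord_recr /= subnn !hsym0 addrAC; congr (_ + _).
  rewrite mulr_sumr -big_split /=; apply: eq_bigr => i _.
  have -> : (m.+1 - i.+1 = (m - i.+1).+1)%N by rewrite subSS subnSK.
  by rewrite hsymS; ring.
have F m : \sum_(r < m.+1) y ^+ r.+1 * hsym (y :: s) (m.+1 - r.+1) =
   y * hsym (y :: s) m + y * \sum_(r < m) y ^+ r.+1 * hsym (y :: s) (m - r.+1).
  rewrite big_ord_recl expr1 subSS subn0; congr (_ + _).
  rewrite mulr_sumr; apply: eq_bigr => i _.
  by rewrite ?lift0 /bump /= ?add1n subSS exprS mulrA.
rewrite (eq_bigr (fun r : 'I_n.+1 => y ^+ r.+1 * hsym (y :: s) (n.+1 - r.+1) +
   psym s r.+1 * hsym (y :: s) (n.+1 - r.+1))); last first.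
  by move=> i _; rewrite psym_cons mulrDl.
rewrite big_split /= E F addrACA -mulrDr -big_split /=.
under eq_bigr do rewrite -mulrDl -psym_cons.
rewrite -IHn.
have := hsymS y s n; rewrite -[n.+1%:R]natr1 => ->; ring.
Qed.

(** This is [newton_hsym] for minus the alphabet: the power sums change sign and [esgn] takes the
    place of [hsym]. [lam_powersums] matches the two identities term by term. *)
Lemma newton_esgn s n :
  n%:R * esgn s n = - \sum_(r < n) psym s r.+1 * esgn s (n - r.+1).
Proof.
elim: s n => [|y s IHs] [|n]; rewrite ?big_ord0 ?mul0r ?oppr0 //.
  by rewrite big1 ?oppr0 /= ?mulr0 // => i _; rewrite /psym big_nil mul0r.
have T m : \sum_(r < m.+1) y ^+ r.+1 * esgn (y :: s) (m.+1 - r.+1) =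
   y * esgn s m.
  elim: m => [|m IHm]; first by rewrite big_ord1 /= esgn0.
  rewrite big_ord_recl subSS subn0 expr1.
  transitivity (y * esgn (y :: s) m.+1 +
     y * \sum_(r < m.+1) y ^+ r.+1 * esgn (y :: s) (m.+1 - r.+1)).
    congr (_ + _); rewrite mulr_sumr; apply: eq_bigr => i _.
    by rewrite ?lift0 /bump /= ?add1n exprS mulrA subSS.
  rewrite IHm /=; ring.
have E m : \sum_(r < m.+1) psym s r.+1 * esgn (y :: s) (m.+1 - r.+1) =
   - (m.+1%:R * esgn s m.+1) - y * \sum_(r < m) psym s r.+1 * esgn s (m - r.+1).
  rewrite IHs opprK !big_ord_recr /= subnn !esgn0 addrAC; congr (_ + _).
  rewrite mulr_sumr -sumrB; apply: eq_bigr => i _.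
  have -> : (m.+1 - i.+1 = (m - i.+1).+1)%N by rewrite subSS subnSK.
  by rewrite /=; ring.
rewrite (eq_bigr (fun r : 'I_n.+1 => y ^+ r.+1 * esgn (y :: s) (n.+1 - r.+1) +
   psym s r.+1 * esgn (y :: s) (n.+1 - r.+1))); last first.
  by move=> i _; rewrite psym_cons mulrDl.
rewrite big_split /= T E.
have -> : \sum_(r < n) psym s r.+1 * esgn s (n - r.+1) = - (n%:R * esgn s n).
  by rewrite IHs opprK.
rewrite -[n.+1%:R]natr1; ring.
Qed.

Lemma hsym_scale a s n : hsym [seq a * y | y <- s] n = a ^+ n * hsym s n.
Proof.
elim: s n => [|y s IH] n.
  by rewrite !hsym_nil; case: n => [|n]; rewrite ?expr0 ?mul1r ?mulr0.
rewrite map_cons !hsym_cons mulr_sumr; apply: eq_bigr => i _.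
rewrite IH exprMn; have -> : a ^+ n = a ^+ i * a ^+ (n - i).
  by rewrite -exprD subnKC // leq_ord.
by ring.
Qed.

Section Filtration.
Variable F : nat -> A -> Prop.
Hypothesis F1 : F 0 1.
Hypothesis FW : forall n x, F n.+1 x -> F n x.
Hypothesis F0 : forall n, F n 0.
Hypothesis FD : forall n x y, F n x -> F n y -> F n (x + y).
Hypothesis FN : forall n x, F n x -> F n (- x).
Hypothesis FM : forall m n x y, F m x -> F n y -> F (m + n) (x * y).

Lemma filt_sum (I : Type) (r : seq I) (P : pred I) (G : I -> A) n :
  (forall i, P i -> F n (G i)) -> F n (\sum_(i <- r | P i) G i).
Proof. by move=> h; apply: big_ind => // x y; apply: FD. Qed.

Lemma filt_exp x n : F 1 x -> F n (x ^+ n).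
Proof. by move=> h; elim: n => [|n IH] //; rewrite exprS -[n.+1]add1n; apply: FM. Qed.

Lemma filt_hsym s n : (forall y, y \in s -> F 1 y) -> F n (hsym s n).
Proof.
elim: s n => [|y s IH] n h; first by rewrite hsym_nil; case: n.
rewrite hsym_cons.
apply: filt_sum => i _; rewrite -[X in F X](subnKC (leq_ord i)).
apply: FM; first by apply: filt_exp; apply: h; rewrite mem_head.
by apply: IH => z hz; apply: h; rewrite inE hz orbT.
Qed.

(** A factor 1 - y telescopes against the truncated sum and leaves only the boundary term y h_L, of
    order L + 1. The filtration is abstract because it serves twice: for the lowest total degree of
    polynomials, and for the negative exponents of some w_j in the series. *)
Lemma filt_hsym_inv s L : (forall y, y \in s -> F 1 y) ->
  F L.+1 ((\prod_(y <- s) (1 - y)) * (\sum_(n < L.+1) hsym s n) - 1).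
Proof.
elim: s => [|y s IH] h.
  rewrite big_nil mul1r big_ord_recl big1 ?addr0 ?hsym_nil ?subrr //.
have hs z : z \in s -> F 1 z by move=> hz; apply: h; rewrite inE hz orbT.
have hy : F 1 y by apply: h; rewrite mem_head.
have E : (1 - y) * (\sum_(n < L.+1) hsym (y :: s) n) =
   \sum_(n < L.+1) hsym s n - y * hsym (y :: s) L.
  elim: L {IH} => [|L IHL].
    by rewrite !big_ord1 !hsym0; ring.
  by rewrite big_ord_recr [in RHS]big_ord_recr /= mulrDr IHL hsymS; ring.
rewrite big_cons [(1 - y) * _]mulrC -mulrA E mulrBr.
have -> (a b c : A) : a - b - c = a - c - b by ring.
apply: FD; first exact: IH.
apply: FN; rewrite -[L.+1]add0n; apply: FM; last first.
  by rewrite -[L.+1]add1n; apply: FM => //; apply: filt_hsym.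
rewrite big_seq; apply: (big_ind (F 0)) => // [x z|z hz]; first exact: (@FM 0 0).
by apply: FD => //; apply: FN; apply: FW; apply: hs.
Qed.
End Filtration.
End SymmetricFunctions.

Arguments hsym : simpl never.

Lemma rmorph_hsym (A B : comNzRingType) (g : {rmorphism A -> B}) (s : seq A) n :
  g (hsym s n) = hsym (map g s) n.
Proof.
elim: s n => [|y s IH] n /=; first by rewrite !hsym_nil rmorph_nat.
by rewrite !hsym_cons rmorph_sum; apply: eq_bigr => i _; rewrite rmorphM rmorphXn IH.
Qed.

Lemma rmorph_esgn (A B : comNzRingType) (g : {rmorphism A -> B}) (s : seq A) n :
  g (esgn s n) = esgn (map g s) n.
Proof.
elim: s n => [|y s IH] [|n] //=; rewrite ?rmorph0 ?rmorph1 //.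
by rewrite rmorphB rmorphM !IH.
Qed.

(** * Divided differences of powers *)

Section Lagrange.
Context {K : fieldType}.
Implicit Types (s : seq K) (y : K).

Definition lagr s y : K := \prod_(x <- s | x != y) (y - x)^-1.

Definition divdiff s (j : nat) : K := \sum_(y <- s) lagr s y * y ^+ j.

Lemma perm_divdiff s s' j : perm_eq s s' -> divdiff s j = divdiff s' j.
Proof.
move=> h; rewrite /divdiff (perm_big _ h) /=; apply: eq_bigr => y _.
by rewrite /lagr (perm_big _ h).
Qed.

(** The factor x - y removes the node y from [lagr] at every other node x, and the term of y itself
    cancels. *)
Lemma divdiff_rec y s j : uniq (y :: s) ->
  divdiff (y :: s) j.+1 - y * divdiff (y :: s) j = divdiff s j.
Proof.
case/andP=> hy us; rewrite /divdiff !big_cons mulrDr opprD addrACA.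
rewrite exprS [y * (lagr _ _ * _)]mulrCA subrr add0r mulr_sumr -sumrB.
rewrite [LHS]big_seq [RHS]big_seq; apply: eq_bigr => x hx.
have hxy : x != y by apply: contraNneq hy => <-.
rewrite /lagr big_cons eq_sym hxy exprS.
have hn : x - y != 0 by rewrite subr_eq0.
transitivity ((x - y) * (x - y)^-1 * (\prod_(z <- s | z != x) (x - z)^-1 * x ^+ j)).
  by ring.
by rewrite divff // mul1r.
Qed.

(** Removing either of two nodes a, b by [divdiff_rec] gives the same value by induction, so b - a
    times the divided difference vanishes. *)
Lemma divdiff0 s : uniq s -> divdiff s 0 = (size s == 1%N)%:R.
Proof.
have [n] := ubnP (size s); elim: n s => // n IH [|a [|b t]] hs us.
- by rewrite /divdiff big_nil.
- by rewrite /divdiff big_seq1 /lagr big_mkcond big_seq1 eqxx /= mul1r.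
have e1 := divdiff_rec 0 us.
have p2 : perm_eq (a :: b :: t) (b :: a :: t).
  by rewrite -[a :: b :: t]/([:: a] ++ [:: b] ++ t) perm_catCA.
have us2 : uniq (b :: a :: t) by rewrite -(perm_uniq p2).
have e2 := divdiff_rec 0 us2.
rewrite -!(perm_divdiff _ p2) in e2.
have hab : a != b by move: us => /= /andP[]; rewrite inE negb_or => /andP[].
have := etrans e1 (etrans (IH (b :: t) hs (proj2 (andP us)))
  (esym (etrans e2 (IH (a :: t) hs (proj2 (andP us2)))))).
move/eqP; rewrite -subr_eq0 => /eqP h.
have : (b - a) * divdiff [:: a, b & t] 0 = 0 by rewrite -h; ring.
by move/eqP; rewrite mulf_eq0 subr_eq0 eq_sym (negPf hab) /= => /eqP.
Qed.

(** [divdiff_rec] and [hsymS] are the same recursion, up to a shift by the number of nodes minus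
    one. *)
Lemma divdiff_hsym s j : uniq s -> s != [::] ->
  divdiff s j = if (j < (size s).-1)%N then 0 else hsym s (j - (size s).-1).
Proof.
elim: s j => // y s IH j us _.
have [->|sn0] := eqVneq s [::].
  rewrite ltn0 subn0 /divdiff big_seq1 /lagr big_mkcond big_seq1 eqxx /= mul1r.
  elim: j => [|j IHj]; rewrite ?hsym0 //.
  by rewrite hsymS hsym_nil add0r exprS IHj.
have sz : (size s = (size s).-1.+1)%N by rewrite prednK // lt0n size_eq0.
elim: j => [|j IHj].
  by rewrite divdiff0 //= eqSS size_eq0 (negPf sn0) sz.
have := divdiff_rec j us => /eqP; rewrite subr_eq => /eqP ->.
rewrite IHj IH ?(andP us) //=; last by case/andP: us.
move: sz; set p := (size s).-1 => sz; rewrite sz !ltnS subSS.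
case: (ltngtP j p) => h; first by rewrite mulr0 addr0.
  have -> : (j - p = (j - p.+1).+1)%N by lia.
  by rewrite hsymS.
by rewrite h subnn !hsym0 mulr0 addr0.
Qed.
End Lagrange.

(** * Constant terms of one level *)

Section MpolyDegrees.
Import mpoly.
Context {K : fieldType} {k : nat}.
Implicit Types (p r : {mpoly K[k]}) (m : 'X_{1..k}).

Definition ldeg (d : nat) p := forall m, p@_m != 0 -> (d <= mdeg m)%N.

Definition xdeg (i : 'I_k) (d : nat) p := forall m, p@_m != 0 -> (m i <= d)%N.

Lemma ldegM d e p r : ldeg d p -> ldeg e r -> ldeg (d + e) (p * r).
Proof.
move=> hp hr m; rewrite -mcoeff_msupp => /msuppM_le /allpairsP[[m1 m2] /= [h1 h2 ->]].
by rewrite mdegD leq_add // ?hp ?hr // -mcoeff_msupp.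
Qed.

Lemma ldegD d p r : ldeg d p -> ldeg d r -> ldeg d (p + r).
Proof.
move=> hp hr m; rewrite mcoeffD.
have [->|h _] := eqVneq (p@_m) 0; last exact: hp.
by rewrite add0r; apply: hr.
Qed.

Lemma ldegN d p : ldeg d p -> ldeg d (- p).
Proof. by move=> hp m; rewrite mcoeffN oppr_eq0; apply: hp. Qed.

Lemma ldeg0 p : ldeg 0 p. Proof. by []. Qed.

Lemma ldegz d : ldeg d 0. Proof. by move=> m; rewrite mcoeff0 eqxx. Qed.

Lemma ldegW d p : ldeg d.+1 p -> ldeg d p.
Proof. by move=> h m /h; apply: ltnW. Qed.

Lemma ldegC d c p : ldeg d p -> ldeg d (c%:MP * p).
Proof. exact: (@ldegM 0 d). Qed.

Lemma ldegX (i : 'I_k) : ldeg 1 'X_i.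
Proof.
move=> m; rewrite mcoeffX; case: (U_(i)%MM =P m) => [<- _|_]; rewrite ?mdeg1 //.
by rewrite eqxx.
Qed.

Lemma xdegM i d e p r : xdeg i d p -> xdeg i e r -> xdeg i (d + e) (p * r).
Proof.
move=> hp hr m; rewrite -mcoeff_msupp => /msuppM_le /allpairsP[[m1 m2] /= [h1 h2 ->]].
by rewrite mnmDE leq_add // ?hp ?hr // -mcoeff_msupp.
Qed.

Lemma xdegD i d p r : xdeg i d p -> xdeg i d r -> xdeg i d (p + r).
Proof.
move=> hp hr m; rewrite mcoeffD.
have [->|h _] := eqVneq (p@_m) 0; last exact: hp.
by rewrite add0r; apply: hr.
Qed.

Lemma xdegN i d p : xdeg i d p -> xdeg i d (- p).
Proof. by move=> hp m; rewrite mcoeffN oppr_eq0; apply: hp. Qed.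

Lemma xdegC i d c : xdeg i d c%:MP.
Proof.
move=> m; rewrite mcoeffC; case: (m =P 0%MM) => [->|_]; first by rewrite mnm0E.
by rewrite mulr0 eqxx.
Qed.

Lemma xdegX i j : xdeg i (i == j) 'X_j.
Proof.
move=> m; rewrite mcoeffX; case: (U_(j)%MM =P m) => [<- _|_].
  by rewrite mnm1E eq_sym.
by rewrite eqxx.
Qed.

Lemma xdegW i d e p : (d <= e)%N -> xdeg i d p -> xdeg i e p.
Proof. by move=> de h m /h /leq_trans; apply. Qed.

Lemma xdeg_prod (I : Type) (s : seq I) (P : pred I) (d : I -> nat)
    (p : I -> {mpoly K[k]}) i :
  (forall j, P j -> xdeg i (d j) (p j)) ->
  xdeg i (\sum_(j <- s | P j) d j) (\prod_(j <- s | P j) p j).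
Proof.
move=> h; elim/big_rec2: _ => [|j d' p' Pj hp].
  by rewrite -mpolyC1; apply: xdegC.
by apply: xdegM => //; apply: h.
Qed.

Lemma ldeg_prod (I : Type) (s : seq I) (P : pred I) (d : I -> nat)
    (p : I -> {mpoly K[k]}) :
  (forall j, P j -> ldeg (d j) (p j)) ->
  ldeg (\sum_(j <- s | P j) d j) (\prod_(j <- s | P j) p j).
Proof.
move=> h; elim/big_rec2: _ => // j d' p' Pj hp.
by apply: ldegM => //; apply: h.
Qed.

End MpolyDegrees.

(** * Coefficients as sums of iterated residues *)

Section IteratedResidue.
Import mpoly.
Context {K : fieldType} {k : nat}.
Implicit Types (p r : {mpoly K[k]}).

Lemma mcoeff_prodsum (a : 'I_k -> nat -> K) L (m : 'X_{1..k}) :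
  (forall i, (m i <= L)%N) ->
  (\prod_i \sum_(n < L.+1) ((a i n)%:MP * 'X_i ^+ n))@_m = \prod_i a i (m i).
Proof.
move=> hm; rewrite bigA_distr_bigA /= raddf_sum /=.
have E (f : {ffun 'I_k -> 'I_L.+1}) :
    \prod_i ((a i (f i))%:MP * 'X_i ^+ f i) =
    (\prod_i a i (f i)) *: 'X_[[multinom f i : nat | i < k]].
  rewrite big_split /= -mul_mpolyC rmorph_prod; congr (_ * _).
  by rewrite [RHS]mpolyXE_id; apply: eq_bigr => i _; rewrite mnmE.
pose f0 : {ffun 'I_k -> 'I_L.+1} := [ffun i => inord (m i)].
have f0E i : f0 i = m i :> nat by rewrite ffunE inordK // ltnS.
rewrite (bigD1 f0) //= E mcoeffZ mcoeffX [X in _ + X]big1 ?addr0.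
  have -> : [multinom (f0 i : nat) | i < k] = m by apply/mnmP => i; rewrite mnmE.
  by rewrite eqxx mulr1; apply: eq_bigr => i _; rewrite f0E.
move=> f hf; rewrite E mcoeffZ mcoeffX; case: eqP => [h|]; rewrite ?mulr0 //.
case/eqP: hf; apply/ffunP => i; apply: val_inj.
by rewrite /= f0E -h mnmE.
Qed.

Lemma mcoeff_mulX p (m m' : 'X_{1..k}) :
  ('X_[m] * p)@_m' = if (m <= m')%MM then p@_(m' - m)%MM else 0.
Proof.
rewrite mulrC; case: ifP => h; first by rewrite -{1}(submK h) addmC mcoeffMX.
apply/eqP; apply/negPn; apply/negP; rewrite -mcoeff_msupp.
rewrite (perm_mem (msuppMX _ _)) => /mapP[m1 _ e].
by move: h; rewrite e lem_addr.
Qed.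

Variables (J : finType) (y : J -> K).
Hypothesis y_inj : injective y.
Hypothesis y_neq0 : forall j, y j != 0.
Hypothesis J0 : (0 < #|J|)%N.

(** The summands are the residues at X_i = 1 / y_j. For a monomial of p with exponents m_i the
    coefficient is the product of the h_(B - m_i), each a divided difference of a power with
    exponent B + |J| - 1 - m_i; the bound on [xdeg] keeps this exponent nonnegative, which excludes
    a residue at infinity. *)
Lemma iterated_residue B L p :
  (k * B <= L)%N -> (forall i, xdeg i (B + #|J|.-1) p) ->
  (p * \prod_i \sum_(n < L.+1) ((hsym (codom y) n)%:MP * 'X_i ^+ n))
    @_[multinom B | i < k] =
  \sum_(rho : {ffun 'I_k -> J})
    (\prod_i (lagr (codom y) (y (rho i)) * y (rho i) ^+ (B + #|J|.-1))) *
    p.@[fun i => (y (rho i))^-1].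
Proof.
move=> hL hp; set W := \prod_i _.
rewrite {1 2}[p]mpolyE mulr_suml raddf_sum /=.
under [RHS]eq_bigr do rewrite raddf_sum /= mulr_sumr.
rewrite exchange_big /= [LHS]big_seq [RHS]big_seq; apply: eq_bigr => m hm.
rewrite -scalerAl mcoeffZ.
under eq_bigr do rewrite mevalZ mulrCA.
rewrite -mulr_sumr; congr (_ * _).
have hmi i : (m i <= B + #|J|.-1)%N by apply: hp; rewrite -mcoeff_msupp.
transitivity (\prod_i \sum_(j : J) lagr (codom y) (y j) * y j ^+ (B + #|J|.-1 - m i)).
  (* For m_i > B the power is too small for its divided difference to survive, in accordance with
     h_n = 0 for negative n. *)
  have R i : \sum_(j : J) lagr (codom y) (y j) * y j ^+ (B + #|J|.-1 - m i) =
      if (m i <= B)%N then hsym (codom y) (B - m i) else 0.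
    have := @divdiff_hsym K (codom y) (B + #|J|.-1 - m i).
    rewrite /divdiff big_map big_enum /= => ->.
    - have -> : (size (codom y)).-1 = #|J|.-1 by rewrite size_codom.
      move: (hmi i); move: #|J|.-1 => r h2.
      case: ltnP => h1; case: leqP => h3 //; try lia.
      by congr (hsym _ _); lia.
    - by rewrite map_inj_uniq // enum_uniq.
    - by rewrite -size_eq0 size_codom -lt0n.
  under eq_bigr do rewrite R.
  rewrite mcoeff_mulX; case: ifPn => h.
    have hB i : (m i <= B)%N by have /mnm_lepP/(_ i) := h; rewrite mnmE.
    rewrite (mcoeff_prodsum (fun _ => hsym (codom y))); last first.
      move=> i; rewrite mnmBE mnmE; apply: leq_trans (leq_subr _ _) _.
      apply: leq_trans hL; by rewrite leq_pmull // (leq_ltn_trans _ (ltn_ord i)).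
    by apply: eq_bigr => i _; rewrite hB mnmBE mnmE.
  have [i hi] : exists i, ~~ (m i <= B)%N.
    apply/existsP; rewrite -negb_forall; apply: contra h => /forallP h.
    by apply/mnm_lepP => i; rewrite mnmE.
  apply/esym/eqP; apply/prodf_eq0; exists i => //; by rewrite (negPf hi).
rewrite bigA_distr_bigA /=; apply: eq_bigr => rho _.
rewrite mevalX -big_split /=; apply: eq_bigr => i _.
rewrite -mulrA; congr (_ * _).
rewrite exprVn; apply: (canRL (mulfK _)); first by rewrite expf_neq0.
by rewrite -exprD subnK.
Qed.
End IteratedResidue.

(* Makes the Kronecker substitution x_j := u ^ (W ^ j) injective on monomials. *)
Lemma digits_inj W k (b b' : 'I_k -> nat) :
  (forall i, (b i < W)%N) -> (forall i, (b' i < W)%N) ->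
  (\sum_i b i * W ^ i = \sum_i b' i * W ^ i)%N -> b =1 b'.
Proof.
elim: k b b' => [|k IH] b b' hb hb'; first by move=> _ [].
rewrite !big_ord_recl !muln1 => E.
have S (d : 'I_k.+1 -> nat) : (\sum_(i < k) d (lift ord0 i) * W ^ (lift ord0 i) =
    W * \sum_(i < k) d (lift ord0 i) * W ^ i)%N.
  by rewrite big_distrr; apply: eq_bigr => i _; rewrite lift0 expnS mulnCA.
rewrite !S in E.
have W0 : (0 < W)%N by apply: leq_ltn_trans (hb ord0).
have e0 : b ord0 = b' ord0.
  have := congr1 (modn^~ W) E.
  by rewrite ![(_ + W * _)%N]addnC ![(W * _)%N]mulnC !modnMDl !modn_small.
have eS : b \o lift ord0 =1 b' \o lift ord0.
  apply: IH => [i|i|]; [exact: hb | exact: hb' |].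
  by apply/eqP; rewrite -(eqn_pmul2l W0); move: E; rewrite e0 => /addnI ->.
by move=> i; case: (unliftP ord0 i) => [j ->|->]; [apply: eS|].
Qed.

Lemma card_other k (i : 'I_k) : (\sum_(j | j != i) 1 = k.-1)%N.
Proof.
rewrite sum1_card; have := cardC1 i; rewrite card_ord => <-.
by apply: eq_card => j; rewrite !inE.
Qed.

Lemma card_gt_lt k (i : 'I_k) :
  (\sum_(j < k | i < j) 1 + \sum_(j < k | j < i) 1 = k.-1)%N.
Proof.
rewrite -(card_other i) [RHS](bigID (fun j : 'I_k => (i < j)%N)) /=.
congr (_ + _)%N; apply: eq_bigl => j; rewrite -(inj_eq val_inj) /=; lia.
Qed.

(** * The kernel of one level and its vanishing factors *)

Section DysonKernel.
Context {K : fieldType} (q kap : K) (k c M : nat).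

(* The integrand of one level up to a constant and a power of the product of
   the Z i, with kap = q ^ b: the factors (1/z)_A (q z)_b merge into a single
   product over M + c - 1 = A + b consecutive powers of q. *)
Definition dyson (A : comNzRingType) (phi : K -> A) (Z : 'I_k -> A) : A :=
  (\prod_i \prod_(l < M + c.-1) (Z i - phi (kap^-1 * q ^+ l))) *
  \prod_(i : 'I_k) \prod_(j : 'I_k | (i < j)%N) \prod_(l < c)
     ((Z j - phi (q ^+ l) * Z i) * (Z i - phi (q ^+ l.+1) * Z j)).

(* The factors q ^ (b + 1 - c) z_i / w_j, ..., q ^ b z_i / w_j of the
   denominator are 1 / w_j times these letters. *)
Definition gletters (A : comNzRingType) (phi : K -> A) (Z : 'I_k -> A) : seq A :=
  [seq phi (kap * q ^- p.2) * Z p.1 | p : 'I_k * 'I_c].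

Lemma rmorph_dyson (A A' : comNzRingType) (g : {rmorphism A -> A'}) phi Z :
  g (dyson phi Z) = dyson (g \o phi) (g \o Z).
Proof.
rewrite rmorphM !rmorph_prod; congr (_ * _).
  apply: eq_bigr => i _; rewrite rmorph_prod; apply: eq_bigr => l _.
  by rewrite rmorphB.
apply: eq_bigr => i _; rewrite rmorph_prod; apply: eq_bigr => j _.
rewrite rmorph_prod; apply: eq_bigr => l _.
by rewrite rmorphM !rmorphB !rmorphM.
Qed.

Lemma eq_dyson (A : comNzRingType) (phi phi' : K -> A) (Z Z' : 'I_k -> A) :
  phi =1 phi' -> Z =1 Z' -> dyson phi Z = dyson phi' Z'.
Proof.
move=> e e'; rewrite /dyson; congr (_ * _).
  by apply: eq_bigr => i _; apply: eq_bigr => l _; rewrite e e'.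
by do 3![apply: eq_bigr => ? _]; rewrite !e !e'.
Qed.

Lemma eq_gletters (A : comNzRingType) (phi phi' : K -> A) (Z Z' : 'I_k -> A) :
  phi =1 phi' -> Z =1 Z' -> gletters phi Z = gletters phi' Z'.
Proof. by move=> e e'; apply: eq_map => p; rewrite e e'. Qed.

Lemma dyson_eq0_root (A : comNzRingType) phi (Z : 'I_k -> A) i (l : nat) :
  (l < M + c.-1)%N -> Z i = phi (kap^-1 * q ^+ l) -> dyson phi Z = 0.
Proof.
move=> hl e; rewrite /dyson (bigD1 i) //= (bigD1 (Ordinal hl)) //= e subrr.
by rewrite !mul0r.
Qed.

Lemma dyson_eq0_pair (A : comNzRingType) phi (Z : 'I_k -> A) (a b : 'I_k) (l : nat) :
  (a < b)%N -> (l < c)%N ->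
  Z b = phi (q ^+ l) * Z a \/ Z a = phi (q ^+ l.+1) * Z b -> dyson phi Z = 0.
Proof.
move=> ab hl e; rewrite /dyson [X in _ * X](bigD1 a) //= [X in _ * (X * _)](bigD1 b) //=.
rewrite [X in _ * ((X * _) * _)](bigD1 (Ordinal hl)) //=.
by case: e => <-; rewrite subrr ?mul0r ?mulr0 ?mul0r ?mulr0.
Qed.

Lemma big_gletters (A : comNzRingType) (T : Type) (idx : T) (op : Monoid.com_law idx)
    phi (Z : 'I_k -> A) (F : A -> T) :
  \big[op/idx]_(y <- gletters phi Z) F y =
  \big[op/idx]_(i < k) \big[op/idx]_(l < c) F (phi (kap * q ^- l) * Z i).
Proof. by rewrite big_image /= pair_bigA. Qed.

Lemma gletterP (A : comNzRingType) phi (Z : 'I_k -> A) y : y \in gletters phi Z ->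
  exists i (m : 'I_c), y = phi (kap * q ^- m) * Z i.
Proof. by case/imageP => p _ ->; exists p.1, p.2. Qed.

Lemma map_gletters (A A' : comNzRingType) (g : {rmorphism A -> A'}) phi Z :
  map g (gletters phi Z) = gletters (g \o phi) (g \o Z).
Proof.
rewrite /gletters /image_mem -map_comp; apply: eq_map => p.
by rewrite /= rmorphM.
Qed.

End DysonKernel.

(** * The coefficient functional of one level *)

Section Core.
Import mpoly.
Context {K : fieldType} (q kap : K) (k c M : nat).
Hypothesis c_gt0 : (0 < c)%N.

Let phi : K -> {mpoly K[k]} := @mpolyC k K.
Let X (i : 'I_k) : {mpoly K[k]} := 'X_i.
Let D : {mpoly K[k]} := dyson q kap c M phi X.
Let g (n : nat) : {mpoly K[k]} := hsym (gletters q kap c phi X) n.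
(** The exponent of each 1 / z_i pulled out of the integrand: M from (1/z_i)_A together with the
    monomial 1 / z_i ^ (b + 1 - c), and c from each of the k - 1 pairs containing z_i. *)
Let B := (M + c * k.-1)%N.
Let B1 : 'X_{1..k} := [multinom B | i < k].

Definition gcoef (b : 'I_k -> nat) : K := (D * \prod_j g (b j))@_B1.

(** X_i occurs in M + c - 1 root factors and in 2 c factors for each of its k - 1 pairs. For k > 0
    the bound equals B + k c - 1, exactly what [iterated_residue] permits with k c letters. *)
Lemma xdeg_dyson i : xdeg i (M + c.-1 + 2 * c * k.-1) D.
Proof.
apply: xdegM.
  have := @xdeg_prod K k 'I_k (index_enum _) xpredT
    (fun j => (\sum_(l < M + c.-1) (i == j))%N)
    (fun j => \prod_(l < M + c.-1) (X j - phi (kap^-1 * q ^+ l))) i.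
  have -> : (\sum_j \sum_(l < M + c.-1) (i == j) = M + c.-1)%N.
    rewrite (bigD1 i) //= eqxx sum_nat_const card_ord muln1 big1 ?addn0 // => j.
    by rewrite eq_sym => /negPf ->; rewrite big1.
  apply => j _; apply: xdeg_prod => l _.
  by apply: xdegD; [apply: xdegX | apply: xdegN; apply: xdegC].
have := @xdeg_prod K k 'I_k (index_enum _) xpredT
    (fun a : 'I_k => (\sum_(b < k | a < b) \sum_(l < c)
       (((i == b) || (i == a)) + ((i == b) || (i == a)))%N)%N)
    (fun a => \prod_(j : 'I_k | (a < j)%N) \prod_(l < c)
     ((X j - phi (q ^+ l) * X a) * (X a - phi (q ^+ l.+1) * X j))) i.
have -> : (\sum_(a < k) \sum_(b < k | a < b) \sum_(l < c)
   (((i == b) || (i == a)) + ((i == b) || (i == a)))%N = 2 * c * k.-1)%N.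
  transitivity (\sum_(a < k) \sum_(b < k | a < b) (2 * c * (i == b) + 2 * c * (i == a)))%N.
    apply: eq_bigr => a _; apply: eq_bigr => b hab.
    rewrite sum_nat_const card_ord.
    have : ~~ ((i == b) && (i == a)).
      by apply/negP => /andP[/eqP e1 /eqP e2]; move: hab; rewrite -e1 -e2 ltnn.
    by case: (i == b); case: (i == a) => //= _; lia.
  under eq_bigr do rewrite big_split /=.
  rewrite big_split /= addnC -(card_gt_lt i) mulnDr; congr (_ + _)%N.
    rewrite (bigD1 i) //= eqxx [X in (_ + X)%N]big1 ?addn0.
      by rewrite big_distrr /=; apply: eq_bigr.
    by move=> a; rewrite eq_sym => /negPf ->; rewrite muln0 big1.
  under eq_bigr do rewrite big_mkcond /=.
  rewrite exchange_big /= (bigD1 i) //= eqxx [X in (_ + X)%N]big1 ?addn0.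
    by rewrite big_distrr [RHS]big_mkcond; apply: eq_bigr => a _; case: ifP.
  by move=> a; rewrite eq_sym => /negPf ->; rewrite muln0 big1 // => b _; rewrite if_same.
apply => a _; apply: xdeg_prod => b _; apply: xdeg_prod => l _.
have xX j e : xdeg i ((i == j) || e) (X j).
  by apply: xdegW (@xdegX K k i j); case: (i == j).
have xX' j e : xdeg i (e || (i == j)) (X j).
  by apply: xdegW (@xdegX K k i j); case: (i == j); rewrite ?orbT.
have xC d r n : xdeg i n r -> xdeg i n (phi d * r)
  by exact: (@xdegM K k i 0 n _ _ (@xdegC K k i 0 d)).
apply: xdegM; apply: xdegD; [exact: xX | apply: xdegN; apply: (xC) |
  exact: xX' | apply: xdegN; apply: (xC)]; [exact: xX' | exact: xX].
Qed.

Lemma ldeg_dyson : ldeg (c * (k * k.-1)) D.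
Proof.
rewrite -[(c * _)%N]add0n; apply: ldegM; first exact: ldeg0.
have := @ldeg_prod K k 'I_k (index_enum _) xpredT
    (fun a => (\sum_(b < k | a < b) \sum_(l < c) (1 + 1))%N)
    (fun a => \prod_(j : 'I_k | (a < j)%N) \prod_(l < c)
     ((X j - phi (q ^+ l) * X a) * (X a - phi (q ^+ l.+1) * X j))).
have -> : (\sum_(a < k) \sum_(b < k | a < b) \sum_(l < c) (1 + 1) = c * (k * k.-1))%N.
  transitivity (c * (\sum_(a < k) \sum_(b < k | a < b) 1 + \sum_(a < k) \sum_(b < k | a < b) 1))%N.
    rewrite -big_split /= big_distrr; apply: eq_bigr => a _.
    rewrite -big_split /= big_distrr; apply: eq_bigr => b _.
    by rewrite sum_nat_const card_ord.
  congr (c * _)%N.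
  have {2}-> : (\sum_(a < k) \sum_(b < k | a < b) 1 = \sum_(a < k) \sum_(b < k | b < a) 1)%N.
    under eq_bigr do rewrite big_mkcond /=.
    by rewrite exchange_big /=; apply: eq_bigr => a _; rewrite [RHS]big_mkcond.
  rewrite -big_split /=; under eq_bigr do rewrite card_gt_lt.
  by rewrite sum_nat_const card_ord.
apply => a _; apply: ldeg_prod => b _; apply: ldeg_prod => l _.
by apply: ldegM; apply: ldegD; try apply: ldegN; try apply: ldegC; apply: ldegX.
Qed.

Lemma filt_ldeg (s : seq {mpoly K[k]}) n : (forall y, y \in s -> ldeg 1 y) ->
  ldeg n (hsym s n).
Proof.
apply: (@filt_hsym _ (@ldeg K k)) => //.
- exact: ldegz.
- exact: ldegD.
- exact: ldegM.
Qed.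

Lemma ldeg_hsym_inv (s : seq {mpoly K[k]}) L : (forall y, y \in s -> ldeg 1 y) ->
  ldeg L.+1 ((\prod_(y <- s) (1 - y)) * (\sum_(n < L.+1) hsym s n) - 1).
Proof.
apply: (@filt_hsym_inv _ (@ldeg K k)) => //.
- exact: ldegW.
- exact: ldegz.
- exact: ldegD.
- exact: ldegN.
- exact: ldegM.
Qed.

Lemma ldeg_gletters y :
  y \in gletters q kap c phi X -> ldeg 1 y.
Proof. by case/imageP => p _ ->; apply: ldegC; apply: ldegX. Qed.

Lemma mdeg_B1 : mdeg B1 = (k * B)%N.
Proof.
rewrite mdegE (eq_bigr (fun=> B)) ?sum_nat_const ?card_ord // => i _.
by rewrite mnmE.
Qed.

(* The Dyson kernel already uses up degree c k (k - 1) of the k B available. *)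
Lemma gcoef_eq0 b : (k * M < \sum_j b j)%N -> gcoef b = 0.
Proof.
move=> h; apply/eqP/negPn/negP => /(ldegM ldeg_dyson) H.
have := H (\sum_j b j)%N _; rewrite mdeg_B1 => {}H.
have /H : ldeg (\sum_j b j) (\prod_j g (b j)).
  by apply: ldeg_prod => j _; apply: filt_ldeg => y; apply: ldeg_gletters.
rewrite /B; move: h; nia.
Qed.

Lemma ldeg_prod1 (I : finType) (p : I -> {mpoly K[k]}) n :
  (forall i, ldeg n (p i - 1)) -> ldeg n (\prod_i p i - 1).
Proof.
move=> h; elim/big_rec: _ => [|i r _ hr]; first by rewrite subrr; apply: ldegz.
have -> : p i * r - 1 = (p i - 1) * r + (r - 1) by ring.
by apply: ldegD => //; rewrite -[n]addn0; apply: ldegM.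
Qed.

Let yl (x : 'I_k -> K) : seq K := gletters q kap c id x.

(** Both products invert E, the product of all 1 - kap q ^ - l x_j X_i, up to terms of degree above
    L: one groups its factors by j, the other by i. *)
Lemma cauchy_kernel (x : 'I_k -> K) L :
  ldeg L.+1 (\prod_j (\sum_(n < L.+1) (x j ^+ n)%:MP * g n) -
     \prod_i (\sum_(n < L.+1) (hsym (yl x) n)%:MP * 'X_i ^+ n)).
Proof.
set U := \prod_j _; set W := \prod_i (\sum_(n < L.+1) (hsym (yl x) n)%:MP * _).
pose E := \prod_(i : 'I_k) \prod_(j : 'I_k) \prod_(l < c)
   (1 - phi (kap * q ^- l * x j) * X i).
have EU : ldeg L.+1 (E * U - 1).
  have -> : E = \prod_j \prod_(y <- [seq phi (x j) * y | y <- gletters q kap c phi X]) (1 - y).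
    rewrite /E exchange_big /=; apply: eq_bigr => j _.
    rewrite big_map big_gletters; apply: eq_bigr => a _; apply: eq_bigr => l _.
    by rewrite /phi !mpolyCM; ring.
  rewrite -big_split /=; apply: ldeg_prod1 => j.
  have -> : \sum_(n < L.+1) (x j ^+ n)%:MP * g n =
     \sum_(n < L.+1) hsym [seq phi (x j) * y | y <- gletters q kap c phi X] n.
    by apply: eq_bigr => n _; rewrite hsym_scale /phi rmorphXn.
  apply: ldeg_hsym_inv => y /mapP[y' /ldeg_gletters hy ->]; exact: ldegC.
have EW : ldeg L.+1 (E * W - 1).
  have -> : E = \prod_i \prod_(y <- [seq X i * y | y <- map phi (yl x)]) (1 - y).
    apply: eq_bigr => i _.
    rewrite big_map [in RHS]big_map /yl big_gletters; apply: eq_bigr => a _; apply: eq_bigr => l _.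
    by rewrite /phi !mpolyCM; ring.
  rewrite -big_split /=; apply: ldeg_prod1 => i.
  have -> : \sum_(n < L.+1) (hsym (yl x) n)%:MP * 'X_i ^+ n =
     \sum_(n < L.+1) hsym [seq X i * y | y <- map phi (yl x)] n.
    by apply: eq_bigr => n _; rewrite hsym_scale mulrC (rmorph_hsym (@mpolyC k K)).
  apply: ldeg_hsym_inv => y /mapP[y' _ ->]; rewrite mulrC -[1%N]add0n.
  by apply: ldegM; [|exact: ldegX].
have -> : U - W = W * (E * U - 1) - U * (E * W - 1) by ring.
by apply: ldegD; [|apply: ldegN]; rewrite -[L.+1]add0n; apply: ldegM.
Qed.

Let gsum (x : 'I_k -> K) L : K :=
  \sum_(b : {ffun 'I_k -> 'I_L.+1}) gcoef (fun j => b j) * \prod_j x j ^+ b j.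

(** With L at least k B the error in [cauchy_kernel] lies above the degree of the monomial [B1] and
    does not reach its coefficient. *)
Lemma gsumE x L : (k * B <= L)%N -> gsum x L =
  (D * \prod_i (\sum_(n < L.+1) (hsym (yl x) n)%:MP * 'X_i ^+ n))@_B1.
Proof.
move=> hL; have := ldegM (@ldeg0 _ _ D) (@cauchy_kernel x L).
rewrite mulrBr add0n => /(_ B1) H.
transitivity ((D * \prod_j (\sum_(n < L.+1) (x j ^+ n)%:MP * g n))@_B1).
  rewrite bigA_distr_bigA /= mulr_sumr raddf_sum /=; apply: eq_bigr => b _.
  by rewrite big_split /= -rmorph_prod mulrCA mcoeffCM mulrC.
apply/eqP; rewrite -subr_eq0 -mcoeffB; apply/negPn/negP => /H.
rewrite mdeg_B1; lia.
Qed.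

Let yv (x : 'I_k -> K) (p : 'I_k * 'I_c) : K := kap * q ^- p.2 * x p.1.

Lemma gsum_residue x L : (0 < k)%N -> (k * B <= L)%N ->
  injective (yv x) -> (forall p, yv x p != 0) ->
  gsum x L = \sum_(rho : {ffun 'I_k -> 'I_k * 'I_c})
    (\prod_i (lagr (yl x) (yv x (rho i)) * yv x (rho i) ^+ (B + (k * c).-1))) *
    dyson q kap c M id (fun i => (yv x (rho i))^-1).
Proof.
move=> hk hL yi y0; rewrite gsumE //.
have cJ : #|{: 'I_k * 'I_c}| = (k * c)%N by rewrite card_prod !card_ord.
have := @iterated_residue K k _ (yv x) yi y0 _ B L D hL.
rewrite cJ => ->; first last.
- move=> i; apply: xdegW (@xdeg_dyson i); rewrite /B.
  case: (k) hk => // k' _ /=; case: (c) c_gt0 => // c' _ /=; nia.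
- by rewrite muln_gt0 hk.
apply: eq_bigr => rho _; congr (_ * _).
rewrite (rmorph_dyson _ _ _ _ (meval (fun i => (yv x (rho i))^-1))).
congr (_ * _).
  apply: eq_bigr => i _; apply: eq_bigr => l _.
  by rewrite /= mevalXU mevalC.
do 3![apply: eq_bigr => ? _].
by rewrite /= !mevalXU !mevalC.
Qed.

Hypothesis q_neq0 : q != 0.
Hypothesis kap_neq0 : kap != 0.
(** Combines three facts about Q(q): characteristic 0, q is not a root of unity, and no nonzero
    power of q is a quotient of positive integers. *)
Hypothesis q_generic : forall n u v : nat, (0 < n)%N -> (0 < u)%N -> (0 < v)%N ->
  u%:R * q ^+ n != v%:R.

Lemma generic_natr n : (0 < n)%N -> n%:R != 0 :> K.
Proof.
move=> n0; apply/negP => /eqP e; have := @q_generic 1 n n isT n0 n0.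
by rewrite e mul0r eqxx.
Qed.

Lemma generic_natr_inj u v : u%:R = v%:R :> K -> u = v.
Proof.
wlog le : u v / (u <= v)%N => [H|].
  by case/orP: (leq_total u v) => h e; [apply: H | apply/esym; apply: H].
move=> e; apply/eqP; rewrite eqn_leq le leqNgt /= -subn_gt0.
apply/negP => /generic_natr; rewrite natrB // e subrr eqxx //.
Qed.

Lemma generic_ratio u v a b : (0 < u)%N -> (0 < v)%N ->
  u%:R * q ^+ a = v%:R * q ^+ b -> a = b /\ u = v.
Proof.
wlog le : u v a b / (a <= b)%N => [H|].
  case/orP: (leq_total a b) => h hu hv e; first exact: H.
  by have [-> ->] := H v u b a h hv hu (esym e).
move=> hu hv; rewrite -(subnK le) exprD mulrA => /(mulIf _) e.
have {}e := e (expf_neq0 _ q_neq0).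
have [h|h] := posnP (b - a).
  split; first by lia.
  by apply: generic_natr_inj; rewrite e h expr0 mulr1.
by have := q_generic h hv hu; rewrite e eqxx.
Qed.

Section Generic.
Variables (t : K) (u : 'I_k -> nat).
Hypotheses (t0 : t != 0) (u_inj : injective u) (u_gt0 : forall i, (0 < u i)%N).
Let x i := t * (u i)%:R.

Lemma generic_yv_neq0 p : yv x p != 0.
Proof.
by rewrite !mulf_neq0 ?generic_natr // invr_neq0 // expf_neq0.
Qed.

Lemma generic_yv_inj : injective (yv x).
Proof.
move=> [i l] [i' l']; rewrite /yv /x /= => e.
have h (n : nat) : q ^+ n != 0 by rewrite expf_neq0.
have E : (u i)%:R * q ^+ l' = (u i')%:R * q ^+ l.
  have e' : kap * t * ((u i)%:R / q ^+ l) = kap * t * ((u i')%:R / q ^+ l').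
    transitivity (kap * q ^- l * (t * (u i)%:R)); first by ring.
    by rewrite e; ring.
  move/(mulfI (mulf_neq0 kap_neq0 t0)): e' => /eqP.
  by rewrite eqr_div // => /eqP.
have [e1 e2] := generic_ratio (u_gt0 i) (u_gt0 i') E.
by congr pair; [apply: u_inj | apply: val_inj].
Qed.
End Generic.

(** The reciprocals of two letters of the same x_j differ by a factor q ^ d with |d| < c. The sign
    of d decides which of the two kinds of pair factors vanishes. *)
Lemma dyson_same x (rho : {ffun 'I_k -> 'I_k * 'I_c}) (a b : 'I_k) :
  (a < b)%N -> (rho a).1 = (rho b).1 ->
  dyson q kap c M id (fun i => (yv x (rho i))^-1) = 0.
Proof.
move=> ab e; have la := ltn_ord (rho a).2; have lb := ltn_ord (rho b).2.
have [h|h] := leqP (rho a).2 (rho b).2.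
  apply: (@dyson_eq0_pair K q kap k c M K id _ a b ((rho b).2 - (rho a).2)%N ab); first lia.
  left; rewrite /yv -e !invfM !invrK.
  have -> : q ^+ (rho b).2 = q ^+ ((rho b).2 - (rho a).2) * q ^+ (rho a).2.
    by rewrite -exprD subnK.
  by ring.
apply: (@dyson_eq0_pair K q kap k c M K id _ a b ((rho a).2 - (rho b).2.+1)%N ab); first lia.
right; rewrite /yv -e !invfM !invrK.
have -> : q ^+ (rho a).2 = q ^+ ((rho a).2 - (rho b).2.+1).+1 * q ^+ (rho b).2.
  by rewrite -exprD; congr (_ ^+ _); lia.
by ring.
Qed.

(* For x_j = q ^ - r with r < M every term of the residue sum vanishes: either
   two variables take letters of the same x_j, which kills a Dyson factor, or
   some variable takes a letter of x_j and is a root of the first product. *)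
Lemma gsum_vanish x L j (r : nat) : (k * B <= L)%N ->
  injective (yv x) -> (forall p, yv x p != 0) -> (r < M)%N -> x j = q ^- r ->
  gsum x L = 0.
Proof.
move=> hL yi y0 hr hx.
have k0 : (0 < k)%N by apply: leq_ltn_trans (ltn_ord j).
rewrite gsum_residue // big1 // => rho _.
have hq (l : nat) : q ^+ l != 0 by rewrite expf_neq0.
suff -> : dyson q kap c M id (fun i => (yv x (rho i))^-1) = 0 by rewrite mulr0.
case: (boolP (injectiveb (fun i => (rho i).1))) => [/injectiveP inj|/injectivePn].
  have [i hi] : exists i, (rho i).1 = j.
    by exists (invF inj j); apply: (f_invF inj).
  (* The reciprocal letter is kap ^ - 1 q ^ (r + l) with r <= M - 1 and l <= c - 1, always one of
     the M + c - 1 roots of the first product. *)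
  have hl : (r + (rho i).2 < M + c.-1)%N by have := ltn_ord (rho i).2; lia.
  apply: (dyson_eq0_root (i := i) hl).
  by rewrite /yv hi hx !invfM !invrK exprD /= -mulrA [_ ^+ _ * q ^+ r]mulrC.
case=> a [b]; wlog ab : a b / (a < b)%N => [H|].
  case: (ltngtP a b) => h nab e; first exact: (H a b).
    by apply: (H b a) => //; rewrite eq_sym.
  by case/eqP: nab; apply: val_inj.
move=> _ e.
exact: dyson_same ab e.
Qed.

Let zero_exp : 'I_k -> nat := fun=> 0%N.

Lemma gcoef_ext b b' : b =1 b' -> gcoef b = gcoef b'.
Proof.
by move=> h; rewrite /gcoef; congr ((_ * _)@_ _); apply: eq_bigr => j _; rewrite h.
Qed.

(* Both sides, taken at t u, are polynomials of degree at most k M in t that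
   agree at 0 and at the k M zeros 1 / (q ^ r u_j) of the right-hand side. *)
Lemma gsum_generic (u : 'I_k -> nat) L :
  (k * B <= L)%N -> injective u -> (forall i, (0 < u i)%N) ->
  gsum (fun i => (u i)%:R) L =
  gcoef zero_exp * \prod_i \prod_(r < M) (1 - q ^+ r * (u i)%:R).
Proof.
move=> hL u_inj u_gt0.
pose pl : {poly K} := \sum_(b : {ffun 'I_k -> 'I_L.+1})
  (gcoef (fun j => b j) * \prod_j (u j)%:R ^+ b j) *: 'X^(\sum_j b j).
pose pr : {poly K} := gcoef zero_exp *:
  \prod_i \prod_(r < M) (1 - (q ^+ r * (u i)%:R) *: 'X).
have plE t : pl.[t] = gsum (fun i => t * (u i)%:R) L.
  rewrite horner_sum; apply: eq_bigr => b _.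
  rewrite hornerZ hornerXn -mulrA; congr (_ * _).
  by rewrite expr_sum mulrC -big_split; apply: eq_bigr => j _; rewrite exprMn.
have prE t : pr.[t] = gcoef zero_exp * \prod_i \prod_(r < M) (1 - q ^+ r * (u i)%:R * t).
  rewrite hornerZ horner_prod; congr (_ * _); apply: eq_bigr => i _.
  by rewrite horner_prod; apply: eq_bigr => r _; rewrite hornerD hornerN hornerZ hornerX hornerC.
suff E : pl - pr = 0.
  have := congr1 (horner^~ 1) E; rewrite hornerD hornerN horner0 plE prE.
  move/eqP; rewrite subr_eq0 => /eqP e.
  transitivity (gsum (fun i => 1 * (u i)%:R) L).
    by apply: eq_bigr => b _; congr (_ * _); apply: eq_bigr => j _; rewrite mul1r.
  rewrite e; congr (_ * _); apply: eq_bigr => i _; apply: eq_bigr => r _.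
  by rewrite mulr1.
pose rs := 0 :: [seq (q ^+ p.2 * (u p.1)%:R)^-1 | p : 'I_k * 'I_M].
have un0 i : (u i)%:R != 0 :> K by rewrite generic_natr.
have qn0 n : q ^+ n != 0 by rewrite expf_neq0.
apply: (@roots_geq_poly_eq0 _ _ rs).
- apply/allP => t; rewrite inE => /orP[/eqP ->|/imageP[[j r] _ ->]] /=.
    rewrite /root hornerD hornerN plE prE subr_eq0; apply/eqP.
    rewrite [X in _ * X]big1 ?mulr1; last first.
      by move=> i _; rewrite big1 // => r _; rewrite mulr0 subr0.
    rewrite /gsum (bigD1 [ffun=> ord0]) //= [X in _ + X]big1 ?addr0.
      rewrite big1 ?mulr1; last by move=> j _; rewrite ffunE expr0.
      by apply: gcoef_ext => j; rewrite ffunE.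
    move=> b hb; have [j hj] : exists j, b j != ord0.
      apply/existsP; rewrite -negb_forall; apply: contra hb => /forallP hb.
      by apply/eqP/ffunP => j; rewrite ffunE; apply/eqP/hb.
    rewrite (bigD1 j) //= mul0r expr0n -val_eqE /= in hj *.
    by rewrite (negPf hj) mul0r mulr0.
  clear t; set t := _^-1; have t0 : t != 0 by rewrite invr_neq0 // mulf_neq0.
  rewrite /root hornerD hornerN plE prE (@gsum_vanish _ _ j r) //.
  - rewrite sub0r oppr_eq0 (bigD1 j) //= (bigD1 r) //= mulfV ?subrr ?mul0r ?mulr0 //.
    by rewrite mulf_neq0.
  - exact: generic_yv_inj.
  - exact: generic_yv_neq0.
  - by rewrite /t invfM mulfVK.
- rewrite /rs /=; apply/andP; split.
    apply/negP => /imageP[[j r] _] /esym/eqP.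
    by rewrite invr_eq0 mulf_eq0 (negPf (qn0 _)) (negPf (un0 _)).
  rewrite map_inj_uniq ?enum_uniq // => -[j r] [j' r'] /= /invr_inj.
  rewrite ![_ * (u _)%:R]mulrC => /generic_ratio [] // e1 e2.
  by congr pair; [apply: u_inj | apply: val_inj].
- rewrite /rs /= size_map -cardE card_prod !card_ord.
  apply: leq_trans (size_polyD _ _) _; rewrite size_polyN geq_max; apply/andP; split.
    apply: leq_trans (size_sum _ _ _) _; apply/bigmax_leqP => b _.
    have [h|h] := leqP (\sum_j b j) (k * M).
      by apply: leq_trans (size_scale_leq _ _) _; rewrite size_polyXn.
    by rewrite gcoef_eq0 // mul0r scale0r size_poly0.
  apply: leq_trans (size_scale_leq _ _) _.
  rewrite pair_bigA /=.
  apply: leq_trans (size_prod_leq _ _) _ => /=.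
  have S (p : 'I_k * 'I_M) : (size (1 - (q ^+ p.2 * (u p.1)%:R) *: 'X : {poly K})%R <= 2)%N.
    apply: leq_trans (size_polyD _ _) _; rewrite size_polyN geq_max size_poly1 /=.
    by apply: leq_trans (size_scale_leq _ _) _; rewrite size_polyX.
  rewrite card_prod !card_ord leq_subLR.
  apply: (@leq_trans (\sum_(p : 'I_k * 'I_M) 2).+1).
    by rewrite ltnS; apply: leq_sum => p _.
  by rewrite sum_nat_const card_prod !card_ord; lia.
Qed.

(* The coefficient of x ^ n in (x)_M. *)
Definition qcoef (n : nat) : K := esgn [seq q ^+ r | r <- iota 0 M] n.

Lemma prod_qcoef x L : (M <= L)%N ->
  \prod_(r < M) (1 - q ^+ r * x) = \sum_(n < L.+1) qcoef n * x ^+ n.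
Proof.
move=> hL; rewrite -prod_esgn ?size_map ?size_iota // big_map.
have -> : iota 0 M = index_iota 0 M by rewrite /index_iota subn0.
by rewrite big_mkord.
Qed.

(** With x_j := u ^ (W ^ j) the difference of the two generating series becomes a polynomial [Q] in
    u, one exponent vector per power of u. It vanishes at every integer u >= 2 by [gsum_generic], so
    all its coefficients are 0. *)
Lemma gcoefE b : gcoef b = gcoef zero_exp * \prod_j qcoef (b j).
Proof.
(* W exceeds every digit, these being at most L, and is at least 2, so that the powers W ^ j and
   hence the points u ^ (W ^ j) are distinct. *)
pose L := (k * B + M + \sum_j b j)%N; pose W := L.+2.
have hL : (k * B <= L)%N by rewrite /L; lia.
have hLM : (M <= L)%N by rewrite /L; lia.
have hb j : (b j < L.+1)%N.
  by rewrite ltnS /L (bigD1 j) //=; lia.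
pose a (d : {ffun 'I_k -> 'I_L.+1}) : K :=
  gcoef (fun j => d j) - gcoef zero_exp * \prod_j qcoef (d j).
pose N (d : {ffun 'I_k -> 'I_L.+1}) := (\sum_j d j * W ^ j)%N.
have N_inj : injective N.
  move=> d d' /(@digits_inj W) h; apply/ffunP => j; apply: val_inj.
  by apply: h => i; apply: leqW; apply: ltn_ord.
suff a0 d : a d = 0.
  have /eqP := a0 [ffun j => Ordinal (hb j)]; rewrite subr_eq0 => /eqP.
  rewrite (@gcoef_ext _ b) => [->|j]; last by rewrite ffunE.
  by congr (_ * _); apply: eq_bigr => j _; rewrite ffunE.
pose Q : {poly K} := \sum_(d : {ffun 'I_k -> 'I_L.+1}) a d *: 'X^(N d).
have Q0 : Q = 0.
  apply: (@roots_geq_poly_eq0 _ _ [seq (i.+2)%:R | i <- iota 0 (size Q)]).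
  - apply/allP => _ /mapP[i _ ->]; apply/eqP.
    rewrite horner_sum.
    have u_inj : injective (fun j : 'I_k => i.+2 ^ (W ^ j))%N.
      by move=> j j' /= /eqP; rewrite eqn_exp2l // eqn_exp2l // => /eqP /val_inj.
    have u_gt0 (j : 'I_k) : (0 < i.+2 ^ (W ^ j))%N by rewrite expn_gt0.
    have H := gsum_generic hL u_inj u_gt0.
    transitivity (gsum (fun j : 'I_k => (i.+2 ^ W ^ j)%N%:R) L -
        gcoef zero_exp * \prod_(j < k) \prod_(r < M) (1 - q ^+ r * (i.+2 ^ W ^ j)%N%:R));
      last by rewrite H subrr.
    under [X in _ - _ * X]eq_bigr do rewrite (prod_qcoef _ hLM).
    rewrite bigA_distr_bigA /= mulr_sumr -sumrB; apply: eq_bigr => e _.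
    rewrite hornerZ hornerXn /a mulrBl; congr (_ - _).
      congr (_ * _); rewrite /N expr_sum; apply: eq_bigr => j _.
      by rewrite natrX -exprM mulnC.
    rewrite -mulrA; congr (_ * _); rewrite /N expr_sum -big_split.
    by apply: eq_bigr => j _; rewrite natrX -exprM mulnC.
  - by rewrite map_inj_uniq ?iota_uniq // => i j /generic_natr_inj [].
  - by rewrite size_map size_iota.
have := congr1 (fun p : {poly K} => p`_(N d)) Q0.
rewrite coef0 coef_sum (bigD1 d) //= coefZ coefXn eqxx mulr1 big1 ?addr0 //.
move=> d' hd; rewrite coefZ coefXn; case: eqP => [/N_inj e|]; last by rewrite mulr0.
by rewrite e eqxx in hd.
Qed.

(** As an identity between coefficients it holds at every x. The special point used next is in
    general not of the form t u with integers u_j. *)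
Lemma gsum_prod x L : (M <= L)%N ->
  gsum x L = gcoef zero_exp * \prod_j \prod_(r < M) (1 - q ^+ r * x j).
Proof.
move=> hL; under [X in _ * X]eq_bigr do rewrite (prod_qcoef _ hL).
rewrite bigA_distr_bigA /= mulr_sumr; apply: eq_bigr => d _.
by rewrite gcoefE big_split mulrA.
Qed.

(** * Evaluation of the constant *)

Section Constant.
(* At x_j = q ^ (1 + j c) the residue sum has a single nonzero term, which
   determines gcoef zero_exp. *)
Let xs (j : 'I_k) : K := q ^+ (1 + j * c).
Let q0n n : q ^+ n != 0. Proof. by rewrite expf_neq0. Qed.

Lemma one_sub_qX n : (0 < n)%N -> 1 - q ^+ n != 0.
Proof.
move=> h; rewrite subr_eq0 eq_sym; have := @q_generic n 1 1 h isT isT.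
by rewrite mul1r.
Qed.

Lemma qX_inj n n' : q ^+ n = q ^+ n' -> n = n'.
Proof.
by move=> e; have := @generic_ratio 1 1 n n' isT isT; rewrite !mul1r => /(_ e) [].
Qed.

Lemma special_neq0 p : yv xs p != 0.
Proof. by rewrite /yv /xs !mulf_neq0 ?invr_neq0 ?q0n. Qed.

(** The letters are kap q ^ (1 + j c - l); by division with remainder by c their exponents run
    through an interval without repetition. *)
Lemma special_inj : injective (yv xs).
Proof.
move=> [j l] [j' l']; rewrite /yv /xs /= -!mulrA => /(mulfI kap_neq0).
rewrite ![q ^- _ * _]mulrC => /eqP; rewrite eqr_div // -!exprD => /eqP /qX_inj.
move=> e; have hl := ltn_ord l; have hl' := ltn_ord l'.
have [e1 e2] : j = j' :> nat /\ l = l' :> nat.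
  suff e1 : j = j' :> nat by split => //; move: e; rewrite e1; lia.
  by case: (ltngtP j j') => // h; nia.
by congr pair; apply: val_inj.
Qed.

Let Z (rho : {ffun 'I_k -> 'I_k * 'I_c}) i := (yv xs (rho i))^-1.

(** By [dyson_same] each x_n is used once. If x_0 is used with l > 0, the reciprocal letter kap ^ -
    1 q ^ (l - 1) is a root. Let a and b be the variables at x_n and x_(n+1), the first with l = 0,
    the second with some l; then Z_a = q ^ (c - l) Z_b. If a < b, this kills a pair factor; if b <
    a, it does so unless l = 0. So all l are 0 and the positions decrease as n grows. *)
Lemma special_rho (rho : {ffun 'I_k -> 'I_k * 'I_c}) :
  dyson q kap c M id (Z rho) != 0 ->
  forall i, rho i = (rev_ord i, Ordinal c_gt0).
Proof.
move=> nz.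
have inj : injective (fun i => (rho i).1).
  apply/injectiveP/negPn/negP => /injectivePn[a [b]].
  wlog ab : a b / (a < b)%N => [H|].
    case: (ltngtP a b) => h nab e; first exact: (H a b).
      by apply: (H b a) => //; rewrite eq_sym.
    by case/eqP: nab; apply: val_inj.
  by move=> _ e; case/eqP: nz; apply: dyson_same ab e.
have ZE i : Z rho i = kap^-1 * q ^+ (rho i).2 / q ^+ (1 + (rho i).1 * c).
  by rewrite /Z /yv /xs !invfM !invrK.
pose pos := invF inj.
have posE j : (rho (pos j)).1 = j by apply: (f_invF inj).
have step n (hn : (n < k)%N) : (rho (pos (Ordinal hn))).2 = 0%N :> nat /\
   forall hm : (n.-1 < k)%N, (0 < n)%N -> (pos (Ordinal hn) < pos (Ordinal hm))%N.
  elim: n hn => [|n IH] hn.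
    split => //; apply/eqP; rewrite -leqn0 leqNgt; apply/negP => h.
    have hl := ltn_ord (rho (pos (Ordinal hn))).2.
    case/eqP: nz; apply: (dyson_eq0_root (i := pos (Ordinal hn))
       (l := (rho (pos (Ordinal hn))).2.-1)); first lia.
    rewrite ZE posE /= mul0n addn0 expr1.
    by rewrite -{1}(prednK h) exprSr mulrA mulfK.
  have hm : (n < k)%N by apply: ltnW.
  have [IH1 _] := IH hm.
  set a := pos (Ordinal hm) in IH1; set b := pos (Ordinal hn).
  have ra : (rho a).1 = n :> nat by rewrite /a posE.
  have rb : (rho b).1 = n.+1 :> nat by rewrite /b posE.
  have nab : a != b.
    by apply/eqP => e; have := ra; rewrite e rb; lia.
  have hl := ltn_ord (rho b).2.
  have E : Z rho a = q ^+ (c - (rho b).2) * Z rho b.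
    rewrite !ZE ra rb IH1 expr0 mulr1.
    apply: (mulIf (q0n (1 + n.+1 * c))).
    rewrite -[RHS]mulrA mulfVK // [RHS]mulrCA -exprD subnK; last exact: ltnW.
    have -> : q ^+ (1 + n.+1 * c) = q ^+ (1 + n * c) * q ^+ c.
      by rewrite -exprD; congr (_ ^+ _); lia.
    by rewrite mulrA mulfVK.
  have ba : (b < a)%N.
    rewrite ltn_neqAle eq_sym; apply/andP; split; first by rewrite (inj_eq val_inj).
    rewrite leqNgt; apply/negP => ab; case/eqP: nz.
    apply: (@dyson_eq0_pair K q kap k c M K id _ a b (c - (rho b).2).-1 ab); first lia.
    by right; rewrite prednK ?subn_gt0.
  split; last by move=> hm' _; rewrite (_ : Ordinal hm' = Ordinal hm) //; apply: val_inj.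
  apply/eqP; rewrite -leqn0 leqNgt; apply/negP => h; case/eqP: nz.
  apply: (@dyson_eq0_pair K q kap k c M K id _ b a (c - (rho b).2) ba); first lia.
  by left.
(* A strictly decreasing enumeration of all k positions is the reversal; [up] and [down] squeeze
   [pos] from both sides. *)
have up n (hn : (n < k)%N) : (pos (Ordinal hn) <= k.-1 - n)%N.
  elim: n hn => [|n IH] hn.
    by rewrite subn0 -ltnS prednK // ltn_ord.
  have hm : (n < k)%N by apply: ltnW.
  have [_ /(_ hm isT) lt] := step _ hn.
  have := leq_trans lt (IH hm); lia.
have down m n (hn : (n < k)%N) : (k.-1 - n = m)%N -> (m <= pos (Ordinal hn))%N.
  elim: m n hn => [|m IH] n hn e //.
  have hn1 : (n.+1 < k)%N by lia.
  have [_ /(_ hn isT) lt] := step _ hn1.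
  by apply: leq_ltn_trans lt; apply: IH; lia.
move=> i; have iE : i = pos (rho i).1 by rewrite /pos (invF_f inj).
have e1 : (rho i).1 = rev_ord i.
  apply: val_inj => /=; have hn := ltn_ord (rho i).1.
  have := up _ hn; have := down _ _ hn erefl.
  rewrite (_ : Ordinal hn = (rho i).1); last exact: val_inj.
  rewrite -iE; lia.
rewrite [LHS]surjective_pairing e1; congr pair; apply: val_inj => /=.
have [h _] := step _ (ltn_ord (rho i).1); move: h.
by rewrite (_ : Ordinal _ = (rho i).1) -?iE //; apply: val_inj.
Qed.

Definition qp (n : nat) : K := \prod_(l < n) (1 - q ^+ l.+1).

Lemma qp_neq0 n : qp n != 0.
Proof. by apply/prodf_neq0 => l _; apply: one_sub_qX. Qed.

Lemma qpS n : qp n.+1 = qp n * (1 - q ^+ n.+1).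
Proof. by rewrite /qp big_ord_recr. Qed.

Lemma qp_tail m n : \prod_(l < m) (1 - q ^+ (1 + n + l)) = qp (m + n) / qp n.
Proof.
elim: m => [|m IH]; first by rewrite big_ord0 divff ?qp_neq0.
have -> : (m.+1 + n = (m + n).+1)%N by [].
rewrite big_ord_recr qpS /= IH mulrAC.
by have -> : (1 + n + m = (m + n).+1)%N by lia.
Qed.

Lemma prod_below (F : nat -> K) (j : 'I_k) :
  \prod_(i < k | (i < j)%N) F (j - i)%N = \prod_(d < j) F d.+1.
Proof.
rewrite -(big_ord_widen_cond _ xpredT (fun i => F (j - i)%N)) ?(ltnW (ltn_ord j)) //.
rewrite (reindex_inj rev_ord_inj) /=; apply: eq_bigr => d _.
by congr F; have := ltn_ord d; lia.
Qed.

Let Y (j : 'I_k) : K := yv xs (j, Ordinal c_gt0).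

Let YE j : Y j = kap * q ^+ (1 + j * c).
Proof. by rewrite /Y /yv /= expr0 invr1 mulr1. Qed.

Let Y0 j : Y j != 0. Proof. exact: special_neq0. Qed.

Let yv_ratio i (l : 'I_c) j :
  yv xs (i, l) / Y j = q ^+ (1 + i * c) / (q ^+ (1 + j * c) * q ^+ l).
Proof.
rewrite YE /yv /xs /=; set w := q ^+ (1 + i * c); set w' := q ^+ (1 + j * c).
set w2 := q ^+ l; have h : w' != 0 by apply: q0n.
have h2 : w2 != 0 by apply: q0n.
by field; rewrite kap_neq0 h h2.
Qed.

(** Contributions to the surviving residue that depend only on an index difference d: [A] and [A']
    come from the letters of an x_i with i = j - d and i = j + d, [P] from the pair factors of the
    kernel. [S] comes from the remaining letters of x_j itself. *)
Let A (d : nat) : K := \prod_(l < c) (1 - q ^- (d * c + l))^-1.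
Let A' (d : nat) : K := \prod_(l < c) (1 - q ^+ (d * c - l))^-1.
Let P (d : nat) : K :=
  \prod_(l < c) ((1 - q ^- (d * c - l)) * (1 - q ^+ (d * c + l.+1))).
Let S : K := \prod_(l < c | l != Ordinal c_gt0) (1 - q ^- l)^-1.

(** The power of Y j normalizes the k c - 1 differences Y j - y to 1 - y / Y j, a function of the
    exponent difference alone. *)
Lemma lagr_special j : lagr (yl xs) (Y j) * Y j ^+ (k * c).-1 =
  (\prod_(i < k | (i < j)%N) A (j - i)) * (\prod_(i < k | (j < i)%N) A' (i - j)) * S.
Proof.
have -> : lagr (yl xs) (Y j) * Y j ^+ (k * c).-1 =
    \prod_(p : 'I_k * 'I_c | p != (j, Ordinal c_gt0)) (1 - yv xs p / Y j)^-1.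
  rewrite /lagr /yl /gletters big_image_cond /=.
  rewrite (eq_bigl (fun p : 'I_k * 'I_c => p != (j, Ordinal c_gt0))); last first.
    by move=> p /=; rewrite -(inj_eq special_inj).
  have -> : Y j ^+ (k * c).-1 = \prod_(p : 'I_k * 'I_c | p != (j, Ordinal c_gt0)) Y j.
    rewrite prodr_const; congr (_ ^+ _).
    by have := cardC1 (j, Ordinal c_gt0); rewrite card_prod !card_ord => <-; apply: eq_card.
  rewrite -big_split; apply: eq_bigr => p _ /=.
  have -> : 1 - yv xs p / Y j = (Y j - yv xs p) / Y j by rewrite mulrBl divff.
  by rewrite invfM invrK.
rewrite big_mkcond /= -(pair_bigA _ (fun i l => if (i, l) != (j, Ordinal c_gt0)
   then (1 - yv xs (i, l) / Y j)^-1 else 1)) /= (bigD1 j) //=.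
rewrite mulrC; congr (_ * _); last first.
  rewrite /S [RHS]big_mkcond; apply: eq_bigr => l _.
  rewrite xpair_eqE eqxx /=; case: ifP => // _.
  congr ((1 - _)^-1); rewrite yv_ratio invfM mulrA divff ?mul1r //.
rewrite (bigID (fun i : 'I_k => (i < j)%N)) /=; congr (_ * _).
  apply: eq_big => [i|i /andP[/negPf ij lt]].
    by rewrite -(inj_eq val_inj) /=; lia.
  apply: eq_bigr => l _; rewrite xpair_eqE ij /=.
  congr ((1 - _)^-1); rewrite yv_ratio -exprD.
  have -> : (1 + j * c + l = (j - i) * c + l + (1 + i * c))%N by nia.
  by rewrite [q ^+ (_ + _ + _)]exprD invfM mulrCA divff ?mulr1.
apply: eq_big => [i|i /andP[/negPf ij lt]].
  by rewrite -(inj_eq val_inj) /=; lia.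
apply: eq_bigr => l _; rewrite xpair_eqE ij /=.
congr ((1 - _)^-1); rewrite yv_ratio -exprD.
have hl := ltn_ord l.
have -> : (1 + i * c = (i - j) * c - l + (1 + j * c + l))%N.
  have : (j < i)%N by move: lt ij; rewrite -(inj_eq val_inj) /=; lia.
  nia.
by rewrite exprD mulfK.
Qed.

Lemma dyson_special :
  dyson q kap c M id (fun i => (Y (rev_ord i))^-1) =
  (\prod_j ((Y j)^-1 ^+ (M + c.-1 + c * k.-1) *
     (qp (M + c.-1 + j * c) / qp (j * c)))) *
  \prod_(j < k) \prod_(i < k | (i < j)%N) P (j - i).
Proof.
have E2 : \prod_(a < k) \prod_(b < k | (a < b)%N) \prod_(l < c)
     (((Y (rev_ord b))^-1 - q ^+ l * (Y (rev_ord a))^-1) *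
      ((Y (rev_ord a))^-1 - q ^+ l.+1 * (Y (rev_ord b))^-1)) =
   (\prod_(a < k) (Y (rev_ord a))^-1 ^+ (c * k.-1)) *
   \prod_(j < k) \prod_(i < k | (i < j)%N) P (j - i).
  transitivity (\prod_(a < k) \prod_(b < k | (a < b)%N)
     (((Y (rev_ord a))^-1 ^+ c * (Y (rev_ord b))^-1 ^+ c) * P (b - a))).
    apply: eq_bigr => a _; apply: eq_bigr => b ab.
    rewrite -exprMn.
    have -> : ((Y (rev_ord a))^-1 * (Y (rev_ord b))^-1) ^+ c =
      \prod_(l < c) ((Y (rev_ord a))^-1 * (Y (rev_ord b))^-1) by rewrite prodr_const card_ord.
    rewrite /P -big_split; apply: eq_bigr => l _ /=.
    have hl := ltn_ord l; have hb := ltn_ord b.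
    have Yab : Y (rev_ord a) = Y (rev_ord b) * q ^+ ((b - a) * c).
      by rewrite !YE -mulrA -exprD /=; congr (_ * _ ^+ _); nia.
    have e1 : q ^- ((b - a) * c - l) = q ^+ l / q ^+ ((b - a) * c).
      have {2}-> : ((b - a) * c = (b - a) * c - l + l)%N by nia.
      by rewrite exprD invfM mulrCA divff ?mulr1.
    rewrite e1 exprD Yab; set y := Y _; set u := q ^+ (_ * c).
    have y0 : y != 0 by apply: Y0.
    have u0 : u != 0 by apply: q0n.
    by field; rewrite y0 u0.
  under eq_bigr do rewrite big_split /=.
  rewrite big_split; congr (_ * _); last first.
    under eq_bigr do rewrite big_mkcond /=.
    by rewrite exchange_big /=; apply: eq_bigr => j _; rewrite [RHS]big_mkcond.
  under eq_bigr do rewrite big_split /=.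
  rewrite big_split /=.
  have -> : \prod_(a < k) \prod_(b < k | (a < b)%N) (Y (rev_ord b))^-1 ^+ c =
     \prod_(a < k) \prod_(b < k | (b < a)%N) (Y (rev_ord a))^-1 ^+ c.
    under eq_bigr do rewrite big_mkcond /=.
    by rewrite exchange_big /=; apply: eq_bigr => j _; rewrite [RHS]big_mkcond.
  rewrite -big_split; apply: eq_bigr => a _ /=.
  by rewrite !prodr_const -exprD -!sum1_card card_gt_lt -exprM.
rewrite /dyson E2 mulrA; congr (_ * _).
rewrite (reindex_inj rev_ord_inj) [X in _ * X](reindex_inj rev_ord_inj) /= -big_split /=.
apply: eq_bigr => j _; rewrite !rev_ordK exprD mulrAC; congr (_ * _).
rewrite -qp_tail -[X in _ ^+ X]card_ord -prodr_const -big_split /=; apply: eq_bigr => l _.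
rewrite YE [q ^+ (_ + l)]exprD; set w := q ^+ (1 + j * c).
have w0 : w != 0 by apply: q0n.
by field; rewrite kap_neq0 w0.
Qed.

Lemma S_eval : S = (-1) ^+ c.-1 * q ^+ 'C(c, 2) / qp c.-1.
Proof.
rewrite /S /qp; case: (c) c_gt0 => // c' h /=.
rewrite big_mkcond big_ord_recl -val_eqE /= mul1r.
rewrite (eq_bigr (fun l : 'I_c' => (- q ^+ l.+1) * (1 - q ^+ l.+1)^-1)); last first.
  move=> l _; rewrite ?lift0 /bump /= ?add1n.
  have h1 := q0n l.+1; have h2 := @one_sub_qX l.+1 isT.
  have h3 : q ^+ l.+1 - 1 != 0 by rewrite -oppr_eq0 opprB.
  by set u := q ^+ l.+1; field; rewrite ?h1 ?h2 ?h3.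
rewrite big_split /= prodfV; congr (_ / _).
rewrite prodrN card_ord; congr (_ * _).
rewrite prodrXr; congr (_ ^+ _).
elim: c' {h} => [|n IH]; first by rewrite big_ord0.
by rewrite big_ord_recr /= IH [RHS]binS bin1.
Qed.

Lemma prod_ratio (F : nat -> K) m : (forall n, F n != 0) ->
  \prod_(l < m) (F l.+1 / F l) = F m / F 0%N.
Proof.
move=> F0; elim: m => [|m IH]; first by rewrite big_ord0 divff.
by rewrite big_ord_recr /= IH mulrC mulrA mulfVK.
Qed.

(** The factors for one l combine to q ^ (2 l) times a quotient of consecutive values of 1 - q ^ (d
    c + l), so the product over l telescopes. *)
Lemma R_eval d : (0 < d)%N ->
  A d * A' d * P d = q ^+ (c * c.-1) * (1 - q ^+ (d.+1 * c)) / (1 - q ^+ (d * c)).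
Proof.
move=> d0; rewrite /A /A' /P -!big_split /=.
have dc : (c <= d * c)%N by rewrite leq_pmull.
rewrite (eq_bigr (fun l : 'I_c => q ^+ l ^+ 2 *
   ((1 - q ^+ (d * c + l.+1)) / (1 - q ^+ (d * c + l))))); last first.
  move=> l _; have hl := ltn_ord l.
  have [e he] : exists e, (d * c = e.+1 + l)%N by exists (d * c - l).-1; lia.
  have -> : (d * c - l = e.+1)%N by lia.
  have h0 := @one_sub_qX (d * c + l) ltac:(lia).
  have h3 : q ^+ (d * c + l) - 1 != 0 by rewrite -oppr_eq0 opprB.
  have h1 := @one_sub_qX e.+1 isT.
  have h2 : q ^+ e.+1 - 1 != 0 by rewrite -oppr_eq0 opprB.
  move: h0 h1 h2 h3; rewrite he !exprD.
  have := q0n e.+1; have := q0n l; set u := q ^+ e.+1; set v := q ^+ l; set w := q ^+ l.+1.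
  move=> v0 u0 h0 h1 h2 h3; field.
  by rewrite ?h0 ?h1 ?h2 ?h3 ?u0 ?v0.
rewrite big_split /= (@prod_ratio (fun l => 1 - q ^+ (d * c + l))) => [|l]; last first.
  by apply: one_sub_qX; lia.
rewrite addn0 -mulSnr mulrA; congr (_ * _ / _).
under eq_bigr do rewrite -exprM.
rewrite prodrXr; congr (_ ^+ _).
elim: (c) => [|n IH]; first by rewrite big_ord0.
by rewrite big_ord_recr /= IH; case: n {IH} => // n; lia.
Qed.

(** The surviving residue divided by the value of the product of the (x_j)_M. The pair contributions
    given by [R_eval] telescope a second time, now in d. *)
Lemma gcoef0E : gcoef zero_exp =
  \prod_(j < k) ((-1) ^+ c.-1 * q ^+ 'C(c.-1, 2) / kap ^+ c.-1 *
    (qp (M + c.-1 + j * c) * qp (j.+1 * c) /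
      (qp (M + j * c) * qp (c.-1 + j * c) * qp c))).
Proof.
have [k0|k0] := posnP k.
  have e (i : 'I_k) : False by have := leq_ltn_trans (leq0n i) (ltn_ord i); rewrite k0.
  rewrite [RHS]big1 => [|i]; last by case: (e i).
  rewrite /gcoef /D /dyson !big1 ?mulr1 => [|i|i|i]; try by case: (e i).
  rewrite mcoeff1; case: eqP => // -[]; apply/mnmP => i; by case: (e i).
pose L := (k * B + M)%N.
have hL1 : (k * B <= L)%N by rewrite /L; lia.
have hL2 : (M <= L)%N by rewrite /L; lia.
have := gsum_prod xs hL2.
rewrite (gsum_residue k0 hL1 special_inj special_neq0).
pose rho0 : {ffun 'I_k -> 'I_k * 'I_c} := [ffun i => (rev_ord i, Ordinal c_gt0)].
rewrite (bigD1 rho0) //= [X in _ + X]big1 ?addr0; last first.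
  move=> rho ne; have [->|nz] := eqVneq (dyson q kap c M id (Z rho)) 0.
    by rewrite mulr0.
  by case/eqP: ne; apply/ffunP => i; rewrite ffunE; apply: special_rho.
have -> : dyson q kap c M id (fun i => (yv xs (rho0 i))^-1) =
    dyson q kap c M id (fun i => (Y (rev_ord i))^-1).
  rewrite /dyson; congr (_ * _).
    by apply: eq_bigr => i _; apply: eq_bigr => l _; rewrite ffunE.
  by do 3![apply: eq_bigr => ? _]; rewrite !ffunE.
have -> : \prod_i (lagr (yl xs) (yv xs (rho0 i)) * yv xs (rho0 i) ^+ (B + (k * c).-1)) =
    \prod_j (lagr (yl xs) (Y j) * Y j ^+ (k * c).-1 * Y j ^+ B).
  rewrite [RHS](reindex_inj rev_ord_inj); apply: eq_bigr => i _.
  by rewrite ffunE -/(Y _) exprD mulrAC mulrA mulrC mulrA.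
rewrite dyson_special; under eq_bigr do rewrite lagr_special.
have -> : \prod_j \prod_(r < M) (1 - q ^+ r * xs j) =
    \prod_(j < k) (qp (M + j * c) / qp (j * c)).
  apply: eq_bigr => j _; rewrite -qp_tail; apply: eq_bigr => r _.
  by rewrite /xs -exprD addnC.
(* Exchanging the two indices moves [A'] to the pairs i < j, where it meets [A] and [P]. *)
have -> : \prod_(j < k) ((\prod_(i < k | (i < j)%N) A (j - i)) *
     (\prod_(i < k | (j < i)%N) A' (i - j)) * S * Y j ^+ B) =
   \prod_(j < k) ((\prod_(i < k | (i < j)%N) (A (j - i) * A' (j - i))) * S * Y j ^+ B).
  rewrite !big_split /=; congr (_ * _ * _).
  under [in RHS]eq_bigr do rewrite big_split /=.
  rewrite big_split; congr (_ * _).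
  under eq_bigr do rewrite big_mkcond /=.
  by rewrite exchange_big /=; apply: eq_bigr => j _; rewrite [RHS]big_mkcond.
rewrite mulrA -!big_split /= => E.
have nz : \prod_(j < k) (qp (M + j * c) / qp (j * c)) != 0.
  by apply/prodf_neq0 => j _; rewrite mulf_neq0 ?invr_neq0 ?qp_neq0.
apply: (mulIf nz); rewrite -E -big_split; apply: eq_bigr => j _ /=.
have -> : (\prod_(i < k | (i < j)%N) (A (j - i) * A' (j - i))) * S * Y j ^+ B *
    ((Y j)^-1 ^+ (M + c.-1 + c * k.-1) * (qp (M + c.-1 + j * c) / qp (j * c))) *
    \prod_(i < k | (i < j)%N) P (j - i) =
  (\prod_(i < k | (i < j)%N) (A (j - i) * A' (j - i) * P (j - i))) * S *
   (Y j ^+ c.-1)^-1 * (qp (M + c.-1 + j * c) / qp (j * c)).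
  have -> : (M + c.-1 + c * k.-1 = B + c.-1)%N by rewrite /B; lia.
  rewrite [in RHS]big_split /= exprD !exprVn.
  have h := expf_neq0 B (Y0 j); have h' := expf_neq0 c.-1 (Y0 j).
  set p1 := \prod_(i < k | _) _; set p2 := \prod_(i < k | _) _.
  by field; rewrite h h' qp_neq0.
rewrite (prod_below (fun d => A d * A' d * P d)).
under eq_bigr do rewrite R_eval // -mulrA.
rewrite big_split (@prod_ratio (fun l => 1 - q ^+ (l.+1 * c))) /= => [|l]; last first.
  by apply: one_sub_qX; rewrite muln_gt0.
rewrite prodr_const card_ord -exprM S_eval mul1n YE exprMn -exprM.
have -> : qp (j.+1 * c) = qp (c.-1 + j * c) * (1 - q ^+ (j.+1 * c)).
  by have -> : (j.+1 * c = (c.-1 + j * c).+1)%N by [lia|]; rewrite qpS.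
have -> : qp c = qp c.-1 * (1 - q ^+ c) by rewrite -{1}(prednK c_gt0) qpS prednK.
have : q ^+ (c * c.-1 * j) * q ^+ 'C(c, 2) =
    q ^+ 'C(c.-1, 2) * q ^+ ((1 + j * c) * c.-1).
  rewrite -!exprD; congr (_ ^+ _).
  by case: (c) c_gt0 => // c' _; rewrite binS bin1 /=; nia.
have := q0n ((1 + j * c) * c.-1).
set a := q ^+ (c * c.-1 * j); set s1 := q ^+ 'C(c, 2); set s2 := q ^+ 'C(c.-1, 2).
set e := q ^+ _ => e0 E2.
have {E2}-> : s2 = a * s1 / e by rewrite E2 mulfK.
have := one_sub_qX c_gt0; set v := 1 - q ^+ c => v0.
have kp := expf_neq0 c.-1 kap_neq0.
field.
by rewrite kp e0 v0 !qp_neq0.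
Qed.

End Constant.

(** * Power sums under the coefficient functional *)

Let lam (p : {mpoly K[k]}) : K := (D * p)@_B1.
Let pw (r : nat) : {mpoly K[k]} := \sum_i X i ^+ r.
Let uc (r : nat) : K := \sum_(l < c) (kap * q ^- l) ^+ r.
(* lam is multiplicative on the g n and maps them to the qcoef n, which are the
   h_n of minus the alphabet 1 + q + ... + q ^ (M - 1); uc r * pw r is the r-th
   power sum behind the g n. *)
Definition pspec (r : nat) : K := - psym [seq q ^+ l | l <- iota 0 M] r / uc r.

(** Up to a unit this is a geometric sum in q ^ r, which could vanish only if q ^ (r c) = 1. *)
Lemma uc_neq0 r : (0 < r)%N -> uc r != 0.
Proof.
move=> r0; have q0n n : q ^+ n != 0 by rewrite expf_neq0.
have -> : uc r = kap ^+ r * q ^- (c.-1 * r) * \sum_(l < c) (q ^+ r) ^+ l.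
  rewrite /uc [LHS](reindex_inj rev_ord_inj) big_distrr; apply: eq_bigr => l _ /=.
  have hl := ltn_ord l.
  have -> : (c.-1 * r = (c - l.+1) * r + r * l)%N by nia.
  rewrite exprMn exprVn -!exprM exprD; have := q0n ((c - l.+1) * r)%N; have := q0n (r * l)%N.
  by set x := q ^+ _; set y := q ^+ _ => hx hy; field; rewrite hx hy.
rewrite !mulf_neq0 ?invr_neq0 ?expf_neq0 //.
apply/eqP => e; have := subrX1 (q ^+ r) c; rewrite e mulr0 -exprM => /eqP.
rewrite subr_eq0; have := @q_generic (r * c) 1 1 _ isT isT.
by rewrite mul1r muln_gt0 r0 c_gt0 => /(_ isT) /negPf ->.
Qed.

Lemma psym_gletters r : psym (gletters q kap c phi X) r = (uc r)%:MP * pw r.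
Proof.
rewrite /psym big_gletters /pw /uc rmorph_sum mulr_sumr /=.
apply: eq_bigr => i _; rewrite mulr_suml; apply: eq_bigr => l _.
by rewrite exprMn rmorphXn.
Qed.

Lemma lam_sum (I : Type) (s : seq I) (P : pred I) F :
  lam (\sum_(i <- s | P i) F i) = \sum_(i <- s | P i) lam (F i).
Proof. by rewrite /lam mulr_sumr raddf_sum. Qed.

Lemma lamC a p : lam (a%:MP * p) = a * lam p.
Proof. by rewrite /lam mulrCA mcoeffCM. Qed.

(* Newton's identity trades p_r for products p_s g_(r - s) and a factor g_r
   while the total weight stays at most k, the number of available g's. *)
Lemma lam_powersums (mu beta : seq nat) : all (leq 1) mu ->
  (sumn mu + size beta <= k)%N ->
  lam (\prod_(r <- mu) pw r * \prod_(n <- beta) g n) =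
  gcoef zero_exp * (\prod_(r <- mu) pspec r * \prod_(n <- beta) qcoef n).
Proof.
have [w] := ubnP (sumn mu); elim: w mu beta => // w IH [|r mu] beta hw hmu hk.
  rewrite !big_nil !mul1r.
  (* [gcoef] takes exactly k indices, so beta is padded with zeros; this is harmless because both
     g_0 and [qcoef 0] are 1. *)
  have G (T : comNzRingType) (F : nat -> T) : F 0%N = 1 ->
      \prod_(n <- beta) F n = \prod_(j < k) F (nth 0%N beta j).
    move=> F1; rewrite (big_nth 0%N) big_mkord.
    have hb : (size beta <= k)%N by move: hk; rewrite /=; lia.
    rewrite (big_ord_widen k (fun j => F (nth 0%N beta j)) hb) big_mkcond.
    by apply: eq_bigr => j _; case: ltnP => // h; rewrite nth_default.
  rewrite !G ?/qcoef ?esgn0 //; last exact: hsym0.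
  exact: (gcoefE (fun j => nth 0%N beta j)).
case/andP: (hmu) => r0 hmu'.
apply: (mulfI (uc_neq0 r0)); rewrite -lamC big_cons.
have N := newton_hsym (gletters q kap c phi X) r.
case: r r0 hw hmu hk N => // r _ hw hmu hk.
rewrite big_ord_recr /= subnn hsym0 mulr1 psym_gletters -/(g _) => /eqP.
rewrite [X in _ == X]addrC -subr_eq => /eqP N.
(* By the choice of [pspec], the pair [pspec], [qcoef] satisfies the recursion that N gives for the
   power sums and the g_n, so the two sides of the claim evolve alike. *)
have N' := newton_esgn [seq q ^+ l | l <- iota 0 M] r.+1.
have psE s : psym [seq q ^+ l | l <- iota 0 M] s.+1 = - (uc s.+1 * pspec s.+1).
  by rewrite /pspec mulrCA mulfV ?mulr1 ?opprK // uc_neq0.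
rewrite -[esgn _ _]/(qcoef _) -sumrN in N'.
rewrite (eq_bigr (fun s : 'I_r.+1 => uc s.+1 * pspec s.+1 * qcoef (r - s))) in N'; last first.
  by move=> s _; rewrite psE mulNr opprK.
have q00 : qcoef 0 = 1 by rewrite /qcoef esgn0.
rewrite big_ord_recr /= subnn q00 mulr1 in N'.
move/eqP: N'; rewrite [X in _ == X]addrC -subr_eq => /eqP N'.
set Pm := \prod_(r <- mu) pw r; set Gb := \prod_(n <- beta) g n.
have -> : (uc r.+1)%:MP * (pw r.+1 * Pm * Gb) =
   (r.+1%:R)%:MP * (Pm * \prod_(n <- r.+1 :: beta) g n) -
   \sum_(s < r) (uc s.+1)%:MP *
      (\prod_(t <- s.+1 :: mu) pw t * \prod_(n <- (r - s)%N :: beta) g n).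
  rewrite -[pw r.+1 * Pm * Gb]mulrA mulrA -N mulrBl mulr_suml; congr (_ - _).
    by rewrite big_cons mpolyC_nat -/Gb; ring.
  apply: eq_bigr => s _; rewrite !big_cons psym_gletters -/Gb -/Pm subSS /g; ring.
have lamB p p' : lam (p - p') = lam p - lam p' by rewrite /lam mulrBr mcoeffB.
rewrite lamB lam_sum lamC.
rewrite (IH mu (r.+1 :: beta) _ hmu'); [|by move: hw; rewrite /=; lia|by move: hk; rewrite /=; lia].
rewrite (eq_bigr (fun s : 'I_r => uc s.+1 * (gcoef zero_exp *
  (\prod_(t <- s.+1 :: mu) pspec t * \prod_(n <- (r - s)%N :: beta) qcoef n)))); last first.
  move=> s _; have hs := ltn_ord s; rewrite lamC IH //.
    by move: hw; rewrite /=; lia.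
  by move: hk; rewrite /=; lia.
have -> : uc r.+1 * (gcoef zero_exp * (\prod_(t <- r.+1 :: mu) pspec t *
     \prod_(n <- beta) qcoef n)) = gcoef zero_exp * (\prod_(t <- mu) pspec t *
     \prod_(n <- beta) qcoef n) * (uc r.+1 * pspec r.+1).
  by rewrite big_cons; ring.
rewrite -N' mulrBr; congr (_ - _); first by rewrite big_cons; ring.
rewrite mulr_sumr; apply: eq_bigr => s _.
by rewrite !big_cons; ring.
Qed.

(** An additive E that extracts the coefficient of the B-th power of the product of the Z_i
    corresponds to [mcoeff] along [mmap f Z]. Thus the polynomial computation becomes available in
    any ring with such a functional. *)
Lemma transfer (A : comNzRingType) (f : {rmorphism K -> A}) (Z : 'I_k -> A)
    (E : A -> A) :
  {morph E : x y / x + y} ->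
  (forall a (e : 'I_k -> nat), E (f a * \prod_i Z i ^+ e i) =
     if [forall i, e i == B] then f a else 0) ->
  forall mu beta, all (leq 1) mu -> (sumn mu + size beta <= k)%N ->
  E (dyson q kap c M f Z * (\prod_(r <- mu) (\sum_i Z i ^+ r) *
      \prod_(n <- beta) hsym (gletters q kap c f Z) n)) =
  f (gcoef zero_exp * (\prod_(r <- mu) pspec r * \prod_(n <- beta) qcoef n)).
Proof.
move=> ED EZ mu beta hmu hk; rewrite -lam_powersums // /lam.
set p := \prod_(r <- mu) pw r * _.
have E0 : E 0 = 0 by apply: (addrI (E 0)); rewrite -ED !addr0.
have -> : f (D * p)@_B1 = E (mmap f Z (D * p)).
  rewrite [in RHS]/mmap (big_morph E ED E0).
  under eq_bigr do rewrite /mmap1 EZ.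
  have [h|h] := boolP (B1 \in msupp (D * p)).
    rewrite (bigD1_seq B1) ?msupp_uniq //= big1 ?addr0.
      by case: forallP => // -[] i; rewrite mnmE.
    move=> m hm; case: forallP => // hB; case/eqP: hm; apply/mnmP => i.
    by rewrite mnmE; apply/eqP.
  rewrite (memN_msupp_eq0 h) rmorph0 big_seq big1 // => m hm.
  case: forallP => // hB; case/negP: h; suff -> : B1 = m by [].
  by apply/mnmP => i; rewrite mnmE; apply/esym/eqP.
pose F : {rmorphism {mpoly K[k]} -> A} := mmap f Z.
have Fphi : F \o phi =1 f by move=> a; apply: mmapC.
have FX : F \o X =1 Z by move=> i; rewrite /= /X; apply: (etrans (mmapX _ _ _)); apply: mmap1U.
congr E; transitivity (F (D * p)); last by [].
rewrite (rmorphM F D) /p (rmorphM F (\prod_(r <- mu) _)) !rmorph_prod; congr (_ * (_ * _)).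
- by rewrite /D rmorph_dyson; apply: eq_dyson.
- apply: eq_bigr => r _; rewrite rmorph_sum; apply: eq_bigr => i _.
  by rewrite rmorphXn; congr (_ ^+ _); rewrite -FX.
- apply: eq_bigr => n _; rewrite /g rmorph_hsym map_gletters; congr (hsym _ _).
  exact/esym/eq_gletters.
Qed.

End Core.

From mathcomp Require Import all_classical.
From mathcomp Require Import finmap monalg.
Require Import Defs.
Import Order.TTheory Num.Theory.
Local Open Scope classical_set_scope.
Local Open Scope ring_scope.

(** * A ring of formal Laurent series *)

Section Levels.
Context {V : choiceType} (D : seq V) (lev : V -> nat).
Implicit Types (e u : {malg int[V]}) (x y : V).

(* lev orders the levels of the variables in D. The ratios z^(s)_i / z^(s+1)_j
   have nonnegative lvl at every variable, and only finitely many exponents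
   have lvl bounded below together with that of their difference to e. *)
Definition lvl x e : int :=
  e@_x + \sum_(y <- D | (x \in D) && (lev y < lev x)%N) e@_y.

Lemma lvlD x e u : lvl x (e + u) = lvl x e + lvl x u.
Proof.
rewrite /lvl mcoeffD addrACA -big_split /=; congr (_ + _).
by apply: eq_bigr => y _; rewrite mcoeffD.
Qed.

Lemma lvl0 x : lvl x 0 = 0.
Proof. by rewrite /lvl mcoeff0 big1 ?addr0 // => y _; rewrite mcoeff0. Qed.

Lemma lvlN x e : lvl x (- e) = - lvl x e.
Proof. by apply/eqP; rewrite -addr_eq0 -lvlD addNr lvl0. Qed.

Lemma lvlB x e u : lvl x (e - u) = lvl x e - lvl x u.
Proof. by rewrite lvlD lvlN. Qed.

Lemma lvlMn x e n : lvl x (e *+ n) = lvl x e *+ n.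
Proof. by elim: n => [|n IH]; rewrite ?mulr0n ?lvl0 // !mulrS lvlD IH. Qed.

Lemma lvl_out x e : x \notin D -> lvl x e = e@_x.
Proof.
by move=> /negPf h; rewrite /lvl big1 ?addr0 // => y; rewrite h.
Qed.

(** Negative values are confined to finitely many variables, so that Laurent variables and infinite
    alphabets fit under one bound. *)
Definition bnd (T : seq V) (B : nat) x : int := if x \in T then - B%:Z else 0.

Lemma finite_box (T : seq V) (C : nat) :
  finite_set [set u : {malg int[V]} |
    forall x, `|u@_x| <= (if x \in T then C%:Z else 0)].
Proof.
elim: T => [|x T IH].
  apply: (@sub_finite_set _ _ [set 0]) => [u /= h|]; last exact: finite_set1.
  by apply/malgP => y; have := h y; rewrite ?in_nil normr_le0 mcoeff0 => /eqP.
have F : finite_set [set d : int | `|d| <= C%:Z].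
  apply: (@sub_finite_set _ _ ((fun n : nat => n%:Z - C%:Z) @` `I_(C + C).+1)).
    move=> d /= hd; exists (absz (d + C%:Z : int)); last by lia.
    by rewrite /mkset; lia.
  exact/finite_image/finite_II.
apply: sub_finite_set (finite_image2 (fun d u => << d *g x >> + u) F IH).
move=> u /= h; exists u@_x; first by have := h x; rewrite mem_head.
exists (u - << u@_x *g x >>); last by rewrite addrC subrK.
move=> y; rewrite mcoeffB mcoeffU; have := h y; rewrite in_cons [x == y]eq_sym.
case: eqVneq => [->|] /=; last by rewrite mulr0n subr0.
by rewrite mulr1n subrr normr0; case: ifP.
Qed.

(** Passing from exponents to [lvl] is triangular with respect to [lev], hence can be undone level
    by level with a growing bound. *)
Lemma lvl_bound (T : seq V) (E : nat) :
  exists C : nat, forall u, (forall x, `|lvl x u| <= (if x \in T then E%:Z else 0)) ->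
    forall x, `|u@_x| <= C%:Z.
Proof.
have H n : exists C : nat, forall u,
    (forall x, `|lvl x u| <= (if x \in T then E%:Z else 0)) ->
    forall x, (x \in D -> (lev x < n)%N) -> `|u@_x| <= C%:Z.
  have hE (u : {malg int[V]}) x : `|lvl x u| <= (if x \in T then E%:Z else 0) -> `|lvl x u| <= E%:Z.
    by case: ifP => // _ /le_trans; apply.
  elim: n => [|n [C IH]].
    exists E => u hu x; case: (boolP (x \in D)) => [_ /(_ isT) //|hx _].
    by rewrite -(lvl_out u hx); apply: hE.
  exists (E + size D * C)%N => u hu x hx.
  have -> : u@_x = lvl x u - \sum_(y <- D | (x \in D) && (lev y < lev x)%N) u@_y.
    by rewrite /lvl addrK.
  apply: le_trans (ler_normB _ _) _; rewrite PoszD lerD ?hE //.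
  apply: le_trans (ler_norm_sum _ _ _) _.
  have -> : (size D * C)%:Z = \sum_(y <- D) C%:Z.
    by rewrite big_const_seq iter_addr_0 count_predT -mulr_natr natz mulrC.
  rewrite big_mkcond /=; apply: ler_sum => y _; case: ifP => // /andP[xD lt].
  by apply: IH => // _; have := hx xD; lia.
have [C hC] := H (\max_(y <- D) lev y).+1.
exists C => u hu x; apply: hC => // xD.
by rewrite ltnS; apply: leq_bigmax_seq.
Qed.

(** The condition on e - u bounds [lvl x u] from above, and [lvl_bound] then puts u into a finite
    box. Outside T, D and the support of e, both bounds together force the exponent to be 0. *)
Lemma finite_fiber (T : seq V) (B : nat) e :
  finite_set [set u | forall x, bnd T B x <= lvl x u /\ bnd T B x <= lvl x (e - u)].
Proof.
pose T' := T ++ msupp e ++ D.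
pose E := (B + \sum_(x <- T') absz (lvl x e))%N.
have [C hC] := @lvl_bound T' E.
apply: sub_finite_set (@finite_box T' C) => u /= h.
have hout x : x \notin T' -> [/\ x \notin T, x \notin D & e@_x = 0].
  rewrite !mem_cat !negb_or => /and3P[? h1 ?]; split=> //.
  exact: mcoeff_outdom.
have hE x : x \in T' -> (absz (lvl x e) + B <= E)%N.
  by move=> hx; rewrite addnC leq_add2l (big_rem x hx) leq_addr.
have hl x : `|lvl x u| <= (if x \in T' then E%:Z else 0).
  have [h1 h2] := h x; move: h1 h2; rewrite lvlB /bnd.
  case: (boolP (x \in T')) => [/hE hx|/hout [/negPf -> hD e0]].
    by case: ifP => _; lia.
  by rewrite (lvl_out e hD) e0; lia.
move=> x; case: ifPn => hx; first exact: hC.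
by have := hl x; rewrite (negPf hx); have [_ hD _] := hout x hx; rewrite lvl_out.
Qed.
End Levels.

(** * Series with bounded levels form a ring *)

Section GoodSeries.
Context {K : fieldType} {V : choiceType} (D : seq V) (lev : V -> nat).
Implicit Types (F G H : fser K V) (e u v : {malg int[V]}) (x y : V).
Local Notation lvl := (lvl D lev).

Lemma fmulE F G e (A : {fset {malg int[V]}}) :
  (forall u, F u != 0 -> G (e - u) != 0 -> u \in A) ->
  fmul F G e = \sum_(u <- A) F u * G (e - u).
Proof.
move=> h; apply: fsbigTE => u; apply: contraNeq; rewrite mulf_eq0 negb_or.
by case/andP; apply: h.
Qed.

Definition good F : Prop := exists T B, forall e, F e != 0 ->
  forall x, bnd T B x <= lvl x e.

Lemma bndW T T' B B' x : bnd (T ++ T') (B + B') x <= bnd T B x.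
Proof. by rewrite /bnd mem_cat; case: (x \in T); case: (x \in T') => /=; lia. Qed.

Lemma bndW' T T' B B' x : bnd (T ++ T') (B + B') x <= bnd T' B' x.
Proof. by rewrite /bnd mem_cat; case: (x \in T); case: (x \in T') => /=; lia. Qed.

Lemma bndD T T' B B' x : bnd (T ++ T') (B + B') x <= bnd T B x + bnd T' B' x.
Proof. by rewrite /bnd mem_cat; case: (x \in T); case: (x \in T') => /=; lia. Qed.

Lemma good_fadd F G : good F -> good G -> good (fadd F G).
Proof.
move=> [T [B hF]] [T' [B' hG]]; exists (T ++ T'), (B + B')%N => e he x.
have [/eqP F0|/negPf Fn0] := boolP (F e == 0).
  by apply: le_trans (bndW' _ _ _ _ _) _; apply: hG; move: he; rewrite /fadd F0 add0r.
by apply: le_trans (bndW _ _ _ _ _) _; apply: hF; rewrite Fn0.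
Qed.

Lemma good0 : good (fun=> 0).
Proof. by exists [::], 0%N => e; rewrite eqxx. Qed.

Lemma good_opp F : good F -> good (fun e => - F e).
Proof. by move=> [T [B h]]; exists T, B => e; rewrite oppr_eq0; apply: h. Qed.

Lemma good_fmon d u : good (fmon d u).
Proof.
pose T := msupp u ++ D; exists T, (\sum_(x <- T) absz (lvl x u))%N => e.
rewrite /fmon; case: (e =P u) => [-> _ x|_]; last by rewrite eqxx.
rewrite /bnd; case: (boolP (x \in T)) => [hx|].
  by rewrite (big_rem x hx) /=; lia.
rewrite mem_cat negb_or => /andP[hx hD].
by rewrite lvl_out // (mcoeff_outdom hx).
Qed.

Lemma good_fiber F G : good F -> good G -> exists T B, forall e u,
  F u != 0 -> G (e - u) != 0 -> forall x, bnd T B x <= lvl x u /\ bnd T B x <= lvl x (e - u).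
Proof.
move=> [T [B hF]] [T' [B' hG]]; exists (T ++ T'), (B + B')%N => e u hu he x; split.
  by apply: le_trans (bndW _ _ _ _ _) _; apply: hF.
by apply: le_trans (bndW' _ _ _ _ _) _; apply: hG.
Qed.

Lemma fmul_neq0 F G e : fmul F G e != 0 -> exists u, F u != 0 /\ G (e - u) != 0.
Proof.
move=> h; apply: contrapT => hN; case/eqP: h; apply: fsbig1 => u _.
apply/eqP; rewrite mulf_eq0; apply/norP => -[h1 h2]; apply: hN; by exists u.
Qed.

Lemma good_fmul F G : good F -> good G -> good (fmul F G).
Proof.
move=> [T [B hF]] [T' [B' hG]]; exists (T ++ T'), (B + B')%N => e.
case/fmul_neq0 => u [h1 h2] x; rewrite -(subrK u e) addrC lvlD.
by apply: le_trans (bndD _ _ _ _ _) _; apply: lerD; [apply: hF|apply: hG].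
Qed.

Lemma fmulC F G : fmul F G = fmul G F.
Proof.
apply/funext => e; rewrite /fmul.
rewrite (reindex_fsbigT (fun u => e - u)) /=; last first.
  by exists (fun u => e - u) => u; rewrite subKr.
by apply: eq_fsbigr => u _; rewrite subKr mulrC.
Qed.

Lemma good_finite F G e : good F -> good G ->
  exists A : {fset {malg int[V]}}, forall u, F u != 0 -> G (e - u) != 0 -> u \in A.
Proof.
move=> gF gG; have [T [B h]] := good_fiber gF gG.
exists (fset_set [set u | forall x, bnd T B x <= lvl x u /\ bnd T B x <= lvl x (e - u)]).
move=> u h1 h2; rewrite in_fset_set; last exact: finite_fiber.
by apply: mem_set => x; apply: h.
Qed.

Lemma fmulDl F G H : good F -> good G -> good H ->
  fmul (fadd F G) H = fadd (fmul F H) (fmul G H).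
Proof.
move=> gF gG gH; apply/funext => e; rewrite /fadd.
have [A hA] := good_finite e gF gH; have [A' hA'] := good_finite e gG gH.
have iA u : F u != 0 -> H (e - u) != 0 -> u \in (A `|` A')%fset.
  by move=> h1 h2; rewrite in_fsetU hA.
have iA' u : G u != 0 -> H (e - u) != 0 -> u \in (A `|` A')%fset.
  by move=> h1 h2; rewrite in_fsetU hA' ?orbT.
have iS u : fadd F G u != 0 -> H (e - u) != 0 -> u \in (A `|` A')%fset.
  move=> h1 h2; have [F0|Fn0] := eqVneq (F u) 0; last exact: iA.
  by apply: iA' => //; move: h1; rewrite /fadd F0 add0r.
rewrite (fmulE iS) (fmulE iA) (fmulE iA').
by rewrite -big_split; apply: eq_bigr => u _; rewrite mulrDl.
Qed.

Lemma fmul_mon d u F e : fmul (fmon d u) F e = d * F (e - u).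
Proof.
have h v : fmon d u v != 0 -> F (e - v) != 0 -> v \in [fset u]%fset.
  by rewrite /fmon in_fset1; case: (v =P u) => // _; rewrite eqxx.
by rewrite (fmulE h) big_seq_fset1 /fmon eqxx.
Qed.

Lemma fmul1 F : fmul fone F = F.
Proof. by apply/funext => e; rewrite fmul_mon subr0 mul1r. Qed.

Lemma fmulA F G H : good F -> good G -> good H ->
  fmul F (fmul G H) = fmul (fmul F G) H.
Proof.
move=> gF gG gH; apply/funext => e.
have [T [B hF]] := gF; have [T' [B' hG]] := gG; have [T2 [B2 hH]] := gH.
pose T3 := T ++ T' ++ T2; pose B3 := (B + (B' + B2))%N.
pose A := fset_set [set u | forall x, bnd T3 B3 x <= lvl x u /\ bnd T3 B3 x <= lvl x (e - u)].
have inA u : (forall x, bnd T3 B3 x <= lvl x u /\ bnd T3 B3 x <= lvl x (e - u)) -> u \in A.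
  by move=> h; rewrite in_fset_set; [apply: mem_set | apply: finite_fiber].
have b1 x : bnd T3 B3 x <= bnd T B x by apply: bndW.
have b12 x : bnd T3 B3 x <= bnd T B x + bnd T' B' x.
  apply: le_trans (bndD _ _ _ _ _) _; rewrite lerD2l; exact: bndW.
have b23 x : bnd T3 B3 x <= bnd T' B' x + bnd T2 B2 x.
  apply: le_trans (bndW' _ _ _ _ _) _; exact: bndD.
have b3 x : bnd T3 B3 x <= bnd T2 B2 x.
  apply: le_trans (bndW' _ _ _ _ _) _; exact: bndW'.
(* A nonzero triple term confines both indices to one finite set, over which the two sums can be
   exchanged. *)
have main v u : F v != 0 -> G (u - v) != 0 -> H (e - u) != 0 -> v \in A /\ u \in A.
  move=> h1 h2 h3; have k1 := hF _ h1; have k2 := hG _ h2; have k3 := hH _ h3.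
  split; apply: inA => x; have := k1 x; have := k2 x; have := k3 x; rewrite !lvlB => *.
    by split; have := b1 x; have := b23 x; lia.
  by split; have := b12 x; have := b3 x; lia.
have E w v : e - (w + v) = e - v - w by rewrite opprD addrA addrAC.
transitivity (\sum_(v <- A) \sum_(u <- A) F v * G (u - v) * H (e - u)).
  rewrite (@fmulE _ _ _ A) => [|v h1 /fmul_neq0[w [h2 h3]]]; last first.
    by have [] := main v (w + v); rewrite ?addrK // E.
  apply: eq_bigr => v _; have [->|Fn0] := eqVneq (F v) 0.
    by rewrite mul0r big1 // => u _; rewrite !mul0r.
  rewrite (@fmulE _ _ _ [fset (u - v) | u in A]%fset) => [|w h2 h3]; last first.
    apply/imfsetP; exists (w + v); last by rewrite addrK.
    by have [] := main v (w + v); rewrite ?addrK // E.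
  rewrite big_imfset /=; last by move=> u u' _ _ /addIr.
  rewrite mulr_sumr; apply: eq_bigr => u _.
  by rewrite mulrA opprB addrA subrK.
rewrite exchange_big /= (@fmulE _ _ _ A) => [|u /fmul_neq0[v [h1 h2]] h3]; last first.
  by have [] := main v u h1 h2 h3.
apply: eq_bigr => u _; have [->|Hn0] := eqVneq (H (e - u)) 0.
  by rewrite mulr0 big1 // => v _; rewrite mulr0.
rewrite (@fmulE _ _ _ A) => [|v h1 h2]; last by have [] := main v u h1 h2 Hn0.
by rewrite mulr_suml.
Qed.

Record gser := GSer { gval : fser K V; gvalP : good gval }.

Lemma gser_inj (F G : gser) : gval F = gval G -> F = G.
Proof.
case: F G => [F hF] [G hG] /= e; subst G; congr GSer; exact: Prop_irrelevance.
Qed.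

HB.instance Definition _ := gen_eqMixin gser.
HB.instance Definition _ := gen_choiceMixin gser.

Definition gser_zero := GSer good0.
Definition gser_add (F G : gser) := GSer (good_fadd (gvalP F) (gvalP G)).
Definition gser_opp (F : gser) := GSer (good_opp (gvalP F)).
Definition gmon d u := GSer (good_fmon d u).
Definition gser_mul (F G : gser) := GSer (good_fmul (gvalP F) (gvalP G)).

Fact gser_addA : associative gser_add.
Proof. by move=> F G H; apply/gser_inj/funext => e; apply: addrA. Qed.
Fact gser_addC : commutative gser_add.
Proof. by move=> F G; apply/gser_inj/funext => e; apply: addrC. Qed.
Fact gser_add0 : left_id gser_zero gser_add.
Proof. by move=> F; apply/gser_inj/funext => e; apply: add0r. Qed.
Fact gser_addN : left_inverse gser_zero gser_opp gser_add.
Proof. by move=> F; apply/gser_inj/funext => e; apply: addNr. Qed.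

HB.instance Definition _ :=
  GRing.isZmodule.Build gser gser_addA gser_addC gser_add0 gser_addN.

Fact gser_mulA : associative gser_mul.
Proof. by move=> F G H; apply/gser_inj/fmulA; apply: gvalP. Qed.
Fact gser_mulC : commutative gser_mul.
Proof. by move=> F G; apply/gser_inj/fmulC. Qed.
Fact gser_mul1 : left_id (gmon 1 0) gser_mul.
Proof. by move=> F; apply/gser_inj/fmul1. Qed.
Fact gser_mulDl : left_distributive gser_mul gser_add.
Proof. by move=> F G H; apply/gser_inj/fmulDl; apply: gvalP. Qed.
Fact gser_one_neq0 : gmon 1 0 != gser_zero.
Proof.
apply/eqP => /(congr1 (fun F : gser => gval F 0)) /eqP.
by rewrite /= /fmon eqxx oner_eq0.
Qed.

HB.instance Definition _ := GRing.Zmodule_isComNzRing.Build gser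
  gser_mulA gser_mulC gser_mul1 gser_mulDl gser_one_neq0.

End GoodSeries.

(** * Supports, geometric series and constant terms *)

Section SeriesRing.
Context {K : fieldType} {V : choiceType} {D : seq V} {lev : V -> nat}.
Local Notation R := (@gser K V D lev).
Local Notation gmon := (@gmon K V D lev).
Implicit Types (F G : R) (e u v : {malg int[V]}) (x y : V).

Lemma gvalD F G : gval (F + G) = fadd (gval F) (gval G). Proof. by []. Qed.
Lemma gvalM F G : gval (F * G) = fmul (gval F) (gval G). Proof. by []. Qed.
Lemma gval1 : gval (1 : R) = fone. Proof. by []. Qed.

Lemma gvalDE F G e : gval (F + G) e = gval F e + gval G e. Proof. by []. Qed.
Lemma gvalNE F e : gval (- F) e = - gval F e. Proof. by []. Qed.

Lemma gval_prod (I : Type) (r : seq I) (P : pred I) (F : I -> R) :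
  gval (\prod_(i <- r | P i) F i) = \big[fmul/fone]_(i <- r | P i) gval (F i).
Proof. exact: (big_morph _ gvalM gval1). Qed.

Lemma gval_sumE (I : Type) (r : seq I) (P : pred I) (F : I -> R) e :
  gval (\sum_(i <- r | P i) F i) e = \sum_(i <- r | P i) gval (F i) e.
Proof. exact: (big_morph (fun G : R => gval G e) (fun F G => gvalDE F G e)). Qed.

Lemma gser_eqP F G : (forall e, gval F e = gval G e) -> F = G.
Proof. by move=> h; apply/gser_inj/funext. Qed.

Lemma gmonM d d' u u' : gmon d u * gmon d' u' = gmon (d * d') (u + u').
Proof.
apply: gser_eqP => e; rewrite gvalM fmul_mon /= /fmon.
by rewrite subr_eq [u' + u]addrC; case: ifP; rewrite ?mulr0.
Qed.

Lemma gmonX d u n : gmon d u ^+ n = gmon (d ^+ n) (u *+ n).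
Proof.
elim: n => [|n IH]; first by rewrite !expr0 mulr0n.
by rewrite exprS IH gmonM -exprS -mulrS.
Qed.

Lemma gmon_prod (I : Type) (r : seq I) (P : pred I) (d : I -> K) (u : I -> {malg int[V]}) :
  \prod_(i <- r | P i) gmon (d i) (u i) =
  gmon (\prod_(i <- r | P i) d i) (\sum_(i <- r | P i) u i).
Proof.
by elim/big_rec3: _ => // i a b c _ ->; rewrite gmonM.
Qed.

Definition gcst (d : K) : R := gmon d 0.

Fact gcst_additive : {morph gcst : a b / a - b}.
Proof.
move=> a b; apply: gser_eqP => e; rewrite gvalDE gvalNE /= /fmon.
by case: ifP; rewrite ?subr0.
Qed.

Fact gcst_multiplicative : multiplicative gcst.
Proof. by split=> [a b|] //; rewrite /gcst gmonM addr0. Qed.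

HB.instance Definition _ := GRing.isAdditive.Build K R gcst gcst_additive.
HB.instance Definition _ := GRing.isMultiplicative.Build K R gcst gcst_multiplicative.

Lemma gcst_gmon d u : gcst d * gmon 1 u = gmon d u.
Proof. by rewrite gmonM mulr1 add0r. Qed.

Lemma gval_gcst d F e : gval (gcst d * F) e = d * gval F e.
Proof. by rewrite gvalM fmul_mon subr0. Qed.

Lemma gval_gmonM d u F e : gval (gmon d u * F) e = d * gval F (e - u).
Proof. by rewrite gvalM fmul_mon. Qed.

Definition supp_in (C : {malg int[V]} -> Prop) F := forall e, gval F e != 0 -> C e.

Lemma supp_inM (C C' C2 : {malg int[V]} -> Prop) F G :
  (forall u v, C u -> C' v -> C2 (u + v)) ->
  supp_in C F -> supp_in C' G -> supp_in C2 (F * G).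
Proof.
move=> h hF hG e /fmul_neq0[u [h1 h2]].
by rewrite -(subrK u e) addrC; apply: h; [apply: hF|apply: hG].
Qed.

Lemma supp_inD C F G : supp_in C F -> supp_in C G -> supp_in C (F + G).
Proof.
move=> hF hG e; have [F0|Fn0] := eqVneq (gval F e) 0; last by move=> _; apply: hF.
by rewrite gvalDE F0 add0r; apply: hG.
Qed.

Lemma supp_inN C F : supp_in C F -> supp_in C (- F).
Proof. by move=> hF e; rewrite gvalNE oppr_eq0; apply: hF. Qed.

Lemma supp_in0 C : supp_in C 0.
Proof. by move=> e; rewrite eqxx. Qed.

Lemma supp_in_mon (C : {malg int[V]} -> Prop) d u : C u -> supp_in C (gmon d u).
Proof.
by move=> h e; rewrite /= /fmon; case: (e =P u) => [->|_] //; rewrite eqxx.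
Qed.

Lemma supp_inW (C C' : {malg int[V]} -> Prop) F :
  supp_in C F -> (forall e, C e -> C' e) -> supp_in C' F.
Proof. by move=> hF h e /hF /h. Qed.

Section SubMonoid.
Variable C : {malg int[V]} -> Prop.
Hypothesis C0 : C 0.
Hypothesis CD : forall u v, C u -> C v -> C (u + v).

Lemma supp_in_cst d : supp_in C (gcst d). Proof. exact: supp_in_mon. Qed.
Lemma supp_in1 : supp_in C 1. Proof. exact: supp_in_cst. Qed.

Lemma supp_in_mul F G : supp_in C F -> supp_in C G -> supp_in C (F * G).
Proof. exact: supp_inM. Qed.

Lemma supp_in_prod (I : Type) (r : seq I) (P : pred I) (F : I -> R) :
  (forall i, P i -> supp_in C (F i)) -> supp_in C (\prod_(i <- r | P i) F i).
Proof.
move=> h; apply: (big_ind (supp_in C)) => //; first exact: supp_in1.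
exact: supp_in_mul.
Qed.

Lemma supp_in_sum (I : Type) (r : seq I) (P : pred I) (F : I -> R) :
  (forall i, P i -> supp_in C (F i)) -> supp_in C (\sum_(i <- r | P i) F i).
Proof.
move=> h; apply: (big_ind (supp_in C)) => //; first exact: supp_in0.
by move=> x y; apply: supp_inD.
Qed.

Lemma supp_inX F n : supp_in C F -> supp_in C (F ^+ n).
Proof.
move=> h; elim: n => [|n IH]; first exact: supp_in1.
by rewrite exprS; apply: supp_in_mul.
Qed.
End SubMonoid.

Lemma malg_mulrn_inj u m n : u != 0 -> u *+ m = u *+ n -> m = n.
Proof.
move=> u0 e; have [x hx] : exists x, u@_x != 0.
  apply: contrapT => h; case/eqP: u0; apply/malgP => x; rewrite mcoeff0.
  by apply: contrapT => /eqP hx; apply: h; exists x.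
by have := congr1 (mcoeff x) e; rewrite !mcoeffMn => /(mulrIn hx).
Qed.

Lemma fgeom_pow d u m : u != 0 -> fgeom d u (u *+ m) = d ^+ m :> K.
Proof.
move=> u0; rewrite /fgeom.
have -> : [set n | u *+ n = u *+ m] = [set m].
  by apply/seteqP; split=> n /= => [/malg_mulrn_inj|->] //; apply.
exact: fsbig_set1.
Qed.

Lemma fgeom_out d u e : (forall m, u *+ m <> e) -> fgeom d u e = 0 :> K.
Proof. by move=> h; apply: fsbig1 => m /= /h. Qed.

Lemma fgeom_neq0 d u e : fgeom d u e != 0 :> K -> exists m, u *+ m = e.
Proof.
move=> h; apply: contrapT => hN; case/eqP: h; apply: fgeom_out => m hm.
by apply: hN; exists m.
Qed.

Lemma good_fgeom d u : (forall x, 0 <= lvl D lev x u) -> good D lev (fgeom d u : fser K V).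
Proof.
move=> h; exists [::], 0%N => e /fgeom_neq0[m <-] x.
by rewrite lvlMn /bnd /=; apply: mulrn_wge0.
Qed.

Definition ggeom d u (h : forall x, 0 <= lvl D lev x u) : R := GSer (good_fgeom d h).

Lemma ggeom_inv d u (h : forall x, 0 <= lvl D lev x u) : u != 0 ->
  (1 - gmon d u) * ggeom d h = 1.
Proof.
move=> u0; rewrite mulrBl mul1r; apply: gser_eqP => e.
rewrite gvalDE gvalNE gval_gmonM /= /fone /fmon.
have [[m <-]|hN] := pselect (exists m, u *+ m = e); last first.
  rewrite !fgeom_out ?mulr0 ?subr0.
  - by case: eqP => // e0; case: hN; exists 0%N; rewrite mulr0n.
  - by move=> m hm; apply: hN; exists m.+1; rewrite mulrS hm addrC subrK.
  - by move=> m hm; apply: hN; exists m.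
rewrite fgeom_pow //; case: m => [|m].
  rewrite mulr0n eqxx sub0r fgeom_out ?mulr0 ?subr0 // => m.
  move/eqP; rewrite -subr_eq0 opprK -mulrSr => /eqP.
  by rewrite -(mulr0n u) => /malg_mulrn_inj -/(_ u0).
rewrite mulrSr addrK fgeom_pow // -exprS subrr.
by case: eqP => // e0; have := @malg_mulrn_inj u m.+1 0 u0; rewrite mulrSr e0 mulr0n => /(_ erefl).
Qed.

Lemma supp_ggeom (C : {malg int[V]} -> Prop) d u (h : forall x, 0 <= lvl D lev x u) :
  (forall m, C (u *+ m)) -> supp_in C (ggeom d h).
Proof. by move=> hC e /fgeom_neq0[m <-]. Qed.

Lemma lvlU x y (a : int) : 0 <= a -> 0 <= lvl D lev x << a *g y >>.
Proof.
move=> ha; rewrite /lvl addr_ge0 ?sumr_ge0 // => [|t _];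
by rewrite mcoeffU; case: eqP.
Qed.

(** The power sum p_r of the alphabet S, given by its coefficients because S may be infinite. *)
Definition fpow (S : set V) (r : nat) : fser K V :=
  fun e => if `[< exists2 x, S x & e = << r%:Z *g x >> >] then 1 else 0.

Lemma falph_fpow S : falph S = fpow S 1.
Proof. by []. Qed.

Lemma good_fpow S r : good D lev (fpow S r).
Proof.
exists [::], 0%N => e; rewrite /fpow; case: asboolP => [[y _ ->] _ x|]; last by rewrite eqxx.
exact: lvlU.
Qed.

Definition gpow S r : R := GSer (good_fpow S r).

Lemma supp_gpow (C : {malg int[V]} -> Prop) S r :
  (forall x, S x -> C << r%:Z *g x >>) -> supp_in C (gpow S r).
Proof.
by move=> h e; rewrite /= /fpow; case: asboolP => [[x hx ->] _|]; [apply: h|rewrite eqxx].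
Qed.

Lemma gpow_sum k (z : 'I_k -> V) S r : injective z -> (0 < r)%N ->
  (forall x, S x <-> exists i, x = z i) ->
  gpow S r = \sum_i gmon 1 << z i >> ^+ r.
Proof.
move=> zi r0 hS; apply: gser_eqP => e; rewrite gval_sumE /= /fpow.
have E i : gmon 1 << z i >> ^+ r = gmon 1 << r%:Z *g z i >>.
  by rewrite gmonX expr1n -monalgUMn natz.
under eq_bigr do rewrite E /= /fmon.
have inj i j : << r%:Z *g z i >> = << r%:Z *g z j >> :> {malg int[V]} -> i = j.
  move=> e1; have := congr1 (mcoeff (z i)) e1; rewrite mcoeffUU mcoeffU.
  by case: eqP => [/zi->//|_] /eqP; rewrite mulr0n; lia.
case: asboolP => [[x /hS[i ->] ->]|hN].
  rewrite (bigD1 i) //= eqxx big1 ?addr0 // => j hj.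
  by case: eqP => // /inj e1; rewrite e1 eqxx in hj.
rewrite big1 // => i _; case: eqP => // ei; case: hN; exists (z i) => //.
by apply/hS; exists i.
Qed.

Definition sfree (S : set V) e := forall x, S x -> e@_x = 0.

Lemma sfree0 S : sfree S 0. Proof. by move=> x _; rewrite mcoeff0. Qed.

Lemma sfreeD S u v : sfree S u -> sfree S v -> sfree S (u + v).
Proof. by move=> hu hv x hx; rewrite mcoeffD hu ?hv. Qed.

Lemma sfreeB S u v : sfree S u -> sfree S v -> sfree S (u - v).
Proof. by move=> hu hv x hx; rewrite mcoeffB hu ?hv ?subr0. Qed.

Lemma sfreeU S a y : ~ S y -> sfree S << a *g y >>.
Proof. by move=> h x hx; rewrite mcoeffU; case: eqP => // e; rewrite -e in hx. Qed.

Lemma good_CT S (F : fser K V) : good D lev F -> good D lev (CT S F).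
Proof.
move=> [T [B h]]; exists T, B => e; rewrite /CT; case: ifP => _; first exact: h.
by rewrite eqxx.
Qed.

Definition gct S F : R := GSer (good_CT S (gvalP F)).

Lemma gctD S : {morph gct S : F G / F + G}.
Proof. by move=> F G; apply: gser_eqP => e; rewrite gvalDE /= /CT; case: ifP; rewrite ?addr0. Qed.

Lemma gct0 S : gct S 0 = 0.
Proof. by apply: gser_eqP => e; rewrite /= /CT; case: ifP. Qed.

Lemma gct_sum S (I : Type) (r : seq I) (P : pred I) (F : I -> R) :
  gct S (\sum_(i <- r | P i) F i) = \sum_(i <- r | P i) gct S (F i).
Proof. exact: (big_morph _ (gctD S) (gct0 S)). Qed.

Lemma gctB S F G : gct S (F - G) = gct S F - gct S G.
Proof.
rewrite gctD; congr (_ + _); apply: gser_eqP => e.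
by rewrite gvalNE /= /CT; case: ifP; rewrite ?oppr0.
Qed.

(** A monomial free of S does not change the exponents at S. This makes the constant term linear
    over the alphabets and over the other levels. *)
Lemma gctM S F G : supp_in (sfree S) F -> gct S (F * G) = F * gct S G.
Proof.
move=> hF; apply: gser_eqP => e; rewrite [LHS]/=.
have [A hA] := good_finite e (gvalP F) (gvalP G).
rewrite gvalM (@fmulE _ _ _ _ _ A) => [|u h1 h2]; last first.
  by apply: hA => //; move: h2; rewrite /= /CT; case: ifP; rewrite // eqxx.
rewrite /CT (fmulE hA); case: asboolP => h.
  apply: eq_bigr => u _; have [->|hu] := eqVneq (gval F u) 0; first by rewrite !mul0r.
  rewrite /= /CT asboolT //; apply: sfreeB => //; exact: hF.
rewrite big1 // => u _; have [->|hu] := eqVneq (gval F u) 0; first by rewrite mul0r.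
rewrite /= /CT asboolF ?mulr0 // => h'; apply: h => x hx.
by rewrite -(subrK u e); apply: (@sfreeD S _ _ h' (hF _ hu)).
Qed.

Lemma gct_id S F : supp_in (sfree S) F -> gct S F = F.
Proof.
move=> hF; apply: gser_eqP => e; rewrite /= /CT; case: asboolP => // h.
by apply/esym/eqP; apply: contrapT => /negP /hF.
Qed.

Lemma gct_supp S F (C : {malg int[V]} -> Prop) : supp_in C F -> supp_in C (gct S F).
Proof. by move=> hF e; rewrite /= /CT; case: ifP => [_ /hF//|]; rewrite eqxx. Qed.

Lemma gct_mon S d u : ~ sfree S u -> gct S (gmon d u) = 0.
Proof.
move=> h; apply: gser_eqP => e; rewrite /= /CT /fmon; case: asboolP => // h'.
by case: eqP => // eu; rewrite eu in h'.
Qed.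

Lemma gctU S S' F : gct (S `|` S') F = gct S (gct S' F).
Proof.
apply: gser_eqP => e; rewrite /= /CT.
case: asboolP => [h|h]; case: asboolP => [h1|h1] //.
- by rewrite asboolT // => x hx; apply: h; right.
- by case: h1 => x hx; apply: h; left.
- by rewrite asboolF // => h2; apply: h => x [/h1|/h2].
Qed.

End SeriesRing.

(** * Plethysm and power sums *)

Lemma divfMK (K : fieldType) (a b u : K) : b != 0 -> a / b * u * b = a * u.
Proof. by move=> h; rewrite mulrAC mulfVK. Qed.

Lemma subf_div (K : fieldType) (a b a' b' : K) : b != 0 -> b' != 0 ->
  a / b - a' / b' = (a * b' - a' * b) / (b * b').
Proof. by move=> h h'; field; rewrite h h'. Qed.

(** * The substitution of a power of q *)

Section QSubst.
Local Open Scope quotient_scope.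
Local Notation "x %:F" := (tofrac x : Qq).

Lemma fracE (d : Qq) : let u : {ratio {poly rat}} := repr (d : {fraction {poly rat}}) in
  d = (\n_u)%:F / (\d_u)%:F.
Proof.
move=> u; have d0 : (\d_u)%:F != 0 by rewrite tofrac_eq0 denom_ratioP.
apply: (canRL (mulfK d0)).
rewrite -[d]reprK -/u.
have -> : (\pi_{fraction {poly rat}} u : {fraction {poly rat}}) * tofrac \d_u =
  FracField.mul (\pi u) (tofrac \d_u) by [].
rewrite !piE; apply/eqmodP; rewrite /= FracField.equivfE /FracField.mulf.
by rewrite !numden_Ratio ?mulf_neq0 ?oner_eq0 ?denom_ratioP // mulr1 !mulr1 mulrC.
Qed.

Variable r : nat.
Hypothesis r_gt0 : (0 < r)%N.

Let sub (p : {poly rat}) : {poly rat} := p \Po 'X^r.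

Let sub_neq0 p : p != 0 -> sub p != 0.
Proof.
move=> p0; rewrite /sub -size_poly_eq0 -lt0n.
have := size_comp_poly p 'X^r; rewrite size_polyXn /= => e.
have [|h] := posnP (size (p \Po 'X^r)); last by [].
move/eqP; rewrite size_poly_eq0 => h.
have := lead_coef_comp p (q := 'X^r); rewrite (eqP h) lead_coef0 size_polyXn ltnS r_gt0.
rewrite lead_coefXn expr1n mulr1 => /(_ isT) /esym /eqP.
by rewrite lead_coef_eq0 (negPf p0).
Qed.

(** The value is independent of the representative chosen by [repr]: composition with X ^ r
    preserves the cross-multiplied equality, and r > 0 keeps denominators nonzero. *)
Lemma qsubst_frac (a b : {poly rat}) : b != 0 ->
  qsubst r (a%:F / b%:F) = (sub a)%:F / (sub b)%:F.
Proof.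
move=> b0; rewrite /qsubst; set d := a%:F / b%:F.
have := fracE d => /=; set u := repr _ => e.
have u0 : \d_u != 0 by apply: denom_ratioP.
have h (p : {poly rat}) : p != 0 -> p%:F != 0 by rewrite tofrac_eq0.
have e2 : (\n_u)%:F = d * (\d_u)%:F by rewrite [in RHS]e mulfVK ?h.
have {}e : \n_u * b = a * \d_u.
  apply/eqP; rewrite -(@tofrac_eq {poly rat}) !tofracM e2 /d; apply/eqP.
  by apply: divfMK; apply: h.
apply/eqP; rewrite eqr_div ?h ?sub_neq0 //; apply/eqP.
by rewrite -!tofracM -!rmorphM e.
Qed.

Fact qsubst_additive : {morph qsubst r : x y / x - y}.
Proof.
move=> x y; rewrite (fracE x) (fracE y).
set a := \n__; set b := \d__; set a' := \n__; set b' := \d__.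
have b0 : b != 0 by apply: denom_ratioP.
have b0' : b' != 0 by apply: denom_ratioP.
have h (p : {poly rat}) : p != 0 -> p%:F != 0 by rewrite tofrac_eq0.
have -> : a%:F / b%:F - a'%:F / b'%:F = (a * b' - a' * b)%:F / (b * b')%:F.
  by rewrite tofracB !tofracM subf_div ?h.
by rewrite !qsubst_frac ?mulf_neq0 // /sub rmorphB !rmorphM tofracB !tofracM subf_div ?h ?sub_neq0.
Qed.

Fact qsubst_multiplicative : multiplicative (qsubst r).
Proof.
split=> [x y|]; last first.
  have -> : (1 : Qq) = 1%:F / 1%:F by rewrite tofrac1 divff ?oner_neq0.
  by rewrite qsubst_frac ?oner_neq0 // /sub rmorph1.
rewrite (fracE x) (fracE y).
set a := \n__; set b := \d__; set a' := \n__; set b' := \d__.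
have b0 : b != 0 by apply: denom_ratioP.
have b0' : b' != 0 by apply: denom_ratioP.
have h (p : {poly rat}) : p != 0 -> p%:F != 0 by rewrite tofrac_eq0.
have -> : a%:F / b%:F * (a'%:F / b'%:F) = (a * a')%:F / (b * b')%:F.
  by rewrite !tofracM mulf_div.
by rewrite !qsubst_frac ?mulf_neq0 // /sub !rmorphM mulf_div.
Qed.

Lemma qsubst_q : qsubst r q = q ^+ r.
Proof.
have -> : q = ('X : {poly rat})%:F / 1%:F by rewrite tofrac1 divr1.
by rewrite qsubst_frac ?oner_neq0 // /sub rmorph1 tofrac1 !divr1 comp_polyX tofracXn.
Qed.
End QSubst.

(** Carries the proof of r > 0, so that the morphism instances can be attached; at r = 0
    denominators such as 1 - q would become 0. *)
Definition qsub r (r_gt0 : (0 < r)%N) (d : Qq) : Qq := qsubst r d.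

HB.instance Definition _ r (r_gt0 : (0 < r)%N) :=
  GRing.isAdditive.Build Qq Qq (qsub r_gt0) (qsubst_additive r_gt0).
HB.instance Definition _ r (r_gt0 : (0 < r)%N) :=
  GRing.isMultiplicative.Build Qq Qq (qsub r_gt0) (qsubst_multiplicative r_gt0).

Section PlethysmRing.
Context {V : choiceType} {D : seq V} {lev : V -> nat}.
Local Notation R := (@gser Qq V D lev).
Local Notation gmon := (@gmon Qq V D lev).
Local Notation gcst := (@gcst Qq V D lev).
Implicit Types (F G : R) (e u v : {malg int[V]}).

Lemma malg_mulrIn r : (0 < r)%N -> injective (fun u : {malg int[V]} => u *+ r).
Proof.
move=> r0 u v /= e; apply/malgP => x.
have := congr1 (mcoeff x) e; rewrite !mcoeffMn => /eqP.
by rewrite eqr_pMn2r // => /eqP.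
Qed.

Section FixedPower.
Variable r : nat.
Hypothesis r_gt0 : (0 < r)%N.

Lemma plethp_mul (F : fser Qq V) u : plethp r F (u *+ r) = qsubst r (F u).
Proof.
rewrite /plethp; have -> : [set v : {malg int[V]} | v *+ r = u *+ r] = [set u].
  by apply/seteqP; split=> v /= => [/(malg_mulrIn r_gt0)|->].
exact: fsbig_set1.
Qed.

Lemma plethp_out (F : fser Qq V) e : (forall u, u *+ r <> e) -> plethp r F e = 0.
Proof. by move=> h; apply: fsbig1 => u /= /h. Qed.

Lemma plethp_ext (F G : fser Qq V) : (forall u, plethp r F (u *+ r) = G (u *+ r)) ->
  (forall e, (forall u, u *+ r <> e) -> G e = 0) -> plethp r F = G.
Proof.
move=> h1 h2; apply/funext => e.
have [[u <-]|hN] := pselect (exists u, u *+ r = e); first exact: h1.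
have h : forall u, u *+ r <> e by move=> u hu; apply: hN; exists u.
by rewrite plethp_out ?h2.
Qed.

Lemma plethpD (F G : fser Qq V) : plethp r (fadd F G) = fadd (plethp r F) (plethp r G).
Proof.
apply: plethp_ext => [u|e h]; rewrite /fadd ?plethp_mul.
  exact: (rmorphD (qsub r_gt0)).
by rewrite !plethp_out ?addr0.
Qed.

Lemma plethp_fmon d u (F : fser Qq V) :
  plethp r (fmul (fmon d u) F) = fmul (fmon (qsubst r d) (u *+ r)) (plethp r F).
Proof.
apply: plethp_ext => [v|e h]; rewrite !fmul_mon ?plethp_mul.
  by rewrite -mulrnBl plethp_mul fmul_mon; apply: (rmorphM (qsub r_gt0)).
rewrite plethp_out ?mulr0 // => v hv; apply: (h (v + u)).
by rewrite mulrnDl hv subrK.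
Qed.

Lemma plethp_fpow S : plethp r (fpow S 1 : fser Qq V) = fpow S r.
Proof.
have E x : << r%:Z *g x >> = << 1 *g x >> *+ r :> {malg int[V]}.
  by rewrite -monalgUMn natz.
apply: plethp_ext => [u|e h]; rewrite ?plethp_mul /fpow.
  case: asboolP => [[x hx ->]|hN].
    rewrite asboolT; last by exists x; rewrite // E.
    exact: (rmorph1 (qsub r_gt0)).
  rewrite asboolF; first exact: (rmorph0 (qsub r_gt0)).
  by move=> [x hx]; rewrite E => /(malg_mulrIn r_gt0) e; apply: hN; exists x.
by rewrite asboolF // => -[x hx]; rewrite E => /esym; apply: h.
Qed.

(** Additivity and compatibility with monomial shifts give multiplicativity when one factor is a
    finite sum of monomials, as the alphabet Z^(s) is. *)
Lemma plethp_sum_fmon (I : Type) (s : seq I) (d : I -> Qq) (u : I -> {malg int[V]}) F :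
  plethp r (gval ((\sum_(i <- s) gmon (d i) (u i)) * F)) =
  fmul (gval (\sum_(i <- s) gmon (qsubst r (d i)) (u i *+ r) : R)) (plethp r (gval F)).
Proof.
elim: s => [|i s IH].
  rewrite !big_nil mul0r; apply: plethp_ext => [v|e h]; rewrite ?plethp_mul.
    rewrite [LHS](rmorph0 (qsub r_gt0)); apply/esym/fsbig1 => w _; exact: mul0r.
  by apply/fsbig1 => w _; exact: mul0r.
(* Distributivity is available for good series; p_r[.] multiplies all levels by r, and so also the
   lower bound. *)
have gp (G : R) : good D lev (plethp r (gval G)).
  have [T [B h]] := gvalP G; exists T, (B * r)%N => e he x.
  have [[w ew]|hN] := pselect (exists w, w *+ r = e); last first.
    by move: he; rewrite plethp_out ?eqxx // => w hw; apply: hN; exists w.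
  move: he; rewrite -ew plethp_mul => he.
  have hG : gval G w != 0.
    by apply: contra he => /eqP ->; apply/eqP; apply: (rmorph0 (qsub r_gt0)).
  have := h w hG x; rewrite lvlMn /bnd; case: ifP => _; last by move=> ?; apply: mulrn_wge0.
  by rewrite -mulr_natr natz PoszM => ?; nia.
rewrite !big_cons mulrDl !gvalD plethpD gvalM plethp_fmon IH.
by rewrite (fmulDl (gvalP _) (gvalP _) (gp F)).
Qed.
End FixedPower.
End PlethysmRing.

(** The partition behind a monomial in the power sums. Variable number i stands for p_(i+1), hence
    the shift. *)
Definition parts (t : {cmonom nat}) : seq nat :=
  flatten [seq nseq (t i) i.+1 | i <- finsupp t].

Lemma parts_gt0 t : all (leq 1) (parts t).
Proof.
apply/allP => r /flattenP[s /mapP[i _ ->]].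
by rewrite mem_nseq => /andP[_ /eqP ->].
Qed.

Lemma count_parts t i : count_mem i.+1 (parts t) = t i.
Proof.
rewrite /parts count_flatten -map_comp sumnE big_map.
rewrite (eq_bigr (fun j => (if j == i then t i else 0)%N)); last first.
  by move=> j _ /=; rewrite count_nseq /= eqSS; case: eqP => [->|_]; rewrite ?mul1n ?mul0n.
rewrite -big_mkcond big_const_seq iter_addn_0.
have [h|h] := boolP (i \in finsupp t).
  by rewrite (count_uniq_mem _ (fset_uniq _)) h muln1.
by rewrite [t i]fsfun_dflt ?mul0n.
Qed.

Section GSubst.
Context {K : fieldType} {V : choiceType} {D : seq V} {lev : V -> nat}.
Local Notation R := (@gser K V D lev).
Local Notation gcst := (@gcst K V D lev).

Definition gsubst (p : nat -> R) (P : {malg rat[{cmonom nat}]}) : R :=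
  \sum_(t <- msupp P) gcst (ratr P@_t) * \prod_(r <- parts t) p r.

Lemma psubst_gval (p : nat -> fser K V) (p' : nat -> R) P :
  (forall r, (0 < r)%N -> p r = gval (p' r)) -> psubst p P = gval (gsubst p' P).
Proof.
move=> h; apply/funext => e; rewrite gval_sumE; apply: eq_bigr => t _.
rewrite gval_gcst; congr (_ * _).
rewrite /parts big_flatten big_map gval_prod.
suff -> : \big[fmul/fone]_(i <- finsupp t) \big[fmul/fone]_(j < t i) p i.+1 =
   \big[fmul/fone]_(j <- finsupp t) gval (\prod_(i <- nseq (t j) j.+1) p' i) by [].
apply: eq_bigr => i _; rewrite big_nseq.
transitivity (gval (\prod_(j < t i) p' i.+1)).
  by rewrite gval_prod; apply: eq_bigr => j _; apply: h.
by rewrite prodr_const card_ord iter_mulr_1.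
Qed.

End GSubst.

(** * Weights of polynomials in the power sums *)

Section PowerSumIndependence.
Local Notation R := (@gser rat nat [::] (fun=> 0%N)).
Local Notation pp := (fun r => (@gpow rat nat [::] (fun=> 0%N) setT r)).

Lemma edegE (e : {malg int[nat]}) (A : {fset nat}) :
  (msupp e `<=` A)%fset -> edeg e = \sum_(x <- A) e@_x.
Proof.
move=> h; rewrite /edeg (big_fset_incl _ h) // => x _ hx.
by rewrite mcoeff_outdom.
Qed.

Lemma edegD (e u : {malg int[nat]}) : edeg (e + u) = edeg e + edeg u.
Proof.
pose A := (msupp e `|` msupp u)%fset.
rewrite (@edegE _ A) ?msuppD_le // (@edegE e A) ?fsubsetUl // (@edegE u A) ?fsubsetUr //.
by rewrite -big_split; apply: eq_bigr => x _; rewrite mcoeffD.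
Qed.

Lemma edegU (x : nat) (a : int) : edeg << a *g x >> = a.
Proof. by rewrite (edegE (msuppU_le)) big_seq_fset1 mcoeffUU. Qed.

(** The monomial arising in a product of power sums when each factor p_r contributes the r-th power
    of one chosen variable; [idx] may repeat. *)
Definition place (s idx : seq nat) : {malg int[nat]} :=
  \sum_(p <- zip s idx) << p.1%:Z *g p.2 >>.

Lemma edeg_place s idx : size idx = size s -> edeg (place s idx) = (sumn s)%:Z.
Proof.
elim: s idx => [|r s IH] [|i idx] //=.
  by rewrite /place big_nil /edeg msupp0 big_seq_fset0.
by case=> hs; rewrite /place big_cons edegD edegU -/(place s idx) IH // PoszD.
Qed.

Lemma gval_pp_ge0 (s : seq nat) (e : {malg int[nat]}) : 0 <= gval (\prod_(r <- s) pp r) e.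
Proof.
elim: s e => [|r s IH] e.
  by rewrite big_nil /= /fone /fmon; case: ifP.
rewrite big_cons gvalM.
have [A hA] := good_finite e (gvalP (pp r)) (gvalP (\prod_(r <- s) pp r)).
rewrite (fmulE hA); apply: sumr_ge0 => u _; apply: mulr_ge0 => //.
by rewrite /= /fpow; case: ifP.
Qed.

Lemma gval_pp_neq0 (s : seq nat) (e : {malg int[nat]}) : gval (\prod_(r <- s) pp r) e != 0 ->
  exists2 idx, size idx = size s & e = place s idx.
Proof.
elim: s e => [|r s IH] e.
  rewrite big_nil /= /fone /fmon; case: (e =P 0) => [->|]; last by rewrite eqxx.
  by exists [::]; rewrite // /place big_nil.
rewrite big_cons gvalM => /fmul_neq0[u [h1 /IH[idx hs he]]].
move: h1; rewrite /= /fpow; case: asboolP; last by rewrite eqxx.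
move=> [x _ ex] _; exists (x :: idx); first by rewrite /= hs.
by rewrite /place big_cons -/(place s idx) -he ex addrC subrK.
Qed.

(** All contributions are nonnegative and one of them is positive, so nothing cancels. *)
Lemma gval_pp_place s idx : size idx = size s ->
  0 < gval (\prod_(r <- s) pp r) (place s idx).
Proof.
elim: s idx => [|r s IH] [|i idx] //= hs.
  by rewrite /place !big_nil /= /fone /fmon eqxx.
rewrite big_cons gvalM; set e := place _ _.
have [A hA] := good_finite e (gvalP (pp r)) (gvalP (\prod_(r <- s) pp r)).
rewrite (fmulE hA).
have eE : e - << r%:Z *g i >> = place s idx.
  by rewrite /e /place big_cons addrC addKr.
have p1 : 0 < gval (pp r) << r%:Z *g i >>.
  by rewrite /= /fpow asboolT //; exists i.
have h2 : 0 < gval (\prod_(r <- s) pp r) (e - << r%:Z *g i >>).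
  by rewrite eE; apply: IH; case: hs.
rewrite (big_fsetD1 << r%:Z *g i >>); last first.
  by apply: hA; rewrite gt_eqF.
apply: ltr_pwDl; first exact: mulr_gt0.
apply: sumr_ge0 => u _; apply: mulr_ge0; last exact: gval_pp_ge0.
by rewrite /= /fpow; case: ifP.
Qed.

Lemma place_out s idx k : k \notin idx -> (place s idx)@_k = 0.
Proof.
move=> hk; rewrite /place raddf_sum big1_seq //= => -[a b] h.
rewrite mcoeffU /=; case: eqP => // e; case/negP: hk; rewrite -e.
elim: s idx h => [|r s IH] [|i idx] //=; rewrite !in_cons xpair_eqE.
by case/orP => [/andP[_ ->]//|/IH ->]; rewrite orbT.
Qed.

Lemma place_coef s idx k : uniq idx -> size idx = size s -> k \in idx ->
  (place s idx)@_k = (nth 0%N s (index k idx))%:Z.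
Proof.
elim: s idx => [|r s IH] [|i idx] //=.
move=> /andP[hi ui] [hs]; rewrite in_cons /place big_cons mcoeffD -/(place s idx).
rewrite mcoeffU [k == i]eq_sym.
case: (i =P k) => [<- _|ne] /=; last by move=> hk; rewrite mulr0n add0r IH.
by rewrite mulr1n (place_out s hi) addr0.
Qed.

Lemma psum_pp r : psum r = gval (pp r).
Proof.
apply/funext => e; rewrite /psum /= /fpow; congr (if _ then _ else _).
by apply: asbool_equiv_eq; split=> [[x]|[x _]]; exists x.
Qed.

(* Leading term: among the offending monomials take one with most parts; the
   coefficient of x_0^{r_0} x_1^{r_1} ... with these parts sees no other one. *)
Lemma psubst_homogeneous P d t : homogeneous d (psubst psum P) -> t \in msupp P ->
  sumn (parts t) = d.
Proof.
move=> hP ht; apply/eqP/negPn/negP => ne.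
pose L0 := (fun t => size (parts t)).
have [t0 [ht0 ne0 max0]] : exists t0, [/\ t0 \in msupp P, sumn (parts t0) != d &
    forall t1, t1 \in msupp P -> sumn (parts t1) != d -> (L0 t1 <= L0 t0)%N].
  pose s := [seq u <- msupp P | sumn (parts u) != d].
  have hs : t \in s by rewrite mem_filter ne.
  pose m := \max_(u <- s) L0 u.
  have [u us um] : exists2 u, u \in s & L0 u = m.
    have : (0 < size s)%N by case: (s) hs.
    rewrite /m; clearbody s; elim: s {hs m} => // a s IH _.
    rewrite big_cons; case: (leqP (\max_(u <- s) L0 u) (L0 a)) => h.
      by exists a; rewrite ?mem_head.
    case: s IH h => [|b s] IH h; first by move: h; rewrite big_nil.
    by have [u hu e] := IH isT; exists u; rewrite // in_cons hu orbT.
  exists u; move: us; rewrite mem_filter => /andP[h1 h2]; split => // t1 h3 h4.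
  by rewrite um; apply: leq_bigmax_seq => //; rewrite mem_filter h4.
set L := L0 t0 in max0; pose e0 := place (parts t0) (iota 0 L).
have szL : size (iota 0 L) = size (parts t0) by rewrite size_iota.
have : psubst psum P e0 = 0.
  apply/eqP/negPn/negP => /hP; rewrite edeg_place // => -[] /eqP.
  by rewrite (negPf ne0).
pose G t1 : rat := ratr P@_t1 * gval (\prod_(r <- parts t1) pp r) e0.
have -> : psubst psum P e0 = \sum_(t1 <- msupp P) G t1.
  rewrite (@psubst_gval _ _ _ _ _ pp) => [|r _]; last exact: psum_pp.
  by rewrite gval_sumE; apply: eq_bigr => t1 _; rewrite gval_gcst.
rewrite (big_fsetD1 t0) // big1_seq /= => [|t1 /fsetD1P[ne1 ht1]]; last first.
  apply/eqP; rewrite mulf_eq0; apply/orP; right.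
  apply/negPn/negP => /gval_pp_neq0[idx hidx E].
  (* Equal degrees make t1 an offending monomial too, so by maximality it has at most L parts. *)
  have hsum : sumn (parts t1) = sumn (parts t0).
    by have := edeg_place hidx; rewrite -E edeg_place // => -[].
  have hle : (size idx <= size (iota 0 L))%N.
    by rewrite hidx szL; apply: max0; rewrite ?hsum.
  (* Each of x_0, ..., x_(L-1) has a positive exponent in [e0] and must be chosen by some factor.
     With at most L factors, [idx] is a permutation of these variables, and reading off exponents
     shows that t0 and t1 have the same parts. *)
  have sub : {subset iota 0 L <= idx}.
    move=> k hk; apply/negPn/negP => hN; have := place_out (parts t1) hN.
    rewrite -E place_coef ?iota_uniq // => -[] h0.
    have hi : (index k (iota 0 L) < size (parts t0))%N by rewrite -szL index_mem.
    have := allP (parts_gt0 t0) _ (mem_nth 0%N hi).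
    by rewrite h0.
  have [eqs eqm] := uniq_min_size (iota_uniq 0 L) sub hle.
  have ui : uniq idx by rewrite -(eq_uniq eqs eqm) iota_uniq.
  have ps : perm_eq (parts t0) (parts t1).
    have pt (s : seq nat) (ix : seq nat) : uniq ix -> size ix = size s ->
        s = [seq absz ((place s ix)@_k) | k <- ix].
      move=> u sz; apply: (@eq_from_nth _ 0%N); first by rewrite size_map sz.
      move=> i hi; rewrite (nth_map 0%N) ?sz // place_coef ?mem_nth ?sz //=.
      by rewrite index_uniq ?sz.
    rewrite (pt _ _ (iota_uniq 0 L) szL) (pt _ _ ui hidx) -E.
    by apply: perm_map; apply: uniq_perm => //; exact: iota_uniq.
  case/eqP: ne1; apply/eqP/cmP => i.
  by rewrite -!count_parts (permP ps).
rewrite addr0 => /eqP; rewrite mulf_eq0 => /orP[|].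
  by rewrite fmorph_eq0 mcoeff_eq0 ht0.
by rewrite gt_eqF // gval_pp_place.
Qed.

End PowerSumIndependence.

(** * One level in the ring of series *)

Section OneLevel.
Context {K : fieldType} {V : choiceType} {D : seq V} {lev : V -> nat}.
Local Notation R := (@gser K V D lev).
Local Notation gmon := (@gmon K V D lev).
Local Notation gcst := (@gcst K V D lev).
Variables (q kap : K) (k l c M : nat) (z : 'I_k -> V) (w : 'I_l -> V).
Hypothesis c_gt0 : (0 < c)%N.
Hypothesis q_neq0 : q != 0.
Hypothesis kap_neq0 : kap != 0.
Hypothesis q_generic : forall n u v : nat, (0 < n)%N -> (0 < u)%N -> (0 < v)%N ->
  u%:R * q ^+ n != v%:R.
Hypothesis z_inj : injective z.
Hypothesis zw : forall i j, z i != w j.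
Hypothesis lvl_zw : forall i j x, 0 <= lvl D lev x (<< z i >> - << w j >>).

Let S : set V := [set x | exists i, x = z i].
Let B := (M + c * k.-1)%N.
Let Z i : R := gmon 1 << z i >>.
Let Zi i : R := gmon 1 (- << z i >>).
Let W j : R := gmon 1 (- << w j >>).

Let kern : R := dyson q kap c M gcst Z * \prod_i Zi i ^+ B.
Definition cauchy_inv : R := \prod_j \prod_i \prod_(m < c)
  ggeom (kap * q ^- m) (lvl_zw i j).

Definition level_ct (F : R) : R := gct S (F * (kern * cauchy_inv)).

Let Cst : K := gcoef q kap c M (fun _ : 'I_k => 0%N).

Lemma ct_monomial a (e : 'I_k -> nat) :
  gct S (gcst a * \prod_i Z i ^+ e i * \prod_i Zi i ^+ B) =
  if [forall i, e i == B] then gcst a else 0.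
Proof.
rewrite -mulrA -big_split /=.
have E i : Z i ^+ e i * Zi i ^+ B = gmon 1 (<< (e i)%:Z - B%:Z *g z i >>).
  rewrite /Z /Zi !gmonX !expr1n gmonM mulr1 mulNrn -!monalgUMn -monalgUB.
  by rewrite !natz.
under eq_bigr do rewrite E.
rewrite gmon_prod big1 // gcst_gmon.
have cf i : (\sum_i << (e i)%:Z - B%:Z *g z i >>)@_(z i) = (e i)%:Z - B%:Z.
  rewrite raddf_sum /= (bigD1 i) //= mcoeffUU big1 ?addr0 // => j ji.
  by rewrite mcoeffU; case: eqP => // /z_inj e1; rewrite e1 eqxx in ji.
case: forallP => h.
  rewrite [X in gmon _ X]big1 => [|i _]; last by rewrite (eqP (h i)) subrr monalgU0.
  by apply: gct_id; apply: supp_in_mon; apply: sfree0.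
apply: gct_mon => hs; apply: h => i; apply/eqP.
by have := hs (z i) (ex_intro _ i erefl); rewrite cf; lia.
Qed.

Lemma level_ct_truncated mu (beta : seq nat) : all (leq 1) mu ->
  (sumn mu + size beta <= k)%N ->
  gct S (\prod_(r <- mu) (\sum_i Z i ^+ r) * kern *
      \prod_(n <- beta) hsym (gletters q kap c gcst Z) n) =
  gcst (Cst * (\prod_(r <- mu) pspec q kap c M r * \prod_(n <- beta) qcoef q M n)).
Proof.
move=> hmu hk.
rewrite -(transfer c_gt0 q_neq0 kap_neq0 q_generic (M := M) (f := gcst) (Z := Z)
  (E := fun F => gct S (F * \prod_i Zi i ^+ B))) //; last first.
- exact: ct_monomial.
- by move=> x y; rewrite mulrDl gctD.
by congr (gct S _); rewrite /kern; ring.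
Qed.

(* The expansion of 1 / prod (1 - y / w_j) is replaced by a truncation at order
   L; the error only has monomials of degree below - L in some w_j, so it does
   not contribute to a given coefficient once L is large. *)
Let nonpos (e : {malg int[V]}) := forall j, e@_(w j) <= 0.
Let small L (e : {malg int[V]}) := (exists j, e@_(w j) < - L%:Z) /\ nonpos e.
Let below j L (e : {malg int[V]}) := e@_(w j) <= - L%:Z /\ nonpos e.

Let nonpos0 : nonpos 0. Proof. by move=> j; rewrite mcoeff0. Qed.
Let nonposD u v : nonpos u -> nonpos v -> nonpos (u + v).
Proof. by move=> hu hv j; rewrite mcoeffD; have := hu j; have := hv j; lia. Qed.
Let smallD L u v : nonpos u -> small L v -> small L (u + v).
Proof.
move=> hu [[j hj] hv]; split; last exact: nonposD.
by exists j; rewrite mcoeffD; have := hu j; lia.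
Qed.

Let zw_coef i j : (<< z i >> - << w j >> : {malg int[V]})@_(w j) = - 1.
Proof. by rewrite mcoeffB mcoeffUU mcoeffU (negPf (zw i j)) mulr0n sub0r. Qed.

Let zw_neq0 i j : << z i >> - << w j >> != 0 :> {malg int[V]}.
Proof.
by apply/eqP => /(congr1 (mcoeff (w j))) /eqP; rewrite zw_coef mcoeff0.
Qed.

Let zw_nonpos i j : nonpos (<< z i >> - << w j >>).
Proof.
move=> j'; rewrite mcoeffB !mcoeffU (negPf (zw i j')) mulr0n sub0r.
by case: eqP; rewrite ?mulr1n ?mulr0n.
Qed.

Let nonposMn n u : nonpos u -> nonpos (u *+ n).
Proof. by move=> hu j; rewrite mcoeffMn; apply: mulrn_wle0. Qed.

Let G j : R := \prod_i \prod_(m < c) ggeom (kap * q ^- m) (lvl_zw i j).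
Let ys j : seq R := [seq W j * y | y <- gletters q kap c gcst Z].
Let T L j : R := \sum_(n < L.+1) hsym (ys j) n.

Let ysE j (i : 'I_k) (m : 'I_c) :
  W j * (gcst (kap * q ^- m) * Z i) = gmon (kap * q ^- m) (<< z i >> - << w j >>).
Proof. by rewrite /W /Z gcst_gmon gmonM mul1r addrC. Qed.

Let prod_ys j : (\prod_(y <- ys j) (1 - y)) * G j = 1.
Proof.
rewrite /ys big_map big_gletters -big_split /=; apply: big1 => i _.
rewrite -big_split /=; apply: big1 => m _.
by rewrite ysE ggeom_inv.
Qed.

Let G_nonpos j : supp_in nonpos (G j).
Proof.
apply: supp_in_prod => // i _; apply: supp_in_prod => // m _.
by apply: supp_ggeom => n; apply: nonposMn.
Qed.

Let ys_below j y : y \in ys j -> supp_in (below j 1) y.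
Proof.
move=> /(@mapP _ _ _ _ y)[y' hy' ->]; have [i [m ->]] := gletterP hy'; rewrite ysE.
by apply: supp_in_mon; split; rewrite ?zw_coef.
Qed.

Let belowD j m n u v : below j m u -> below j n v -> below j (m + n) (u + v).
Proof.
by move=> [h1 h2] [h3 h4]; split; [rewrite mcoeffD; lia | apply: nonposD].
Qed.

(** Since [G j] inverts the product exactly, [T L j - G j] is [G j] times the defect estimated by
    [filt_hsym_inv]. *)
Lemma truncation_error L j : supp_in (below j L.+1) (T L j - G j).
Proof.
have -> : T L j - G j = G j * ((\prod_(y <- ys j) (1 - y)) * T L j - 1).
  by rewrite mulrBr mulrA mulrC mulr1 [G j * _]mulrC prod_ys mulr1.
have F0 : supp_in (below j 0) (G j).
  by apply: (supp_inW (@G_nonpos j)) => e he; split => //; have := he j; lia.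
rewrite -[L.+1]add0n; apply: (supp_inM (@belowD j 0 L.+1)) => //.
apply: (@filt_hsym_inv R (fun n => supp_in (below j n))) => [|n y|n|n y y'|n y|m n y y'|y].
- by apply: supp_in_mon; split; rewrite ?mcoeff0.
- by move=> hy; apply: (supp_inW hy) => e [h1 h2]; split=> //; lia.
- exact: supp_in0.
- exact: supp_inD.
- exact: supp_inN.
- exact: supp_inM (@belowD j m n).
- exact: ys_below.
Qed.

Lemma cauchy_truncation L : supp_in (small L) (cauchy_inv - \prod_j T L j).
Proof.
have TE j : T L j = T L j - G j + G j by rewrite subrK.
have sm j : supp_in (small L) (G j - T L j).
  rewrite -opprB; apply: supp_inN; apply: (supp_inW (@truncation_error L j)) => e [h1 h2].
  by split => //; exists j; lia.
have nT j : supp_in nonpos (T L j).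
  rewrite TE; apply: supp_inD => //.
  by apply: (supp_inW (@truncation_error L j)) => e [].
rewrite /cauchy_inv -/(G _).
have {}H (s : seq 'I_l) : supp_in nonpos (\prod_(j <- s) G j) /\
   supp_in (small L) (\prod_(j <- s) G j - \prod_(j <- s) T L j).
  elim: s => [|j s [IH1 IH2]]; first by rewrite !big_nil subrr; split;
    [apply: supp_in1|apply: supp_in0].
  rewrite !big_cons; split; first exact: supp_in_mul.
  have -> : G j * \prod_(j <- s) G j - T L j * \prod_(j <- s) T L j =
     \prod_(j <- s) G j * (G j - T L j) + T L j * (\prod_(j <- s) G j - \prod_(j <- s) T L j).
    by ring.
  by apply: supp_inD; apply: (supp_inM (@smallD L)).
by have [] := H (index_enum 'I_l).
Qed.

Lemma level_ct_powersums mu : all (leq 1) mu -> (sumn mu + l <= k)%N ->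
  level_ct (\prod_(r <- mu) (\sum_i Z i ^+ r)) =
  gcst (Cst * \prod_(r <- mu) pspec q kap c M r) *
    \prod_j \prod_(m < M) (1 - gmon (q ^+ m) (- << w j >>)).
Proof.
move=> hmu hk; set P := \prod_(r <- mu) _.
have Zn i : supp_in nonpos (Z i).
  by apply: supp_in_mon => j; rewrite mcoeffU (negPf (zw i j)).
have Zin i : supp_in nonpos (Zi i).
  by apply: supp_in_mon => j; rewrite mcoeffN mcoeffU (negPf (zw i j)) oppr0.
have Pn : supp_in nonpos (P * kern).
  have cn a : supp_in nonpos (gcst a) by apply: supp_in_cst.
  apply: supp_in_mul => //.
    apply: supp_in_prod => // r _; apply: supp_in_sum => i _; exact: supp_inX.
  apply: supp_in_mul => //; last first.
    by apply: supp_in_prod => // i _; apply: supp_inX.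
  apply: supp_in_mul => //; apply: supp_in_prod => // i _; apply: supp_in_prod => // j _.
    by apply: supp_inD => //; apply: supp_inN.
  apply: supp_in_prod => // m _.
  by apply: supp_in_mul => //; apply: supp_inD => //; apply: supp_inN; apply: supp_in_mul.
have main L : (M <= L)%N -> supp_in (small L) (level_ct P -
   gcst (Cst * \prod_(r <- mu) pspec q kap c M r) *
    \prod_j \prod_(m < M) (1 - gmon (q ^+ m) (- << w j >>))).
  move=> hL.
  suff <- : gct S (P * kern * \prod_j T L j) = gcst (Cst * \prod_(r <- mu) pspec q kap c M r) *
    \prod_j \prod_(m < M) (1 - gmon (q ^+ m) (- << w j >>)).
    rewrite /level_ct -gctB mulrA -mulrBr; apply: gct_supp.
    by apply: (supp_inM (@smallD L)) => //; apply: cauchy_truncation.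
  have Tsum j : T L j = \sum_(n < L.+1) W j ^+ n * hsym (gletters q kap c gcst Z) n.
    by apply: eq_bigr => n _; rewrite hsym_scale.
  under eq_bigr do rewrite Tsum.
  rewrite bigA_distr_bigA /= mulr_sumr gct_sum.
  have Qprod j : \prod_(m < M) (1 - gmon (q ^+ m) (- << w j >>)) =
      \sum_(n < L.+1) W j ^+ n * gcst (qcoef q M n).
    have -> : \prod_(m < M) (1 - gmon (q ^+ m) (- << w j >>)) =
       \prod_(y <- map gcst [seq q ^+ r | r <- iota 0 M]) (1 - y * W j).
      have -> : iota 0 M = index_iota 0 M by rewrite /index_iota subn0.
      by rewrite !big_map big_mkord; apply: eq_bigr => m _; rewrite /W gcst_gmon.
    rewrite (@prod_esgn _ _ _ L) ?size_map ?size_iota //.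
    by apply: eq_bigr => n _; rewrite mulrC -rmorph_esgn.
  under [X in _ = _ * X]eq_bigr do rewrite Qprod.
  rewrite bigA_distr_bigA /= mulr_sumr; apply: eq_bigr => b _.
  rewrite big_split [X in _ = _ * X]big_split /=.
  have Wfree : supp_in (sfree S) (\prod_j W j ^+ b j).
    apply: supp_in_prod => [||j _]; [exact: sfree0|exact: sfreeD|].
    apply: supp_inX; [exact: sfree0|exact: sfreeD|].
    apply: supp_in_mon => x [i ->]; rewrite mcoeffN mcoeffU.
    by rewrite eq_sym (negPf (zw i j)) oppr0.
  rewrite [P * kern * _]mulrCA gctM // [RHS]mulrCA; congr (_ * _).
  (* Each w_j contributes exactly one g_n, so beta has length l and the bound on the weight of mu is
     k - l. *)
  have := @level_ct_truncated mu [seq val (b j) | j <- enum 'I_l] hmu.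
  rewrite size_map size_enum_ord => /(_ hk).
  have bE (A : comNzRingType) (F : nat -> A) :
      \prod_(n <- [seq val (b j) | j <- enum 'I_l]) F n = \prod_j F (b j).
    by rewrite big_map big_enum.
  rewrite !bE => ->.
  by rewrite !rmorphM !rmorph_prod mulrA.
apply: gser_eqP => e; apply/eqP; rewrite -subr_eq0.
pose L := (M + \sum_j absz (e@_(w j)))%N.
apply: contrapT => /negP h; have [] := main L _ e h; first by rewrite /L; lia.
case=> j + _; rewrite /L (bigD1 j) //=; lia.
Qed.

End OneLevel.

(** * From power sums to plethysms *)

Section Multiplicativity.
Context {A : comNzRingType} (free : A -> Prop) (Lam : A -> A) (Lam0 : A).
Context (pz pi : nat -> A) (N : nat).
Hypothesis LamD : {morph Lam : x y / x + y}.
Hypothesis LamM : forall x y, free x -> Lam (x * y) = x * Lam y.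
Hypothesis Lam_pz : forall mu, all (leq 1) mu -> (sumn mu <= N)%N ->
  Lam (\prod_(r <- mu) pz r) = Lam0 * \prod_(r <- mu) pi r.

(* Lam substitutes pi for the power sums pz, up to the factor Lam0, as long as
   the weight is at most N; hom d x x' says that this persists when x, of
   weight d, is replaced by x'. *)
Definition compat (d : nat) (x x' : A) := forall mu, all (leq 1) mu ->
  (sumn mu + d <= N)%N ->
  Lam (\prod_(r <- mu) pz r * x) = Lam0 * (\prod_(r <- mu) pi r * x').

Definition hom (d : nat) (x x' : A) := forall e y y',
  compat e y y' -> compat (d + e) (x * y) (x' * y').

Lemma compat1 : compat 0 1 1.
Proof. by move=> mu h1; rewrite addn0 !mulr1; apply: Lam_pz. Qed.

Lemma hom_pz r : (0 < r)%N -> hom r (pz r) (pi r).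
Proof.
move=> r0 e y y' h mu hmu hs.
have := h (r :: mu); rewrite !big_cons /= r0 => /(_ hmu) H.
have -> : \prod_(j <- mu) pz j * (pz r * y) = pz r * \prod_(j <- mu) pz j * y by ring.
by rewrite H; [ring | lia].
Qed.

Lemma hom_free x : free x -> hom 0 x x.
Proof.
move=> fx e y y' h mu hmu hs; rewrite mulrCA LamM // h //; ring.
Qed.

Lemma homW d d' x x' : (d <= d')%N -> hom d x x' -> hom d' x x'.
Proof. by move=> hd h e y y' hy mu hmu hs; apply: (h e y y' hy) => //; lia. Qed.

Lemma homD d x x' y y' : hom d x x' -> hom d y y' -> hom d (x + y) (x' + y').
Proof.
move=> hx hy e u u' hu mu hmu hs.
by rewrite !mulrDl !mulrDr LamD (hx _ _ _ hu) // (hy _ _ _ hu) // mulrDr.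
Qed.

(** Because [hom] quantifies over all compatible cofactors, multiplication is just composition,
    although Lam itself is not multiplicative. *)
Lemma homM d e x x' y y' : hom d x x' -> hom e y y' -> hom (d + e) (x * y) (x' * y').
Proof.
move=> hx hy f u u' hu; rewrite -addnA -!mulrA; apply: hx; exact: hy.
Qed.

Lemma hom1 : hom 0 1 1.
Proof. by move=> e y y' h; rewrite !mul1r. Qed.

Lemma hom_prod (I : eqType) (s : seq I) (d : I -> nat) (x x' : I -> A) :
  (forall i, i \in s -> hom (d i) (x i) (x' i)) ->
  hom (\sum_(i <- s) d i) (\prod_(i <- s) x i) (\prod_(i <- s) x' i).
Proof.
elim: s => [|i s IH] h; first by rewrite !big_nil; apply: hom1.
rewrite !big_cons; apply: homM; first by apply: h; rewrite mem_head.
by apply: IH => j hj; apply: h; rewrite in_cons hj orbT.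
Qed.

Lemma hom_sum (I : eqType) (s : seq I) d (x x' : I -> A) : free 0 ->
  (forall i, i \in s -> hom d (x i) (x' i)) ->
  hom d (\sum_(i <- s) x i) (\sum_(i <- s) x' i).
Proof.
move=> f0; elim: s => [|i s IH] h.
  by rewrite !big_nil; apply: homW (hom_free f0).
rewrite !big_cons; apply: homD; first by apply: h; rewrite mem_head.
by apply: IH => j hj; apply: h; rewrite in_cons hj orbT.
Qed.

Lemma Lam_hom d x x' : hom d x x' -> (d <= N)%N -> Lam x = Lam0 * x'.
Proof.
move=> h hd; have := h _ _ _ compat1 [::] isT.
by rewrite !big_nil !mul1r !mulr1 addn0; apply.
Qed.
End Multiplicativity.

Section PlethysmHom.
Context {K : fieldType} {V : choiceType} {D : seq V} {lev : V -> nat}.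
Local Notation R := (@gser K V D lev).
Context (free : R -> Prop) (Lam : R -> R) (Lam0 : R) (pz pi : nat -> R) (N : nat).
Hypothesis LamD : {morph Lam : x y / x + y}.
Hypothesis LamM : forall x y, free x -> Lam (x * y) = x * Lam y.
Hypothesis free_cst : forall a, free (gcst a).

(** In a factor for p_r the part with [pz r] has weight r, and the free part has weight 0, raised to
    r by [homW]. The weights along a monomial then add up to the sum of its parts. *)
Lemma hom_gsubst (X Y : nat -> R) d P :
  (forall r, free (X r)) -> (forall r, free (Y r)) ->
  (forall t, t \in msupp P -> sumn (parts t) = d) ->
  hom Lam Lam0 pz pi N d (gsubst (fun r => pz r * Y r + X r) P)
    (gsubst (fun r => pi r * Y r + X r) P).
Proof.
move=> fX fY hP; apply: (hom_sum LamD LamM) => [|t ht].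
  suff -> : (0 : R) = gcst 0 by apply: free_cst.
  by rewrite rmorph0.
have hf x : free x -> hom Lam Lam0 pz pi N 0 x x by exact: (@hom_free R free Lam Lam0 pz pi N LamM).
rewrite -[d]add0n; apply: homM; first exact: hf (free_cst _).
rewrite -(hP t ht) sumnE; apply: hom_prod => r hr.
have r0 := allP (parts_gt0 t) r hr.
apply: (homD LamD); last by apply: (homW (leq0n r)); apply: hf.
by rewrite -{1}[r]addn0; apply: homM; [apply: hom_pz|apply: hf].
Qed.
End PlethysmHom.

Lemma q_neq0 : q != 0.
Proof. by rewrite /q tofrac_eq0 polyX_eq0. Qed.

(** Comparison of constant coefficients: that of u X ^ n is 0, that of v is not. *)
Lemma q_generic (n u v : nat) : (0 < n)%N -> (0 < u)%N -> (0 < v)%N ->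
  u%:R * q ^+ n != v%:R.
Proof.
move=> n0 u0 v0; rewrite /q -tofracXn -!(rmorph_nat (@tofrac {poly rat})) -tofracM.
rewrite tofrac_eq; apply/eqP => /(congr1 (fun p : {poly rat} => p`_0)) /eqP.
rewrite -polyC_natr mul_polyC coefZ coefXn -polyC_natr coefC /=.
by rewrite (ltn_eqF n0) mulr0 eq_sym pnatr_eq0 (gtn_eqF v0).
Qed.

(** * The specialized alphabet and the constants of a level *)

Section GenericConstants.
Variables (K : fieldType) (q : K).
Hypothesis q_neq0 : q != 0.
Hypothesis q_generic : forall n u v : nat, (0 < n)%N -> (0 < u)%N -> (0 < v)%N ->
  u%:R * q ^+ n != v%:R.

Let one_sub_q n : (0 < n)%N -> 1 - q ^+ n != 0.
Proof. exact: one_sub_qX q_generic n. Qed.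

Let q_exp_neq0 n : q ^+ n != 0. Proof. by rewrite expf_neq0. Qed.

Lemma geometric_q (r : nat) n : (0 < r)%N ->
  \sum_(l < n) q ^+ (r * l) = (1 - q ^+ (r * n)) / (1 - q ^+ r).
Proof.
move=> r0; apply: (canRL (mulfK (one_sub_q r0))).
elim: n => [|n IH]; first by rewrite big_ord0 mul0r muln0 expr0 subrr.
by rewrite big_ord_recr mulrDl IH mulnS exprD; ring.
Qed.

(** Numerator and denominator of [pspec] are geometric sums in q ^ r, so 1 - q ^ r cancels; M + c -
    1 - b = A turns the power with M into the one with A. *)
Lemma pspecE (A b c M r : nat) : (0 < r)%N -> (0 < c)%N -> (M + c = A + b + 1)%N ->
  pspec q (q ^+ b) c M r =
  (q ^+ (r * A) - q ^+ (r * c) / q ^+ (r * b.+1)) / (1 - q ^+ (r * c)).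
Proof.
move=> r0 c0 hM; rewrite /pspec /psym big_map.
have -> : iota 0 M = index_iota 0 M by rewrite /index_iota subn0.
rewrite big_mkord (eq_bigr (fun l : 'I_M => q ^+ (r * l))) => [|l _]; last first.
  by rewrite -exprM mulnC.
rewrite geometric_q //.
have -> : \sum_(l < c) (q ^+ b * q ^- l) ^+ r =
   q ^+ (r * b) / q ^+ (r * c.-1) * ((1 - q ^+ (r * c)) / (1 - q ^+ r)).
  rewrite -geometric_q // [LHS](reindex_inj rev_ord_inj) big_distrr /=.
  apply: eq_bigr => l _; have hl := ltn_ord l.
  have -> : (r * c.-1 = r * (c - l.+1) + r * l)%N by nia.
  rewrite exprMn exprVn -!exprM exprD ![(r * _)%N]mulnC.
  have := q_exp_neq0 ((c - l.+1) * r); have := q_exp_neq0 (l * r).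
  by set x := q ^+ (l * r); set y := q ^+ ((c - l.+1) * r) => hx hy; field; rewrite hx hy.
have h1 := one_sub_q r0; have hc : (0 < r * c)%N by rewrite muln_gt0 r0.
have h2 := one_sub_q hc.
have e1 : q ^+ (r * c) = q ^+ (r * c.-1) * q ^+ r.
  by rewrite -exprD; congr (_ ^+ _); nia.
have e2 : q ^+ (r * b.+1) = q ^+ (r * b) * q ^+ r.
  by rewrite -exprD; congr (_ ^+ _); nia.
have e3 : q ^+ (r * A) * q ^+ (r * b) = q ^+ (r * M) * q ^+ (r * c.-1).
  by rewrite -!exprD; congr (_ ^+ _); nia.
have n1 := q_exp_neq0 (r * b); have n2 := q_exp_neq0 (r * c.-1); have n3 := q_exp_neq0 r.
have {}e3 : q ^+ (r * A) = q ^+ (r * M) * q ^+ (r * c.-1) / q ^+ (r * b).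
  by rewrite -e3 mulfK.
move: h2; rewrite e3 e2 e1.
set v := q ^+ (r * b) in n1 *; set w := q ^+ (r * c.-1) in n2 *.
set x := q ^+ r in n3 h1 *; set y := q ^+ (r * M) => h2.
by field; rewrite ?h1 ?h2 ?n1 ?n2 ?n3.
Qed.

(** The leading coefficient of (q z)_b, which is split off to make the kernel a product of monic
    factors z - q ^ - (l + 1). *)
Definition level_sign (b : nat) : K := (-1) ^+ b * q ^+ 'C(b.+1, 2).

(** [level_sign] contributes C(b + 1, 2) to the exponent of q and [gcoef0E] contributes C(c - 1, 2)
    - b (c - 1). The sum is the binomial of b + 2 - c over 2, also for negative b + 2 - c. *)
Lemma level_sign_exp (b c : nat) : (0 < c)%N ->
  level_sign b * ((-1) ^+ c.-1 * q ^+ 'C(c.-1, 2) / (q ^+ b) ^+ c.-1) =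
  (-1) ^ (b%:Z + 1 - c%:Z) * q ^ binz2 (b%:Z + 2 - c%:Z).
Proof.
move=> c0; have b2 (n : nat) : (n%:Z * (n%:Z - 1) = 2 * 'C(n, 2)%:Z)%R.
  case: n => [|n]; first by rewrite mul0r.
  have -> : n.+1%:Z - 1 = n by lia.
  by rewrite -PoszM; have := mul_bin_diag n.+1 1; rewrite /= bin1 => ->; rewrite PoszM.
have e1 : binz2 (b%:Z + 2 - c%:Z) = 'C(b.+1, 2)%:Z + 'C(c.-1, 2)%:Z - (b * c.-1)%:Z.
  rewrite /binz2.
  have -> : (b%:Z + 2 - c%:Z) * (b%:Z + 2 - c%:Z - 1) =
     ('C(b.+1, 2)%:Z + 'C(c.-1, 2)%:Z - (b * c.-1)%:Z) * 2.
    have := b2 b.+1; have := b2 c.-1.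
    have -> : c%:Z = c.-1%:Z + 1 by lia.
    have -> : b.+1%:Z = b%:Z + 1 by lia.
    rewrite PoszM; move: (c.-1%:Z) (b%:Z) ('C(c.-1, 2)%:Z) ('C(b.+1, 2)%:Z) => x y u v h1 h2.
    by lia.
  by rewrite mulzK.
have e2 : (-1) ^ (b%:Z + 1 - c%:Z) = (-1) ^+ b * (-1) ^+ c.-1 :> K.
  have -> : b%:Z + 1 - c%:Z = b%:Z - c.-1%:Z by lia.
  rewrite expfzDr ?oppr_eq0 ?oner_neq0 // -exprnP -exprnN.
  by rewrite invr_sign.
rewrite e1 e2 !expfzDr // -!exprnP -exprnN exprM /level_sign.
have := expf_neq0 c.-1 (q_exp_neq0 b).
set x := (q ^+ b) ^+ c.-1 => x0; set s := (-1) ^+ b; set s' := (-1) ^+ c.-1.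
by set u := q ^+ _; set v := q ^+ _; field.
Qed.

Lemma level_constant (k b c M : nat) : (0 < c)%N ->
  level_sign b ^+ k * gcoef q (q ^+ b) c M (fun _ : 'I_k => 0%N) =
  (-1) ^ (k%:Z * (b%:Z + 1 - c%:Z)) * q ^ (k%:Z * binz2 (b%:Z + 2 - c%:Z)) *
  \prod_(j < k) (qp q (M + c.-1 + j * c) * qp q (j.+1 * c) /
       (qp q (M + j * c) * qp q (c.-1 + j * c) * qp q c)).
Proof.
move=> c0; rewrite (gcoef0E _ _ c0 q_neq0 (q_exp_neq0 b) q_generic).
rewrite big_split /= mulrA; congr (_ * _).
rewrite prodr_const card_ord -exprMn level_sign_exp // exprMn.
by rewrite ![k%:Z * _]mulrC -!exprz_exp -!exprnP.
Qed.
End GenericConstants.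

Lemma pspec_qsubst (A b c M r : nat) : (0 < r)%N -> (0 < c)%N -> (M + c = A + b + 1)%N ->
  pspec q (q ^+ b) c M r = qsubst r ((q ^+ A - q ^+ c / q ^+ b.+1) / (1 - q ^+ c)).
Proof.
move=> r0 c0 hM; rewrite (pspecE q_neq0 q_generic r0 c0 hM).
have qr n : qsub r0 (q ^+ n) = q ^+ (r * n).
  by rewrite rmorphXn exprM; congr (_ ^+ _); apply: qsubst_q.
rewrite -/(qsub r0 _) fmorph_div !rmorphB fmorph_div rmorph1.
by congr ((_ - _ / _) / (_ - _)); rewrite -qr.
Qed.

Lemma qp_qpoch n : qp q n = qpoch q n.
Proof. by apply: eq_bigr => l _; rewrite exprS. Qed.

(** * From the integrand to the kernel *)

Section LevelKernel.
Variables (K : fieldType) (q : K) (A : comNzRingType) (phi : {rmorphism K -> A}).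
Hypothesis q_neq0 : q != 0.
Variables (k : nat) (Z Zi Mo : 'I_k -> A).
Hypothesis ZZi : forall i, Z i * Zi i = 1.

Lemma poch_inverse i a :
  \prod_(l < a) (1 - phi (q ^+ l) * Zi i) = Zi i ^+ a * \prod_(l < a) (Z i - phi (q ^+ l)).
Proof.
rewrite -[in Zi i ^+ a](card_ord a) -prodr_const -big_split; apply: eq_bigr => l _ /=.
by rewrite mulrBr [Zi i * Z i]mulrC ZZi mulrC.
Qed.

Lemma poch_direct i b :
  \prod_(l < b) (1 - phi (q ^+ l.+1) * Z i) =
  phi (level_sign q b) * \prod_(l < b) (Z i - phi (q ^- l.+1)).
Proof.
have -> : level_sign q b = \prod_(l < b) (- q ^+ l.+1).
  rewrite prodrN card_ord /level_sign; congr (_ * _); rewrite prodrXr; congr (_ ^+ _).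
  elim: b => [|b IH]; first by rewrite big_ord0.
  by rewrite big_ord_recr /= -IH binS bin1 addnC.
rewrite rmorph_prod -big_split; apply: eq_bigr => l _ /=.
have h : q ^+ l.+1 != 0 by rewrite expf_neq0.
have e : phi (q ^+ l.+1) * phi (q ^- l.+1) = 1 by rewrite -rmorphM divff ?rmorph1.
by rewrite rmorphN mulrBr !mulNr e; ring.
Qed.

(** The roots q ^ - b, ..., q ^ - 1 of (q z)_b and 1, ..., q ^ (a - 1) of (1/z)_a form one run of
    consecutive powers. *)
Lemma poch_merge i a b :
  \prod_(l < a + b) (Z i - phi ((q ^+ b)^-1 * q ^+ l)) =
  \prod_(l < b) (Z i - phi (q ^- l.+1)) * \prod_(l < a) (Z i - phi (q ^+ l)).
Proof.
have h n : q ^+ n != 0 by rewrite expf_neq0.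
rewrite addnC big_split_ord /=; congr (_ * _).
  rewrite (reindex_inj rev_ord_inj); apply: eq_bigr => l _ /=.
  congr (_ - phi _); have hl := ltn_ord l.
  have {1}-> : (b = b - l.+1 + l.+1)%N by lia.
  by rewrite exprD invfM mulrAC mulVf ?mul1r.
by apply: eq_bigr => l _; rewrite exprD mulrA mulVf ?mul1r.
Qed.

(** [Zi] plays 1 / z and [Mo] the monomial 1 / z ^ (b + 1 - c), whose exponent can have either sign;
    hence its description through a relation between natural powers. *)
Lemma level_kernel (a b c M : nat) : (0 < c)%N -> (M + c = a + b + 1)%N ->
  (forall i, Zi i ^+ a * Mo i = Zi i ^+ M) ->
  (\prod_i ((\prod_(l < a) (1 - phi (q ^+ l) * Zi i)) *
     \prod_(l < b) (1 - phi (q ^+ l.+1) * Z i))) *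
  (\prod_(i < k) \prod_(j < k | (i < j)%N)
     ((\prod_(l < c) (1 - phi (q ^+ l) * (Z i * Zi j))) *
      \prod_(l < c) (1 - phi (q ^+ l.+1) * (Z j * Zi i)))) *
  \prod_i Mo i =
  phi (level_sign q b ^+ k) *
    (dyson q (q ^+ b) c M phi Z * \prod_i Zi i ^+ (M + c * k.-1)).
Proof.
move=> c0 hM hMo.
have -> : \prod_(i < k) \prod_(j < k | (i < j)%N)
     ((\prod_(l < c) (1 - phi (q ^+ l) * (Z i * Zi j))) *
      \prod_(l < c) (1 - phi (q ^+ l.+1) * (Z j * Zi i))) =
   (\prod_i Zi i ^+ (c * k.-1)) *
   \prod_(i < k) \prod_(j < k | (i < j)%N) \prod_(l < c)
     ((Z j - phi (q ^+ l) * Z i) * (Z i - phi (q ^+ l.+1) * Z j)).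
  transitivity (\prod_(i < k) \prod_(j < k | (i < j)%N) ((Zi i ^+ c * Zi j ^+ c) *
     \prod_(l < c) ((Z j - phi (q ^+ l) * Z i) * (Z i - phi (q ^+ l.+1) * Z j)))).
    apply: eq_bigr => i _; apply: eq_bigr => j _.
    have -> : Zi i ^+ c * Zi j ^+ c = \prod_(l < c) (Zi i * Zi j).
      by rewrite prodr_const card_ord exprMn.
    rewrite -!big_split; apply: eq_bigr => l _ /=.
    set x := phi _; set y := phi _.
    have -> : 1 - x * (Z i * Zi j) = Zi j * (Z j - x * Z i).
      by rewrite mulrBr [Zi j * Z j]mulrC ZZi; ring.
    have -> : 1 - y * (Z j * Zi i) = Zi i * (Z i - y * Z j).
      by rewrite mulrBr [Zi i * Z i]mulrC ZZi; ring.
    by ring.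
  under [LHS]eq_bigr do rewrite big_split /=.
  rewrite big_split; congr (_ * _).
  under [LHS]eq_bigr do rewrite big_split /=.
  rewrite big_split /=.
  have -> : \prod_(i < k) \prod_(j < k | (i < j)%N) Zi j ^+ c =
     \prod_(i < k) \prod_(j < k | (j < i)%N) Zi i ^+ c.
    under eq_bigr do rewrite big_mkcond /=.
    by rewrite exchange_big /=; apply: eq_bigr => j _; rewrite [RHS]big_mkcond.
  rewrite -big_split; apply: eq_bigr => i _ /=.
  by rewrite !prodr_const -exprD -!sum1_card card_gt_lt -exprM.
rewrite /dyson; set P := \prod_(i < k) \prod_(j < k | _) _.
have N : (M + c.-1 = a + b)%N by lia.
rewrite N.
transitivity (\prod_i ((\prod_(l < a) (1 - phi (q ^+ l) * Zi i)) *
     (\prod_(l < b) (1 - phi (q ^+ l.+1) * Z i)) * Mo i * Zi i ^+ (c * k.-1)) * P).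
  by rewrite !big_split /=; ring.
transitivity (\prod_i (phi (level_sign q b) * Zi i ^+ (M + c * k.-1) *
    \prod_(l < a + b) (Z i - phi ((q ^+ b)^-1 * q ^+ l))) * P).
  congr (_ * P); apply: eq_bigr => i _.
  by rewrite poch_inverse poch_direct poch_merge exprD -hMo; ring.
by rewrite !big_split /= prodr_const card_ord rmorphXn; ring.
Qed.
End LevelKernel.

(** * Induction over the levels *)

Lemma zlevel_ord (V : choiceType) (k : nat -> nat) (z : nat -> nat -> V) s x :
  zlevel z k s x <-> exists i : 'I_(k s), x = z s i.+1.
Proof.
split=> [[i hi ->]|[i ->]].
  have h : (i.-1 < k s)%N by lia.
  by exists (Ordinal h) => /=; rewrite prednK //; case/andP: hi.
by exists i.+1 => //; rewrite ltn_ord.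
Qed.

Section Variables.
Context {V : choiceType} (n : nat) (k : nat -> nat) (z : nat -> nat -> V).
Hypothesis hz : forall s i s' i',
  (1 <= s <= n.+1)%N -> (1 <= i <= k s)%N ->
  (1 <= s' <= n.+1)%N -> (1 <= i' <= k s')%N ->
  z s i = z s' i' -> s = s' /\ i = i'.

(** Level n + 1 is included although it is not integrated out, since the last denominators contain
    its variables. *)
Definition zseq : seq V := undup [seq z s i | s <- iota 1 n.+1, i <- iota 1 (k s)].

Definition zlev (x : V) : nat := xget 0%N [set s | (1 <= s <= n.+1)%N /\
  exists i, (1 <= i <= k s)%N /\ x = z s i].

Lemma zseqP x : reflect (exists s i, [/\ (1 <= s <= n.+1)%N, (1 <= i <= k s)%N & x = z s i])
  (x \in zseq).
Proof.
rewrite mem_undup; apply: (iffP allpairsPdep) => [[s [i [hs hi ->]]]|[s [i [hs hi ->]]]].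
  by exists s, i; split=> //; move: hs hi; rewrite !mem_iota; lia.
by exists s, i; split=> //; rewrite mem_iota; lia.
Qed.

Lemma zlevE s i : (1 <= s <= n.+1)%N -> (1 <= i <= k s)%N -> zlev (z s i) = s.
Proof.
move=> hs hi; apply: xget_unique => [|s' [hs' [i' [hi' e]]]]; first by split=> //; exists i.
by have [] := hz hs hi hs' hi' e.
Qed.

Lemma lvl_unit x y : y \in zseq ->
  lvl zseq zlev x << y >> = (y == x)%:R + ((x \in zseq) && (zlev y < zlev x)%N)%:R.
Proof.
move=> hy; rewrite /lvl mcoeffU; congr (_ + _).
have [h|h] := boolP ((x \in zseq) && (zlev y < zlev x)%N).
  rewrite big_mkcond (bigD1_seq y) ?undup_uniq //= h mcoeffUU big1 ?addr0 // => t ht.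
  by rewrite mcoeffU eq_sym (negPf ht) if_same.
rewrite big1 // => t ht; rewrite mcoeffU; case: eqP => // e.
by rewrite -e (negPf h) in ht.
Qed.

(** At x = z^(s+1)_j the exponent - 1 is compensated by z^(s)_i, which [lvl] counts because its
    level is lower; at higher levels the two contributions cancel. *)
Lemma lvl_ratio s i j x : (1 <= s <= n)%N -> (1 <= i <= k s)%N -> (1 <= j <= k s.+1)%N ->
  0 <= lvl zseq zlev x (<< z s i >> - << z s.+1 j >>).
Proof.
move=> hs hi hj; have hs1 : (1 <= s <= n.+1)%N by lia.
have hs2 : (1 <= s.+1 <= n.+1)%N by lia.
have u1 : z s i \in zseq by apply/zseqP; exists s, i.
have u2 : z s.+1 j \in zseq by apply/zseqP; exists s.+1, j.
rewrite lvlB !lvl_unit // !zlevE //.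
case: (z s.+1 j =P x) => [<-|_].
  rewrite u2 /= zlevE // ltnSn ltnn /=; case: (_ == _) => //.
by case: (_ == _); case: (x \in zseq); case: ltnP => h1; case: ltnP => h2 //=; lia.
Qed.
End Variables.

(** The hypothesis at s and at s - 1 makes both truncated subtractions in [Aidx] exact. *)
Lemma Aidx_rec n c a (b : nat -> nat) s :
  (forall t, (1 <= t <= n)%N -> (t * c <= a + sigma b t + t)%N) -> (1 <= s <= n)%N ->
  (Aidx a c b s + c = Aidx a c b s.-1 + b s + 1)%N.
Proof.
move=> hab hs; have h1 := hab _ hs; rewrite /Aidx.
case: s hs h1 => // s hs h1; rewrite /=.
have e : sigma b s.+1 = (sigma b s + b s.+1)%N by rewrite /sigma big_nat_recr.
have h2 : (s * c <= a + sigma b s + s)%N.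
  by case: s hs {h1 e} => // s hs; apply: hab; lia.
by move: h1; rewrite e mulSn; lia.
Qed.

Section Levels.
Variables (K : fieldType) (q : K).
Hypothesis q_neq0 : q != 0.
Hypothesis q_generic : forall n u v : nat, (0 < n)%N -> (0 < u)%N -> (0 < v)%N ->
  u%:R * q ^+ n != v%:R.
Context {V : choiceType} (n c : nat) (k : nat -> nat) (a : nat) (b : nat -> nat)
  (z : nat -> nat -> V) (m : nat -> nat) (X Y : nat -> nat -> set V)
  (P : nat -> nat -> {malg rat[{cmonom nat}]}) (w : nat -> nat -> nat).
Hypothesis hc : (0 < c)%N.
Hypothesis hk : forall s, (1 <= s <= n)%N -> (k s.+1 <= k s)%N.
Hypothesis hz : forall s i s' i',
  (1 <= s <= n.+1)%N -> (1 <= i <= k s)%N ->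
  (1 <= s' <= n.+1)%N -> (1 <= i' <= k s')%N ->
  z s i = z s' i' -> s = s' /\ i = i'.
Hypothesis hX : forall s j, (1 <= s <= n)%N -> (1 <= j <= m s)%N ->
  X s j `&` zvars z k n = set0.
Hypothesis hY : forall s j, (1 <= s <= n)%N -> (1 <= j <= m s)%N ->
  Y s j `&` zvars z k n = set0.
Hypothesis hP : forall s j, (1 <= s <= n)%N -> (1 <= j <= m s)%N ->
  forall t, t \in msupp (P s j) -> sumn (parts t) = w s j.
Hypothesis hdeg : forall s, (1 <= s <= n)%N ->
  (\sum_(1 <= j < (m s).+1) w s j <= k s - k s.+1)%N.
Hypothesis hab : forall s, (1 <= s <= n)%N -> (s * c <= a + sigma b s + s)%N.

Local Notation R := (@gser K V (zseq n k z) (zlev n k z)).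
Local Notation gmon := (@gmon K V (zseq n k z) (zlev n k z)).
Local Notation gcst := (@gcst K V (zseq n k z) (zlev n k z)).

(** A total version of [ggeom], so that products over natural indices can be written without proofs
    inside. For the ratios in the integrand the fallback 0 is never taken, by [lvl_ratio]. *)
Definition ggeomT (d : K) (u : {malg int[V]}) : R :=
  match pselect (forall x, 0 <= lvl (zseq n k z) (zlev n k z) x u) with
  | left h => ggeom d h
  | right _ => 0
  end.

Lemma ggeomTE d u (h : forall x, 0 <= lvl (zseq n k z) (zlev n k z) x u) :
  ggeomT d u = ggeom d h.
Proof. by rewrite /ggeomT; case: pselect => // h'; congr ggeom; exact: Prop_irrelevance. Qed.

Definition gpoch (d : K) u e : R := \prod_(l < e) (1 - gmon (d * q ^+ l) u).
Definition gpochV (d : K) u e : R := \prod_(l < e) ggeomT (d * q ^+ l) u.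

(* The s-th factor of the integrand without its (1/z)_a part. *)
Definition gfactor s : R :=
  (\prod_(1 <= i < (k s).+1) gpoch q << z s i >> (b s)) *
  (\prod_(1 <= i < (k s).+1) \prod_(i.+1 <= j < (k s).+1)
     (gpoch 1 (<< z s i >> - << z s j >>) c * gpoch q (<< z s j >> - << z s i >>) c)) *
  (\prod_(1 <= i < (k s).+1) gmon 1 (- << (b s)%:Z + 1 - c%:Z *g z s i >>)) *
  (\prod_(1 <= j < (k s.+1).+1) \prod_(1 <= i < (k s).+1)
     gpochV (q ^ ((b s)%:Z + 1 - c%:Z)) (<< z s i >> - << z s.+1 j >>) c).

Definition gfront s e : R := \prod_(1 <= i < (k s).+1) gpoch 1 (- << z s i >>) e.

Definition zpow s r : R := \sum_(1 <= i < (k s).+1) gmon 1 << z s i >> ^+ r.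

Definition pl_in s j : R := gsubst (fun r => zpow s r * gpow (Y s j) r + gpow (X s j) r) (P s j).

Let Mi s := Aidx a c b s.
Let pis s r : K := pspec q (q ^+ b s) c (Mi s) r.

Definition pl_out s j : R :=
  gsubst (fun r => gcst (pis s r) * gpow (Y s j) r + gpow (X s j) r) (P s j).

Definition level_cst s : K := level_sign q (b s) ^+ k s *
  gcoef q (q ^+ b s) c (Mi s) (fun _ : 'I_(k s) => 0%N).

Lemma prod_nat_ord (A : comNzRingType) e (F : nat -> A) :
  \prod_(1 <= i < e.+1) F i = \prod_(i < e) F i.+1.
Proof. by rewrite big_add1 big_mkord. Qed.

Lemma prod_nat_ord2 (A : comNzRingType) e (F : nat -> nat -> A) :
  \prod_(1 <= i < e.+1) \prod_(i.+1 <= j < e.+1) F i j =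
  \prod_(i < e) \prod_(j < e | (i < j)%N) F i.+1 j.+1.
Proof.
rewrite prod_nat_ord; apply: eq_bigr => i _.
by rewrite big_add1 big_geq_mkord.
Qed.

Let Mi_rec s (hs : (1 <= s <= n)%N) : (Mi s + c = Mi s.-1 + b s + 1)%N :=
  Aidx_rec hab hs.

Section OneStep.
Variable s : nat.
Hypothesis hs : (1 <= s <= n)%N.
Let zs (i : 'I_(k s)) : V := z s i.+1.
Let ws (j : 'I_(k s.+1)) : V := z s.+1 j.+1.

Let hs1 : (1 <= s <= n.+1)%N. Proof. lia. Qed.
Let hs2 : (1 <= s.+1 <= n.+1)%N. Proof. lia. Qed.
Let zi (e : nat) (i : 'I_e) : (1 <= i.+1 <= e)%N. Proof. exact: ltn_ord. Qed.

Let zs_inj : injective zs.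
Proof. by move=> i j /(hz hs1 (zi i) hs1 (zi j))[_ []] /val_inj. Qed.
Let zws i j : zs i != ws j.
Proof. by apply/eqP => /(hz hs1 (zi i) hs2 (zi j))[]; lia. Qed.
Let lvlzw i j x : 0 <= lvl (zseq n k z) (zlev n k z) x (<< zs i >> - << ws j >>).
Proof. by apply: lvl_ratio. Qed.

Let kern : R := dyson q (q ^+ b s) c (Mi s) gcst (fun i => gmon 1 << zs i >>) *
  \prod_i gmon 1 (- << zs i >>) ^+ (Mi s + c * (k s).-1).

Lemma cauchy_inv_nat :
  \prod_(1 <= j < (k s.+1).+1) \prod_(1 <= i < (k s).+1)
     gpochV (q ^ ((b s)%:Z + 1 - c%:Z)) (<< z s i >> - << z s.+1 j >>) c =
  cauchy_inv q (q ^+ b s) c lvlzw.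
Proof.
rewrite prod_nat_ord; apply: eq_bigr => j _; rewrite prod_nat_ord; apply: eq_bigr => i _.
(* The Pochhammer symbol lists q ^ (b + 1 - c), ..., q ^ b upwards, the letters q ^ (b - l) list
   them downwards. *)
rewrite /gpochV (reindex_inj rev_ord_inj); apply: eq_bigr => l _ /=.
rewrite (ggeomTE _ (lvlzw i j)).
suff -> : q ^ ((b s)%:Z + 1 - c%:Z) * q ^+ (c - l.+1) = q ^+ b s * q ^- l by [].
have hl := ltn_ord l; rewrite exprnN !exprnP -!expfzDr //; congr (_ ^ _); lia.
Qed.

Lemma gfactor_kernel : gfront s (Mi s.-1) * gfactor s =
  gcst (level_sign q (b s) ^+ k s) * (kern * cauchy_inv q (q ^+ b s) c lvlzw).
Proof.
have ZZi i : gmon 1 << zs i >> * gmon 1 (- << zs i >>) = 1.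
  by rewrite gmonM mulr1 subrr.
have hMo i : gmon 1 (- << zs i >>) ^+ Mi s.-1 * gmon 1 (- << (b s)%:Z + 1 - c%:Z *g zs i >>) =
    gmon 1 (- << zs i >>) ^+ Mi s.
  rewrite !gmonX !expr1n gmonM mulr1; congr gmon.
  rewrite !mulNrn -!monalgUMn -opprD -monalgUD !natz; congr (- << _ *g _ >>).
  have := Mi_rec hs; lia.
rewrite /gfactor cauchy_inv_nat [RHS]mulrA [LHS]mulrA; congr (_ * _).
rewrite /kern -(level_kernel gcst q_neq0 ZZi hc (Mi_rec hs) hMo).
rewrite /gfront prod_nat_ord2 !prod_nat_ord !mulrA -big_split /=.
apply: (congr2 *%R) => [|//]; apply: (congr2 *%R); apply: eq_bigr => i _.
  apply: (congr2 *%R); apply: eq_bigr => l _; first by rewrite gcst_gmon mul1r.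
  by rewrite gcst_gmon exprS.
apply: eq_bigr => j _; apply: (congr2 *%R); apply: eq_bigr => l _.
  by rewrite gmonM mulr1 gcst_gmon mul1r.
by rewrite gmonM mulr1 gcst_gmon exprS.
Qed.

Let S : set V := [set x | exists i, x = zs i].

Lemma zlevelS : zlevel z k s = S.
Proof. by apply/seteqP; split=> x /zlevel_ord. Qed.

Lemma zlevel_sub : zlevel z k s `<=` zvars z k n.
Proof. by move=> x hx; exists s. Qed.

Lemma free_gpow (T : set V) r : T `&` zvars z k n = set0 ->
  supp_in (sfree S) (gpow T r : R).
Proof.
move=> hT; apply: supp_gpow => x hx; apply: sfreeU => hS.
have : (T `&` zvars z k n) x by split=> //; apply: zlevel_sub; rewrite zlevelS.
by rewrite hT.
Qed.

(** The output has the shape of the next input: the front factor moves from level s with [Mi s.-1]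
    to level s.+1 with [Mi s]. *)
Lemma one_step :
  gct (zlevel z k s) ((\prod_(1 <= j < (m s).+1) pl_in s j) *
    (gfront s (Mi s.-1) * gfactor s)) =
  gcst (level_cst s) * (\prod_(1 <= j < (m s).+1) pl_out s j) * gfront s.+1 (Mi s).
Proof.
rewrite gfactor_kernel zlevelS mulrCA gctM; last first.
  by apply: supp_in_mon; apply: sfree0.
set Lam := @level_ct K V _ _ q (q ^+ b s) (k s) (k s.+1) c (Mi s) zs ws lvlzw.
transitivity (gcst (level_sign q (b s) ^+ k s) * Lam (\prod_(1 <= j < (m s).+1) pl_in s j)).
  by [].
pose Lam0 : R := gcst (gcoef q (q ^+ b s) c (Mi s) (fun _ : 'I_(k s) => 0%N)) *
   \prod_j \prod_(l < Mi s) (1 - gmon (q ^+ l) (- << ws j >>)).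
have LamD : {morph Lam : x y / x + y} by move=> x y; rewrite /Lam /level_ct mulrDl gctD.
have LamM (x y : R) : supp_in (sfree S) x -> Lam (x * y) = x * Lam y.
  by move=> hx; rewrite /Lam /level_ct -mulrA gctM.
have Lamp mu : all (leq 1) mu -> (sumn mu <= k s - k s.+1)%N ->
    Lam (\prod_(r <- mu) zpow s r) = Lam0 * \prod_(r <- mu) gcst (pis s r).
  move=> h1 h2; have := @level_ct_powersums K V _ _ q (q ^+ b s) _ _ c (Mi s) zs ws hc q_neq0
    (expf_neq0 _ q_neq0) q_generic zs_inj zws lvlzw mu h1.
  have h3 : (sumn mu + k s.+1 <= k s)%N by have := hk hs; lia.
  move/(_ h3); rewrite rmorphM rmorph_prod mulrAC => <-; congr Lam.
  by apply: eq_bigr => r _; rewrite /zpow big_add1 big_mkord.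
have H : hom Lam Lam0 (zpow s) (fun r => gcst (pis s r)) (k s - k s.+1)
    (\sum_(1 <= j < (m s).+1) w s j)
    (\prod_(1 <= j < (m s).+1) pl_in s j) (\prod_(1 <= j < (m s).+1) pl_out s j).
  apply: hom_prod => j; rewrite mem_index_iota => hj.
  apply: (@hom_gsubst K V _ _ (supp_in (sfree S)) Lam Lam0 (zpow s)
    (fun r => gcst (pis s r)) _ LamD LamM _ (gpow (X s j)) (gpow (Y s j))) => [d|r|r|t].
  - by apply: supp_in_mon; apply: sfree0.
  - exact/free_gpow/hX.
  - exact/free_gpow/hY.
  - exact: hP.
have E := Lam_hom Lamp H (hdeg hs).
rewrite E /Lam0.
have -> : \prod_j \prod_(l < Mi s) (1 - gmon (q ^+ l) (- << ws j >>)) =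
    gfront s.+1 (Mi s).
  rewrite /gfront prod_nat_ord; apply: eq_bigr => j _; apply: eq_bigr => l _.
  by rewrite mul1r.
have -> : gcst (level_cst s) = gcst (level_sign q (b s) ^+ k s) *
    gcst (gcoef q (q ^+ b s) c (Mi s) (fun _ : 'I_(k s) => 0%N)).
  by rewrite /level_cst rmorphM.
by rewrite -!mulrA; congr (_ * (_ * _)); rewrite mulrC.
Qed.

End OneStep.
Section Free.
Variable T : set V.
Let free (F : R) := supp_in (sfree T) F.
Let fprod := @supp_in_prod K V (zseq n k z) (zlev n k z) (sfree T) (@sfree0 V T) (@sfreeD V T).
Let fsum := @supp_in_sum K V (zseq n k z) (zlev n k z) (sfree T).
Let fmulr := @supp_in_mul K V (zseq n k z) (zlev n k z) (sfree T) (@sfreeD V T).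

Lemma free_cst x : free (gcst x). Proof. by apply: supp_in_mon; apply: sfree0. Qed.

Lemma free_gsubst p Q : (forall r, free (p r)) -> free (gsubst p Q).
Proof.
move=> hp; apply: fsum => t _; apply: fmulr; first exact: free_cst.
by apply: fprod => r _; apply: hp.
Qed.

Lemma free_pow (U : set V) r : U `&` T = set0 -> free (gpow U r).
Proof.
move=> hU; apply: supp_gpow => x hx; apply: sfreeU => hT.
have : (U `&` T) x by split.
by rewrite hU.
Qed.

Lemma free_gpoch d u e : sfree T u -> free (gpoch d u e).
Proof.
move=> hu; apply: fprod => l _; apply: supp_inD; first exact: free_cst.
by apply: supp_inN; apply: supp_in_mon.
Qed.

Lemma free_gpochV d u e : sfree T u -> free (gpochV d u e).
Proof.
move=> hu; apply: fprod => l _; rewrite /ggeomT; case: pselect => [h|_].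
  by apply: supp_ggeom => r x hx; rewrite mcoeffMn hu // mul0rn.
exact: supp_in0.
Qed.

Lemma free_gfactor s : (forall i, (1 <= i <= k s)%N -> ~ T (z s i)) ->
  (forall i, (1 <= i <= k s.+1)%N -> ~ T (z s.+1 i)) -> free (gfactor s).
Proof.
move=> h1 h2.
have u1 i (e : int) : (1 <= i <= k s)%N -> sfree T << e *g z s i >>.
  by move=> hi; apply: sfreeU; apply: h1.
have u2 i (e : int) : (1 <= i <= k s.+1)%N -> sfree T << e *g z s.+1 i >>.
  by move=> hi; apply: sfreeU; apply: h2.
have r1 i : (1 <= i < (k s).+1)%N -> (1 <= i <= k s)%N by lia.
rewrite /gfactor !big_nat; apply: fmulr; [apply: fmulr; [apply: fmulr|]|].
- by apply: fprod => i /r1 hi; apply: free_gpoch; apply: u1.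
- apply: fprod => i /r1 hi; rewrite big_nat; apply: fprod => j hj.
  have hj' : (1 <= j <= k s)%N by lia.
  by apply: fmulr; apply: free_gpoch; apply: sfreeB; apply: u1.
- apply: fprod => i /r1 hi; apply: supp_in_mon => x hx.
  by rewrite mcoeffN u1 ?oppr0.
- apply: fprod => j hj; rewrite big_nat; apply: fprod => i /r1 hi.
  by apply: free_gpochV; apply: sfreeB; [apply: u1 | apply: u2; lia].
Qed.
End Free.

Lemma zvars_sub t : (t <= n)%N -> zvars z k t `<=` zvars z k n.
Proof. by move=> ht x [s /= hs hx]; exists s => //=; lia. Qed.

Lemma zvars_notin t s i : (t <= n)%N -> (t < s <= n.+1)%N -> (1 <= i <= k s)%N ->
  ~ zvars z k t (z s i).
Proof.
move=> ht hs hi [s' /= hs' [i' hi' e]].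
have [] := hz _ hi _ hi' e; [lia|lia|lia].
Qed.

Lemma zvarsS t : zvars z k t.+1 = zlevel z k t.+1 `|` zvars z k t.
Proof.
apply/seteqP; split=> x.
  move=> [s /= hs hx]; have [e|ne] := eqVneq s t.+1; first by left; rewrite -e.
  by right; exists s => //=; lia.
case=> [hx|[s /= hs hx]]; first by exists t.+1 => //=; lia.
by exists s => //=; lia.
Qed.

Lemma disjointW (U : set V) t : (t <= n)%N -> U `&` zvars z k n = set0 ->
  U `&` zvars z k t = set0.
Proof.
move=> ht hU; apply/seteqP; split=> x // -[h1 h2].
by rewrite -hU; split=> //; apply: zvars_sub h2.
Qed.

(** The factors of level t + 1 contain no variable of a lower level and leave the inner constant
    term. The front factor left by the induction hypothesis then completes level t + 1 for
    [one_step]. *)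
Lemma all_levels t : (t <= n)%N ->
  gct (zvars z k t) (gfront 1 a *
    \prod_(1 <= s < t.+1) ((\prod_(1 <= j < (m s).+1) pl_in s j) * gfactor s)) =
  gcst (\prod_(1 <= s < t.+1) level_cst s) *
  (\prod_(1 <= s < t.+1) \prod_(1 <= j < (m s).+1) pl_out s j) * gfront t.+1 (Mi t).
Proof.
elim: t => [|t IH] ht.
  rewrite !big_geq // gct_id; last by move=> e _ x [s /=]; lia.
  by rewrite mulr1 rmorph1 !mul1r /Mi /Aidx /sigma big_geq // addn0 addn0 mul0n subn0.
have hs : (1 <= t.+1 <= n)%N by lia.
have htn : (t <= n)%N by lia.
set T := (\prod_(1 <= j < (m t.+1).+1) pl_in t.+1 j) * gfactor t.+1.
rewrite big_nat_recr //= -/T mulrA [_ * T]mulrC zvarsS gctU gctM; last first.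
  apply: supp_in_mul; [exact: sfreeD| |].
    rewrite big_nat; apply: supp_in_prod; [exact: sfree0|exact: sfreeD|] => j hj.
    apply: free_gsubst => r; apply: supp_inD.
      apply: supp_in_mul; [exact: sfreeD| |].
        rewrite /zpow big_nat; apply: supp_in_sum => i hi.
        apply: supp_inX; [exact: sfree0|exact: sfreeD|].
        apply: supp_in_mon; apply: sfreeU; apply: zvars_notin => //; lia.
      by apply: free_pow; apply: disjointW => //; apply: hY.
    by apply: free_pow; apply: disjointW => //; apply: hX.
  by apply: free_gfactor => i hi; apply: zvars_notin => //; lia.
rewrite {}IH //; set C := gcst _; set Q := \prod_(1 <= s < t.+1) _.
have -> : T * (C * Q * gfront t.+1 (Mi t)) = (C * Q) *
   ((\prod_(1 <= j < (m t.+1).+1) pl_in t.+1 j) * (gfront t.+1 (Mi t) * gfactor t.+1)).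
  by rewrite /T; ring.
rewrite gctM; last first.
  apply: supp_in_mul; [exact: sfreeD|exact: free_cst|].
  rewrite /Q big_nat; apply: supp_in_prod; [exact: sfree0|exact: sfreeD|] => s hs'.
  rewrite big_nat; apply: supp_in_prod; [exact: sfree0|exact: sfreeD|] => j hj.
  have hd (U : set V) : U `&` zvars z k n = set0 -> U `&` zlevel z k t.+1 = set0.
    move=> hU; apply/seteqP; split=> x // -[h1 h2].
    by rewrite -hU; split=> //; exists t.+1.
  apply: free_gsubst => r; apply: supp_inD.
    apply: supp_in_mul; [exact: sfreeD|exact: free_cst|].
    by apply/free_pow/hd/hY; lia.
  by apply/free_pow/hd/hX; lia.
have eC : gcst (\prod_(1 <= s < t.+2) level_cst s) = C * gcst (level_cst t.+1).
  by rewrite big_nat_recr //= rmorphM.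
have eQ : \prod_(1 <= s < t.+2) \prod_(1 <= j < (m s).+1) pl_out s j =
    Q * \prod_(1 <= j < (m t.+1).+1) pl_out t.+1 j by rewrite big_nat_recr.
by rewrite eC eQ (one_step hs); ring.
Qed.

End Levels.

(** * Translation of the statement into the ring *)

Section Integrand.
Variables (K : fieldType) (q : K).
Context {V : choiceType} (n c : nat) (k : nat -> nat) (a : nat) (b : nat -> nat)
  (z : nat -> nat -> V).
Local Notation R := (@gser K V (zseq n k z) (zlev n k z)).
Local Notation gmon := (@gmon K V (zseq n k z) (zlev n k z)).
Local Notation gpoch := (@gpoch K q V n k z).
Local Notation gpochV := (@gpochV K q V n k z).

Definition gintegrand s : R :=
  (\prod_(1 <= i < (k s).+1)
     (gpoch 1 (- << z s i >>) (if s == 1%N then a else 0%N) * gpoch q << z s i >> (b s))) *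
  (\prod_(1 <= i < (k s).+1) \prod_(i.+1 <= j < (k s).+1)
     (gpoch 1 (<< z s i >> - << z s j >>) c * gpoch q (<< z s j >> - << z s i >>) c)) *
  (\prod_(1 <= i < (k s).+1) gmon 1 (- << (b s)%:Z + 1 - c%:Z *g z s i >>)) *
  (\prod_(1 <= j < (k s.+1).+1) \prod_(1 <= i < (k s).+1)
     gpochV (q ^ ((b s)%:Z + 1 - c%:Z)) (<< z s i >> - << z s.+1 j >>) c).

Lemma gintegrand_front s : gintegrand s =
  gfront q n k z s (if s == 1%N then a else 0%N) * gfactor q n c k b z s.
Proof. by rewrite /gintegrand /gfactor /gfront big_split /= -!mulrA. Qed.

Lemma prod_gintegrand (F : nat -> R) : (1 <= n)%N ->
  (\prod_(1 <= s < n.+1) F s) * (\prod_(1 <= s < n.+1) gintegrand s) =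
  gfront q n k z 1 a * \prod_(1 <= s < n.+1) (F s * gfactor q n c k b z s).
Proof.
move=> hn; rewrite [in RHS]big_split /= (eq_bigr _ (fun s _ => gintegrand_front s)).
rewrite big_split /= mulrA [in RHS]mulrCA mulrA; congr (_ * _ * _).
rewrite big_ltn //= big_nat big1 ?mulr1 // => s hs.
have -> : (s == 1%N) = false by apply/negbTE; lia.
by rewrite /gfront big1 // => i _; rewrite /gpoch big_ord0.
Qed.

Lemma level_cst_prod (e : nat -> int) (e' : nat -> int) (F : nat -> K) r : q != 0 ->
  \prod_(1 <= s < r) ((-1) ^ e s * q ^ e' s * F s) =
  (-1) ^ (\sum_(1 <= s < r) e s) * q ^ (\sum_(1 <= s < r) e' s) * \prod_(1 <= s < r) F s.
Proof.
move=> q0; rewrite !big_split /=; congr (_ * _ * _); symmetry.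
  by apply: (big_morph (fun x : int => (-1 : K) ^ x)) => // x y;
  rewrite expfzDr // oppr_eq0 oner_eq0.
by apply: (big_morph (fun x : int => q ^ x)) => // x y; rewrite expfzDr.
Qed.
End Integrand.

Section GvalPlethysm.
Context {V : choiceType} (D : seq V) (lev : V -> nat).
Local Notation R := (@gser Qq V D lev).
Local Notation gmon := (@gmon Qq V D lev).

Lemma fscale_gval d (F : R) : fscale d (gval F) = gval (gcst d * F).
Proof. by apply/funext => e; rewrite gval_gcst. Qed.

Lemma plethp_affine r (d : Qq) (S T : set V) : (0 < r)%N ->
  plethp r (fadd (fscale d (falph S)) (falph T)) =
  gval (gcst (qsubst r d) * gpow S r + gpow T r : R).
Proof.
move=> r0; rewrite plethpD //.
have -> : fscale d (falph S) = fmul (fmon d 0) (fpow S 1).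
  exact: (fscale_gval d (gpow S 1)).
by rewrite plethp_fmon // falph_fpow !plethp_fpow // mul0rn.
Qed.

Lemma plethp_letters r (s : seq nat) (x : nat -> V) (S T : set V) : (0 < r)%N ->
  plethp r (fadd (fmul (gval (\sum_(i <- s) gmon 1 << x i >> : R)) (falph S)) (falph T)) =
  gval ((\sum_(i <- s) gmon 1 << x i >> ^+ r) * gpow S r + gpow T r : R).
Proof.
move=> r0; rewrite plethpD //.
rewrite [plethp r (fmul _ _)](plethp_sum_fmon r0 s (fun=> 1) (fun i => << x i >>)
  (gpow S 1 : R)) !falph_fpow /= !plethp_fpow //.
apply: (congr2 (@fadd Qq V)) => //; apply: (congr2 (@fmul Qq V)) => //.
apply: (congr1 (@gval _ _ _ _)); apply: eq_bigr => i _.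
by rewrite gmonX expr1n; congr gmon; apply: (rmorph1 (qsub r0)).
Qed.
End GvalPlethysm.

Section GvalFactors.
Context {V : choiceType} (n : nat) (k : nat -> nat) (z : nat -> nat -> V).
Hypothesis hz : forall s i s' i',
  (1 <= s <= n.+1)%N -> (1 <= i <= k s)%N ->
  (1 <= s' <= n.+1)%N -> (1 <= i' <= k s')%N ->
  z s i = z s' i' -> s = s' /\ i = i'.
Local Notation R := (@gser Qq V (zseq n k z) (zlev n k z)).
Local Notation gmon := (@gmon Qq V (zseq n k z) (zlev n k z)).

Lemma fpoch_gval d u e : fpoch d u e = gval (@gpoch Qq q V n k z d u e).
Proof.
rewrite gval_prod; apply: eq_bigr => l _; apply/funext => v.
rewrite gvalDE gvalNE /= /fadd /fmon; congr (_ + _).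
by case: ifP; rewrite ?oppr0.
Qed.

Lemma fpochV_gval d s i j e : (1 <= s <= n)%N -> (1 <= i <= k s)%N -> (1 <= j <= k s.+1)%N ->
  fpochV d (<< z s i >> - << z s.+1 j >>) e =
  gval (@gpochV Qq q V n k z d (<< z s i >> - << z s.+1 j >>) e).
Proof.
move=> hs hi hj; rewrite gval_prod; apply: eq_bigr => l _.
by rewrite (ggeomTE _ (fun x => lvl_ratio hz x hs hi hj)).
Qed.

Lemma falph_zlevel s : (1 <= s <= n.+1)%N ->
  falph (zlevel z k s) = gval (\sum_(1 <= i < (k s).+1) gmon 1 << z s i >> : R).
Proof.
move=> hs; rewrite falph_fpow big_add1 big_mkord.
have zi (i : 'I_(k s)) : (1 <= i.+1 <= k s)%N by exact: ltn_ord.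
rewrite (_ : fpow _ _ = gval (gpow (zlevel z k s) 1 : R)) //.
rewrite (@gpow_sum _ _ _ _ _ (fun i : 'I_(k s) => z s i.+1)) //.
  by move=> i j /(hz hs (zi i) hs (zi j))[_ []] /val_inj.
  by move=> x; apply: zlevel_ord.
Qed.

Lemma fintegrand_gval c a b s : (1 <= s <= n)%N ->
  ((\fprod_(1 <= i < (k s).+1)
           (fpoch 1 (- << z s i >>) (if s == 1%N then a else 0%N) *s
            fpoch q << z s i >> (b s)))
        *s
        (\fprod_(1 <= i < (k s).+1) \fprod_(i.+1 <= j < (k s).+1)
           (fpoch 1 (<< z s i >> - << z s j >>) c *s
            fpoch q (<< z s j >> - << z s i >>) c))
        *s
        (\fprod_(1 <= i < (k s).+1)
           fmon 1 (- << (b s)%:Z + 1 - c%:Z *g z s i >>))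
        *s
        (\fprod_(1 <= j < (k s.+1).+1) \fprod_(1 <= i < (k s).+1)
           fpochV (q ^ ((b s)%:Z + 1 - c%:Z))
                  (<< z s i >> - << z s.+1 j >>) c))%S =
  gval (gintegrand q n c k a b z s).
Proof.
move=> hs; rewrite /gintegrand 3!gvalM.
apply: (congr2 (@fmul Qq V)); [apply: (congr2 (@fmul Qq V)); [apply: (congr2 (@fmul Qq V))|]|].
- rewrite gval_prod; apply: eq_bigr => i _; rewrite gvalM; rewrite !fpoch_gval; reflexivity.
- rewrite gval_prod; apply: eq_bigr => i _; rewrite gval_prod; apply: eq_bigr => j _.
  rewrite gvalM !fpoch_gval; reflexivity.
- rewrite gval_prod; apply: eq_bigr => i _; reflexivity.
- rewrite gval_prod; apply: eq_big_nat => j hj; rewrite gval_prod; apply: eq_big_nat => i hi.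
  by apply: fpochV_gval.
Qed.
End GvalFactors.

Theorem theorem6p5 (V : choiceType) (n c : nat) (k m : nat -> nat)
    (a : nat) (b : nat -> nat) (z : nat -> nat -> V)
    (lam : nat -> nat -> seq nat) (f : nat -> nat -> fser rat nat)
    (X Y : nat -> nat -> set V)
    (hn : (1 <= n)%N) (hc : (0 < c)%N)
    (hk : forall s, (1 <= s <= n)%N -> (k s.+1 <= k s)%N)
    (hz : forall s i s' i',
        (1 <= s <= n.+1)%N -> (1 <= i <= k s)%N ->
        (1 <= s' <= n.+1)%N -> (1 <= i' <= k s')%N ->
        z s i = z s' i' -> s = s' /\ i = i')
    (hlam : forall s j, (1 <= s <= n)%N -> (1 <= j <= m s)%N ->
        is_partition (lam s j))
    (hf : forall s j, (1 <= s <= n)%N -> (1 <= j <= m s)%N ->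
        symfun (f s j) /\ homogeneous (sumn (lam s j)) (f s j))
    (hX : forall s j, (1 <= s <= n)%N -> (1 <= j <= m s)%N ->
        X s j `&` zvars z k n = set0)
    (hY : forall s j, (1 <= s <= n)%N -> (1 <= j <= m s)%N ->
        Y s j `&` zvars z k n = set0)
    (hdeg : forall s, (1 <= s <= n)%N ->
        (\sum_(1 <= j < (m s).+1) sumn (lam s j) <= k s - k s.+1)%N)
    (hab : forall s, (1 <= s <= n)%N -> (s * c <= a + sigma b s + s)%N) :
  CT (zvars z k n)
    ((\fprod_(1 <= s < n.+1) \fprod_(1 <= j < (m s).+1)
        pleth (f s j) (falph (zlevel z k s) *s falph (Y s j) +s falph (X s j)))
     *s
     \fprod_(1 <= s < n.+1)
       ((\fprod_(1 <= i < (k s).+1)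
           (fpoch 1 (- << z s i >>) (if s == 1%N then a else 0%N) *s
            fpoch q << z s i >> (b s)))
        *s
        (\fprod_(1 <= i < (k s).+1) \fprod_(i.+1 <= j < (k s).+1)
           (fpoch 1 (<< z s i >> - << z s j >>) c *s
            fpoch q (<< z s j >> - << z s i >>) c))
        *s
        (\fprod_(1 <= i < (k s).+1)
           fmon 1 (- << (b s)%:Z + 1 - c%:Z *g z s i >>))
        *s
        (\fprod_(1 <= j < (k s.+1).+1) \fprod_(1 <= i < (k s).+1)
           fpochV (q ^ ((b s)%:Z + 1 - c%:Z))
                  (<< z s i >> - << z s.+1 j >>) c)))%S
  =
  fscale
    ((-1) ^ (\sum_(1 <= s < n.+1) (k s)%:Z * ((b s)%:Z + 1 - c%:Z))
     * q ^ (\sum_(1 <= s < n.+1) (k s)%:Z * binz2 ((b s)%:Z + 2 - c%:Z))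
     * \prod_(1 <= s < n.+1) Mcst (k s) (Aidx a c b s) c.-1 c)
    ((\fprod_(1 <= s < n.+1) \fprod_(1 <= j < (m s).+1)
        pleth (f s j)
          (fscale ((q ^ (a%:Z + (sigma b s.-1)%:Z + (s%:Z - 1) * (1 - c%:Z))
                    - q ^ (c%:Z - (b s)%:Z - 1)) / (1 - q ^+ c))
             (falph (Y s j))
           +s falph (X s j)))
     *s
     \fprod_(1 <= j < (k n.+1).+1)
        fpoch 1 (- << z n.+1 j >>) (Aidx a c b n))%S.
Proof.
(* The polynomial used by [pleth] on both sides. If [xget] returned its default 0, the support would
   be empty and the weight claim vacuous. *)
pose P s j : {malg rat[{cmonom nat}]} := xget 0 [set P | psubst psum P = f s j].
have hP s j : (1 <= s <= n)%N -> (1 <= j <= m s)%N ->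
    forall t, t \in msupp (P s j) -> sumn (parts t) = sumn (lam s j).
  move=> hs hj t; have [_ hom] := hf s j hs hj.
  rewrite /P; case: xgetP => [Q _ /= eQ|_]; last by rewrite msupp0.
  by apply: psubst_homogeneous; rewrite eQ.
have main := @all_levels Qq q q_neq0 q_generic V n c k a b z m X Y P _ hc hk hz hX hY hP hdeg
  hab n (leqnn n).
have {main} := congr1 (@gval _ _ _ _) main.
rewrite -(prod_gintegrand q c a b _ hn) => main.
have L : (\fprod_(1 <= s < n.+1) \fprod_(1 <= j < (m s).+1)
        pleth (f s j) (falph (zlevel z k s) *s falph (Y s j) +s falph (X s j)))%S =
    gval (\prod_(1 <= s < n.+1) \prod_(1 <= j < (m s).+1) pl_in Qq n k z X Y P s j).
  rewrite gval_prod; apply: eq_big_nat => s hs; rewrite gval_prod; apply: eq_big_nat => j hj.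
  apply: psubst_gval => r r0; rewrite (falph_zlevel hz); last by lia.
  exact: plethp_letters.
have L2 : (\fprod_(1 <= s < n.+1) \fprod_(1 <= j < (m s).+1)
        pleth (f s j)
          (fscale ((q ^ (a%:Z + (sigma b s.-1)%:Z + (s%:Z - 1) * (1 - c%:Z))
                    - q ^ (c%:Z - (b s)%:Z - 1)) / (1 - q ^+ c))
             (falph (Y s j))
           +s falph (X s j)))%S =
    gval (\prod_(1 <= s < n.+1) \prod_(1 <= j < (m s).+1) pl_out q n c k a b z X Y P s j).
  rewrite gval_prod; apply: eq_big_nat => s hs; rewrite gval_prod; apply: eq_big_nat => j hj.
  apply: psubst_gval => r r0; rewrite (plethp_affine (zseq n k z) (zlev n k z)) //.
  have hM := Aidx_rec hab hs.
  rewrite (pspec_qsubst r0 hc hM).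
  (* The integer exponent agrees with the truncated one by [hab] at s - 1, or trivially for s =
     1. *)
  have -> : q ^ (a%:Z + (sigma b s.-1)%:Z + (s%:Z - 1) * (1 - c%:Z)) = q ^+ Aidx a c b s.-1.
    rewrite exprnP; congr (_ ^ _); rewrite /Aidx.
    have h : (s.-1 * c <= a + sigma b s.-1 + s.-1)%N.
      by case: s hs {hj hM} => // -[|s] hs //; apply: hab; lia.
    case: s hs h {hj hM} => // s hs h /=.
    rewrite -subzn // !PoszD PoszM -(addn1 s) PoszD; ring.
  have -> : q ^ (c%:Z - (b s)%:Z - 1) = q ^+ c / q ^+ (b s).+1.
    rewrite exprnN !exprnP -expfzDr ?q_neq0 //; congr (_ ^ _); lia.
  by [].
have L3 : \prod_(1 <= s < n.+1) level_cst q c k a b s =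
   (-1) ^ (\sum_(1 <= s < n.+1) (k s)%:Z * ((b s)%:Z + 1 - c%:Z))
     * q ^ (\sum_(1 <= s < n.+1) (k s)%:Z * binz2 ((b s)%:Z + 2 - c%:Z))
     * \prod_(1 <= s < n.+1) Mcst (k s) (Aidx a c b s) c.-1 c.
  rewrite -level_cst_prod ?q_neq0 //; apply: eq_bigr => s _.
  rewrite /level_cst (level_constant q_neq0 q_generic) //; congr (_ * _).
  by apply: eq_bigr => i _; rewrite !qp_qpoch.
rewrite -L3 L L2.
have -> : (\fprod_(1 <= j < (k n.+1).+1)
        fpoch 1 (- << z n.+1 j >>) (Aidx a c b n))%S =
    gval (gfront q n k z n.+1 (Aidx a c b n)).
  by rewrite gval_prod; apply: eq_bigr => i _; apply: fpoch_gval.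
rewrite -gvalM fscale_gval mulrA -main.
apply: (congr1 (CT (zvars z k n))); rewrite gvalM; apply: (congr2 (@fmul Qq V)) => //.
rewrite gval_prod; apply: eq_big_nat => s hs; exact: fintegrand_gval.
Qed.
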